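(* Let $r\ge 2$ and let $F=K_{r+2}-e$ be the graph obtained from the complete graph $K_{r+2}$ by removing one edge. Then $c_1(F)=(r-1)/r^2$.
   Context: $\mathrm{ex}(n,F)$ is the maximum number of edges in an $n$-vertex graph with no subgraph isomorphic to $F$. $h_F(n,q)$ is the minimum number of subgraphs isomorphic to $F$ in a graph with $n$ vertices and $\mathrm{ex}(n,F)+q$ edges. $t_F(n,q)$ is the smallest number of subgraphs isomorphic to $F$ in a graph obtained by adding $q$ edges to a maximum $F$-free graph on $n$ vertices. Let $q_F(n)=\max\{q: h_F(n,q')=t_F(n,q')\text{ for all } q'\le q\}$ and $c_1(F)=\liminf_{n\to\infty} q_F(n)/n$. *)

(* Defs.v *)
From mathcomp Require Import all_boot all_order all_algebra.
From mathcomp Require Import all_classical all_reals all_analysis.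
Set Implicit Arguments. Unset Strict Implicit. Unset Printing Implicit Defensive.

Definition is_graph (n : nat) (E : {set {set 'I_n}}) : bool :=
  [forall e in E, #|e| == 2].

Definition complete_graph (n : nat) : {set {set 'I_n}} :=
  [set e : {set 'I_n} | #|e| == 2].

(* Subgraphs (U, S) of the host graph E (vertex set U, edge set S included in E)
   isomorphic to the pattern graph F on 'I_k: the image of F under an
   injective vertex map phi. *)
Definition copies (k n : nat) (F : {set {set 'I_k}}) (E : {set {set 'I_n}})
  : {set ({set 'I_n} * {set {set 'I_n}})} :=
  [set US : {set 'I_n} * {set {set 'I_n}} |
     [exists phi : {ffun 'I_k -> 'I_n},
        [&& injectiveb phi,
            US.1 == phi @: [set: 'I_k],
            US.2 == (fun e : {set 'I_k} => phi @: e) @: F &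
            US.2 \subset E]]].

Definition ncopies (k n : nat) (F : {set {set 'I_k}}) (E : {set {set 'I_n}}) : nat :=
  #|copies F E|.

Definition exF (k : nat) (F : {set {set 'I_k}}) (n : nat) : nat :=
  \max_(E : {set {set 'I_n}} | is_graph E && (ncopies F E == 0)) #|E|.

(* h_F(n, q): minimum number of copies of F over n-vertex graphs with
   ex(n,F) + q edges.  The default value of the min (number of copies in K_n)
   is an upper bound for every term, so it never matters when the range is
   non-empty. *)
Definition hF (k : nat) (F : {set {set 'I_k}}) (n q : nat) : nat :=
  \big[minn/ncopies F (complete_graph n)]_(E : {set {set 'I_n}} |
      is_graph E && (#|E| == exF F n + q)) ncopies F E.

Definition tF (k : nat) (F : {set {set 'I_k}}) (n q : nat) : nat :=
  \big[minn/ncopies F (complete_graph n)]_(E0 : {set {set 'I_n}} |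
      [&& is_graph E0, ncopies F E0 == 0 & #|E0| == exF F n])
    \big[minn/ncopies F (complete_graph n)]_(E : {set {set 'I_n}} |
      [&& is_graph E, E0 \subset E & #|E| == #|E0| + q]) ncopies F E.

(* q_F(n) = max { q : h_F(n,q') = t_F(n,q') for all q' <= q }, where q ranges
   over the values for which a graph with ex(n,F)+q edges exists,
   i.e. q <= C(n,2) - ex(n,F). *)
Definition qF (k : nat) (F : {set {set 'I_k}}) (n : nat) : nat :=
  \max_(q < ('C(n, 2) - exF F n).+1 |
        [forall q' : 'I_q.+1, hF F n q' == tF F n q']) q.

Definition K_minus_e (r : nat) : {set {set 'I_r.+2}} :=
  [set e : {set 'I_r.+2} | (#|e| == 2) && (e != [set x : 'I_r.+2 | val x < 2])].

(* Main.v *)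
(* Write F = K_(r+2) - e and work with graphs as symmetric irreflexive relations, where the number of
   arcs is twice the number of edges.  Let A minimise the number of copies of F among the graphs with
   ex(n, F) + q edges, where q <= (1/r - 1/r^2 - eps) n and n is large.  As A contains few copies of F
   it contains few K_(r+1), hence by stability it is close to a complete r-partite graph; in a
   max-cut colouring call the monochromatic edges bad and the absent bichromatic pairs missing.
   Counting the copies that use exactly one bad edge, and the copies at the vertices of large bad or
   missing degree, shows that no such vertices exist.  Replacing a bad edge by a missing one then
   shows that no pair is missing, and moving a vertex to a smaller colour class shows that the
   classes are balanced.  So A contains a Turan graph, h_F(n, q) = t_F(n, q), and c_1 is at least
   1/r - 1/r^2 = (r-1)/r^2.

   Conversely, let n = r m.  An edge inside a class costs about the product of the other class
   sizes times the number of vertices outside its class, and a pair of adjacent bad edges costs one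
   more product.  A triangle-free graph with q + 1 edges put in the class of size m + 1 of the
   partition with classes m + 1, m - 1, m, ..., m has fewer copies of F than q edges added to the
   balanced partition as soon as q is a little larger than (r-1) m / r. *)

Require Import Defs.
From mathcomp Require Import all_boot all_order all_algebra.
From mathcomp Require Import zify ring lra.
Set Implicit Arguments. Unset Strict Implicit. Unset Printing Implicit Defensive.
Import Order.TTheory GRing.Theory Num.Theory.

(** The constant is a break-even point. For classes of size m = n/r, a bad edge is the only one in
    about (r-1) m^r copies (the removed pair being ordered), and at most about r m^(r-1) of these
    contain a given further vertex. Moving a vertex into a class smaller by at least two saves one
    bad edge and creates at most about q r m^(r-1) copies; conversely, unbalancing an equal
    partition costs one bad edge and saves about that many. Both meet at q r m^(r-1) = (r-1) m^r,
    that is at q = (r-1) n / r^2.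

    The obstacle is that q is linear in n, so that copies with two bad edges number about n^r, as
    many as one bad edge costs. For h = t they are never estimated in full: the exchanges compare
    only the copies through one edge or one vertex, where they are few. For the upper bound on c_1
    they have to be bounded below for every placement of the q edges, gathered in one class or
    spread over all. This goes through the transversals of the partition: the sum of their numbers
    of common neighbours has a lower bound that does not depend on the placement. *)

Lemma card_pairs (T1 T2 : finType) (P : pred T1) (Q : T1 -> pred T2) :
  #|[set p : T1 * T2 | P p.1 && Q p.1 p.2]| = \sum_(x | P x) #|[set y | Q x y]|.
Proof.
rewrite -sum1_card (eq_bigl (fun p => P p.1 && Q p.1 p.2)); last by move=> p; rewrite inE.
rewrite -(pair_big_dep P Q (fun _ _ => 1)) /=; apply: eq_bigr => x _.
by rewrite -sum1_card; apply: eq_bigl => y; rewrite inE.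
Qed.

Lemma card_pairs_in (T1 T2 : finType) (A : {set T1}) (F : T1 -> {set T2}) :
  #|[set p : T1 * T2 | (p.1 \in A) && (p.2 \in F p.1)]| = \sum_(x in A) #|F x|.
Proof.
rewrite (card_pairs (mem A) (fun x => mem (F x))); apply: eq_bigr => x _.
by apply: eq_card => y; rewrite inE.
Qed.

(** Exchange of summation: [t] is counted once for every index it belongs to. This turns families of
    copies with bounded overlap into lower bounds for [#|S|]. *)
Lemma sum_card_overlap (I T : finType) (S : {set T}) (J : pred I) (P : I -> pred T) k :
  (forall t, t \in S -> #|[set i | J i && P i t]| <= k) ->
  \sum_(i | J i) #|[set t in S | P i t]| <= k * #|S|.
Proof.
move=> H.
have -> : \sum_(i | J i) #|[set t in S | P i t]| = \sum_(t in S) #|[set i | J i && P i t]|.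
  rewrite (eq_bigr (fun i => \sum_(t in S) (P i t : nat))); last first.
    by move=> i _; rewrite -sum1dep_card big_mkcondr.
  rewrite exchange_big /=; apply: eq_bigr => t _.
  by rewrite -sum1dep_card big_mkcondr.
by rewrite mulnC -sum_nat_const; apply: leq_sum.
Qed.

(** * Graphs as relations, cliques and monochromatic arcs *)

Section Graphs.
Variable V : finType.
Implicit Types (A : rel V) (W : {set V}).

Definition graph A := symmetric A /\ irreflexive A.
Definition arcs A := [set p : V * V | A p.1 p.2].
Definition nbr A u := [set v | A u v].

Lemma card_arcs A : #|arcs A| = \sum_u #|nbr A u|.
Proof. by rewrite -(card_pairs xpredT (fun u v => A u v)). Qed.

Definition clique A W := [forall u in W, forall v in W, (u != v) ==> A u v].

Lemma cliqueP A W :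
  reflect {in W &, forall u v, u != v -> A u v} (clique A W).
Proof.
apply: (iffP forall_inP) => [H u v uW vW uv|H u uW].
  by move: (H u uW) => /forall_inP/(_ v vW)/implyP; apply.
by apply/forall_inP => v vW; apply/implyP; apply: H.
Qed.

Definition cliques A W s :=
  [set S : {set V} | [&& S \subset W, #|S| == s & clique A S]].

(** A vertex [x] together with an [s]-clique in its neighbourhood is an [s.+1]-clique with a marked
    vertex, and a clique can be marked in [s.+1] ways. *)
Lemma sum_cliques_nbr A W s : graph A ->
  \sum_(x in W) #|cliques A (W :&: nbr A x) s| <= s.+1 * #|cliques A W s.+1|.
Proof.
move=> [symA irrA].
rewrite -card_pairs_in.
set L := [set p | _].
have -> : s.+1 * #|cliques A W s.+1| =
   #|[set q : {set V} * V | (q.1 \in cliques A W s.+1) && (q.2 \in q.1)]|.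
  rewrite (card_pairs_in (cliques A W s.+1) id) mulnC -sum_nat_const.
  by apply: eq_bigr => S; rewrite inE => /and3P[_ /eqP h _].
pose g (p : V * {set V}) := (p.1 |: p.2, p.1).
have notin p : p \in L -> p.1 \notin p.2.
  rewrite !inE => /andP[_ /and3P[/subsetP h _ _]]; apply/negP => /h.
  by rewrite !inE irrA andbF.
have ginj : {in L &, injective g}.
  move=> [x S] [y S'] /notin /= h1 /notin /= h2 [e exy]; subst y; congr pair.
  by rewrite -(setU1K h1) e setU1K.
rewrite -(card_in_imset ginj); apply: subset_leq_card; apply/subsetP => q /imsetP[p pL ->].
move: (notin _ pL); move: pL; rewrite !inE /= => /andP[xW /and3P[/subsetP sub /eqP c /cliqueP cl]] nin.
rewrite eqxx /= andbT; apply/and3P; split.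
- apply/subsetP => u; rewrite !inE => /orP[/eqP->//|/sub]; by rewrite inE => /andP[].
- by rewrite cardsU1 nin c.
- apply/cliqueP => u v; rewrite !inE => /orP[/eqP->|uS] /orP[/eqP->|vS] uv.
  + by rewrite eqxx in uv.
  + by move/sub: vS; rewrite !inE => /andP[].
  + by rewrite symA; move/sub: uS; rewrite !inE => /andP[].
  + exact: cl.
Qed.

Definition arcs_in A W := [set p in arcs A | (p.1 \in W) && (p.2 \in W)].

Lemma card_arcs_in A W : #|arcs_in A W| = \sum_(u in W) #|W :&: nbr A u|.
Proof.
rewrite -(card_pairs_in W (fun u => W :&: nbr A u)); apply: eq_card => p.
by rewrite !inE; do !case: (_ \in _); rewrite ?andbT ?andbF.
Qed.

(** Colours are natural numbers, so that the induction in [clique_stability] can add the fresh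
    colour [s.+1] without a change of type. *)
Definition mono_in A (c : V -> nat) W := [set p in arcs_in A W | c p.1 == c p.2].

End Graphs.

(** * Stability for cliques *)

Section FurediStep.
Variables (V : finType) (A : rel V).
Hypothesis gA : graph A.
Implicit Types W X Y : {set V}.

Definition arcs_between X Y := \sum_(u in X) #|Y :&: nbr A u|.

Lemma arcs_betweenC X Y : arcs_between X Y = arcs_between Y X.
Proof.
have [symA _] := gA.
rewrite /arcs_between.
have E Z u : #|Z :&: nbr A u| = \sum_(v in Z) (A u v : nat).
  rewrite -sum1_card big_mkcond [RHS]big_mkcond; apply: eq_bigr => v _.
  by rewrite !inE; do !case: ifP; case: (v \in Z); case: (A u v).
rewrite (eq_bigr _ (fun u _ => E Y u)) (eq_bigr _ (fun u _ => E X u)).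
by rewrite exchange_big; apply: eq_bigr => u _; apply: eq_bigr => v _; rewrite symA.
Qed.

Lemma arcs_between_id X : arcs_between X X = #|arcs_in A X|.
Proof. by rewrite card_arcs_in. Qed.

Lemma arcs_betweenUr X Y1 Y2 : [disjoint Y1 & Y2] ->
  arcs_between X (Y1 :|: Y2) = arcs_between X Y1 + arcs_between X Y2.
Proof.
move=> dis; rewrite /arcs_between -big_split; apply: eq_bigr => u _ /=.
rewrite setIUl cardsU -[RHS]subn0; congr (_ - _).
apply/eqP; rewrite cards_eq0 -subset0; apply/subsetP => v.
rewrite !inE => /andP[/andP[h1 _] /andP[h2 _]].
by move: (disjointFr dis h1); rewrite h2.
Qed.

(** Twice the degree sum of [Y] into the whole set counts the arcs inside [Y] twice, which the
    summand [arcs_in A Y] compensates. In this form the only quantity left to bound is a degree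
    sum. *)
Lemma arcs_in_split X Y : [disjoint X & Y] ->
  #|arcs_in A (X :|: Y)| + #|arcs_in A Y|
  = #|arcs_in A X| + 2 * arcs_between Y (X :|: Y).
Proof.
move=> dis; rewrite -!arcs_between_id arcs_betweenUr //.
rewrite !(arcs_betweenC (X :|: Y)) !arcs_betweenUr // (arcs_betweenC X Y); lia.
Qed.

(** Colours on [X] are at most [s], so no monochromatic arc joins [X] to the new class [Y]; inside
    [Y] every arc is conceded. *)
Lemma card_mono_in_extend (c0 : V -> nat) s X Y : [disjoint X & Y] ->
  (forall v, c0 v <= s) ->
  #|mono_in A (fun v => if v \in X then c0 v else s.+1) (X :|: Y)|
  <= #|mono_in A c0 X| + #|arcs_in A Y|.
Proof.
move=> dis c0s; set M := mono_in _ _ _.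
apply: leq_trans (leq_card_setU _ _); apply/subset_leq_card/subsetP => -[u v].
rewrite !inE /= => /andP[/andP[-> /andP[hu hv]]].
case: (boolP (u \in X)) hu => [uX|uX] /= hu;
  case: (boolP (v \in X)) hv => [vX|vX] /= hv.
- by move=> ->.
- by move/eqP => e; have := c0s u; rewrite e ltnn.
- by move/eqP => e; have := c0s v; rewrite -e ltnn.
- by move=> _; rewrite hu hv.
Qed.
End FurediStep.

Lemma card_cliques1 (V : finType) (A : rel V) (X : {set V}) : #|X| <= #|cliques A X 1|.
Proof.
rewrite -(card_imset _ set1_inj); apply/subset_leq_card/subsetP => S /imsetP[x xX ->].
rewrite inE sub1set xX cards1 eqxx; apply/cliqueP => u v /set1P -> /set1P ->.
by rewrite eqxx.
Qed.

Local Open Scope ring_scope.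

(** The difference of the two sides is [(t * a - b) ^+ 2 / (t * (t + 1))]. It vanishes at
    [b = t * a], where the new class [a] has the same size as each of [t] equal classes making up
    [b]. *)
Lemma turan_step (R : realFieldType) (t a b : R) : 0 < t ->
  (1 - t^-1) * b ^+ 2 + 2 * a * b <= (1 - (t + 1)^-1) * (b + a) ^+ 2.
Proof.
move=> t0; have t1 : 0 < t + 1 by rewrite addr_gt0.
rewrite -subr_ge0 [leRHS](_ : _ = (t * a - b) ^+ 2 / (t * (t + 1))).
  by rewrite divr_ge0 ?sqr_ge0 // mulr_ge0 ?ltW.
by field; rewrite !lt0r_neq0.
Qed.

(* Füredi's argument with clique counts: pick a vertex x of maximum degree among those whose
   neighbourhood spans few smaller cliques; the non-neighbours of x form a new colour class. *)
Lemma clique_stability (R : realFieldType) s (eta : R) : 0 < eta ->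
  exists2 delta : R, 0 < delta &
  forall (V : finType) (A : rel V) (W : {set V}), graph A ->
  #|cliques A W s.+2|%:R <= delta * #|V|%:R ^+ s.+2 ->
  exists2 c : V -> nat, (forall v, c v <= s)%N &
  #|mono_in A c W|%:R + #|arcs_in A W|%:R
    <= (1 - s.+1%:R^-1) * #|W|%:R ^+ 2 + eta * #|V|%:R ^+ 2.
Proof.
elim: s eta => [|s IH] eta eta0.
  (* For [s = 0] the cliques are edges and one colour is used; both cardinals on the left are at
     most twice the number of edges. *)
  exists (eta / 4); first by rewrite divr_gt0.
  move=> V A W gA cl; exists (fun=> 0%N) => //.
  have h1 : (#|arcs_in A W| <= 2 * #|cliques A W 2|)%N.
    apply: leq_trans (sum_cliques_nbr W 1 gA).
    by rewrite card_arcs_in; apply: leq_sum => u _; apply: card_cliques1.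
  have h2 : (#|mono_in A (fun=> 0%N) W| <= #|arcs_in A W|)%N.
    by apply/subset_leq_card/subsetP => p; rewrite !inE => /andP[].
  have : #|mono_in A (fun=> 0%N) W|%:R <= #|arcs_in A W|%:R :> R by rewrite ler_nat.
  have : #|arcs_in A W|%:R <= 2 * #|cliques A W 2|%:R :> R by rewrite -natrM ler_nat.
  rewrite invr1 subrr mul0r; lra.
have [d' d'0 {}IH] := IH (eta / 2) (divr_gt0 eta0 (ltr0Sn _ 1)).
have s0 : 0 < s.+3%:R :> R by rewrite ltr0n.
(* Chosen for Markov's inequality on [sum_cliques_nbr]: at most [eta / 4 * N] vertices see more than
   [d' * N ^+ s.+2] cliques in their neighbourhood. *)
exists (d' * eta / (4 * s.+3%:R)); first by rewrite divr_gt0 ?mulr_gt0.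
move=> V A W gA cl.
have [symA irrA] := gA.
set N := #|V|%:R : R in cl *.
have N0 : 0 <= N by rewrite ler0n.
pose good x := #|cliques A (W :&: nbr A x) s.+2|%:R <= d' * N ^+ s.+2.
pose X := [set x in W | ~~ good x].
have leN Y : #|Y : {set V}|%:R <= N by rewrite ler_nat max_card.
have cX : #|X|%:R <= eta / 4 * N.
  have [V0|V0] := eqVneq N 0; first by rewrite V0 mulr0 -V0.
  have Np : 0 < N ^+ s.+2 by rewrite exprn_gt0 // lt_neqAle eq_sym V0.
  have h : #|X|%:R * (d' * N ^+ s.+2) <= s.+3%:R * #|cliques A W s.+3|%:R.
    rewrite -natrM; apply: le_trans (_ : (\sum_(x in W) #|cliques A (W :&: nbr A x) s.+2|)%:R <= _); last first.
      by rewrite ler_nat; apply: sum_cliques_nbr.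
    rewrite natr_sum mulr_natl -sumr_const [leRHS](bigID (mem X)) /=.
    rewrite -[leLHS]addr0; apply: lerD; last by apply: sumr_ge0 => *; rewrite ler0n.
    rewrite [leRHS](eq_bigl (mem X)); last first.
      by move=> x; rewrite !inE; case: (x \in W).
    by apply: ler_sum => x; rewrite inE => /andP[_]; rewrite -ltNge => /ltW.
  have h2 : #|X|%:R * (d' * N ^+ s.+2) <= (eta / 4 * N) * (d' * N ^+ s.+2).
    apply: le_trans h _; apply: le_trans (_ : s.+3%:R * (d' * eta / (4 * s.+3%:R) * N ^+ s.+3) <= _).
      by rewrite ler_wpM2l // ltW.
    rewrite [N ^+ s.+3]exprS le_eqVlt; apply/orP; left; apply/eqP; field; lra.
  by move: h2; rewrite ler_pM2r // mulr_gt0.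
have [X0|[x0 x0W]] := set_0Vmem (W :\: X); last first.
  case: (arg_maxnP (fun x => #|W :&: nbr A x|) x0W) => x xWX xmax.
  have xg : good x.
    have : x \in W :\: X := xWX; rewrite !inE andbC => /andP[-> /=]; by rewrite negbK.
  have [c0 c0s Hc] := IH V A _ gA xg.
  set Y1 := W :&: nbr A x in xmax Hc *; pose Y2 := W :\: nbr A x.
  have dis : [disjoint Y1 & Y2].
    rewrite -setI_eq0 -subset0; apply/subsetP => v; rewrite !inE.
    by move=> /andP[/andP[_ ->]].
  have WE : Y1 :|: Y2 = W by rewrite setID.
  exists (fun v => if v \in Y1 then c0 v else s.+1).
    by move=> v; case: ifP => // _; apply: leq_trans (c0s v) _.
  have hm := card_mono_in_extend A dis c0s.
  have hs := arcs_in_split gA dis.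
  rewrite !WE in hm hs.
  (* Outside [X] the degree into [W] is at most that of [x], by maximality; the few vertices of [X]
     get the trivial bound. *)
  have hb : (arcs_between A Y2 W <= #|Y2| * #|Y1| + #|X| * #|V|)%N.
    rewrite /arcs_between (bigID (mem X)) /= addnC; apply: leq_add.
      rewrite -sum_nat_const [leqRHS](bigID (mem X)) /=; apply: leq_trans (leq_addl _ _).
      apply: leq_sum => u /andP[]; rewrite in_setD => /andP[_ uW] uX.
      by apply: xmax; rewrite [_ u]in_setD uW uX.
    apply: leq_trans (_ : \sum_(u in X) #|V| <= _)%N; last by rewrite sum_nat_const.
    rewrite big_mkcond [leqRHS]big_mkcond; apply: leq_sum => u _.
    case: ifP => [/andP[_ ->]|_ //]; exact: max_card.
  have cW : #|W| = (#|Y1| + #|Y2|)%N by rewrite -(cardsID (nbr A x) W).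
  move: hm hs hb; rewrite -!(ler_nat R) => hm /(congr1 (fun k => k%:R : R)) hs hb.
  rewrite cW !natrD !natrM in hm hs hb *.
  move: hm hs hb Hc.
  set m := #|mono_in _ _ W|%:R; set m0 := #|mono_in _ _ Y1|%:R.
  set a := #|Y2|%:R; set b := #|Y1|%:R => hm hs hb Hc.
  have XN : #|X|%:R * N <= eta / 4 * N ^+ 2.
    by rewrite expr2 mulrA ler_wpM2r.
  have key : (1 - s.+1%:R^-1) * b ^+ 2 + 2 * (a * b) <= (1 - s.+2%:R^-1) * (b + a) ^+ 2.
    by rewrite -[s.+2]addn1 natrD mulrA; apply: turan_step; rewrite ltr0n.
  rewrite -/N in hb Hc.
  have arith (w y y1 bt p q K1 K2 e : R) : m <= m0 + y -> w + y = y1 + (bt + (bt + 0)) ->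
    bt <= p + q -> m0 + y1 <= K1 + e / 2 -> q <= e / 4 -> K1 + 2 * p <= K2 -> m + w <= K2 + e.
    by move=> *; lra.
  apply: arith hm hs hb _ _ key; last by rewrite mulrAC.
  by rewrite mulrAC.
(* No vertex is good, so [W] itself is small and a single colour suffices. *)
have WX : W \subset X by rewrite -setD_eq0 X0.
exists (fun=> 0%N) => //.
have h2 : (#|mono_in A (fun=> 0%N) W| <= #|arcs_in A W|)%N.
  by apply/subset_leq_card/subsetP => p; rewrite !inE => /andP[].
have h3 : (#|arcs_in A W| <= #|X| * #|V|)%N.
  rewrite card_arcs_in -sum_nat_const; apply: leq_trans (_ : \sum_(u in W) #|V| <= _)%N.
    by apply: leq_sum => u _; apply: max_card.
  by rewrite !sum_nat_const leq_mul2r subset_leq_card ?orbT.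
move: h2 h3; rewrite -!(ler_nat R) natrM -/N => h2 h3.
have : #|X|%:R * N <= eta / 4 * N ^+ 2 by rewrite expr2 mulrA ler_wpM2r.
have : 0 <= (1 - s.+2%:R^-1) * #|W|%:R ^+ 2 :> R.
  by rewrite mulr_ge0 ?sqr_ge0 // subr_ge0 invf_le1 ?ler1n ?ltr0n.
have : 0 <= eta * N ^+ 2 by rewrite mulr_ge0 ?sqr_ge0 // ltW.
move: (_ * #|W|%:R ^+ 2) => K; lra.
Qed.
Local Close Scope ring_scope.

(** * Copies of K_(r+2) - e *)

(** A union bound. The factor [M], in practice a power of the number of vertices, stands for a
    division and keeps the estimate in [nat]. *)
Lemma card_cover_le (I T : finType) (S : {set T}) (J : {set I}) (P : I -> pred T) M c :
  (forall t, t \in S -> exists2 i, i \in J & P i t) ->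
  (forall i, i \in J -> M * #|[set t in S | P i t]| <= c) ->
  M * #|S| <= #|J| * c.
Proof.
move=> H1 H2; apply: leq_trans (_ : M * \sum_(i in J) #|[set t in S | P i t]| <= _).
  rewrite leq_mul2l; apply/orP; right.
  have -> : \sum_(i in J) #|[set t in S | P i t]| = \sum_(t in S) #|[set i | (i \in J) && P i t]|.
    rewrite (eq_bigr (fun i => \sum_(t in S) (P i t : nat))); last first.
      by move=> i _; rewrite -sum1dep_card big_mkcondr.
    rewrite exchange_big /=; apply: eq_bigr => t _.
    by rewrite -sum1dep_card big_mkcondr.
  rewrite -sum1_card; apply: leq_sum => t /H1[i iJ Pit].
  by apply/card_gt0P; exists i; rewrite inE iJ.
by rewrite big_distrr -sum_nat_const; apply: leq_sum => i /H2.
Qed.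

Lemma card_offdiag (T : finType) (D : {set T}) :
  #|[set p : T * T | [&& p.1 \in D, p.2 \in D & p.1 != p.2]]| = #|D| * #|D|.-1.
Proof.
have -> : [set p : T * T | [&& p.1 \in D, p.2 \in D & p.1 != p.2]]
   = [set p : T * T | (p.1 \in D) && (p.2 \in D :\ p.1)].
  by apply/setP => p; rewrite !inE eq_sym; do !case: (_ \in _); rewrite ?andbF ?andbT.
rewrite (card_pairs_in D (fun x => D :\ x)) -sum_nat_const; apply: eq_bigr => x xD.
by rewrite (cardsD1 x D) xD.
Qed.

Lemma leq_bin_exp n k : 'C(n, k) <= n ^ k.
Proof.
have /leq_trans : 'C(n, k) <= n ^_ k by rewrite -bin_ffact leq_pmulr // fact_gt0.
by apply; elim: k => // k IH; rewrite ffactnSr expnSr leq_mul // leq_subr.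
Qed.

Section Copies.
Variables (V : finType) (r : nat).
Implicit Types (A : rel V) (T : {set V}) (t : {set V} * (V * V)).

Definition cnbr A T := [set v | [forall u in T, A u v]].

Lemma cnbrP A T v : reflect {in T, forall u, A u v} (v \in cnbr A T).
Proof. by rewrite inE; apply: forall_inP. Qed.

(* Copies of K_(r+2) - e, given by the r-clique of the vertices of full degree and the pair of
   non-adjacent vertices; since the pair is ordered, each copy is counted twice. *)
Definition ocopies A : {set {set V} * (V * V)} :=
  [set t | (t.1 \in cliques A setT r) &&
     [&& t.2.1 \in cnbr A t.1, t.2.2 \in cnbr A t.1 & t.2.1 != t.2.2]].

Lemma card_ocopies A :
  #|ocopies A| = \sum_(T in cliques A setT r) #|cnbr A T| * #|cnbr A T|.-1.
Proof.
rewrite (eq_bigr (fun T => #|[set p : V * V | [&& p.1 \in cnbr A T, p.2 \in cnbr A T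
   & p.1 != p.2]]|)); last by move=> T _; rewrite card_offdiag.
rewrite -card_pairs_in; apply: eq_card => t; by rewrite !inE.
Qed.

Lemma ocopiesP A T x y :
  reflect [/\ #|T| = r, {in T &, forall u v, u != v -> A u v}, {in T, forall u, A u x},
              {in T, forall u, A u y} & x != y]
          ((T, (x, y)) \in ocopies A).
Proof.
rewrite !inE /= subsetT /=; apply: (iffP idP).
  by case/andP=> /andP[/eqP-> /cliqueP cl] /and3P[/forall_inP hx /forall_inP hy ->].
by case=> -> cl hx hy ->; rewrite eqxx andbT; apply/and3P; split;
  [apply/cliqueP | apply/forall_inP | apply/forall_inP].
Qed.

Lemma ocopies_sub A A' : subrel A A' -> ocopies A \subset ocopies A'.
Proof.
move=> sub; apply/subsetP => -[T [x y]] /ocopiesP[h1 h2 h3 h4 h5].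
by apply/ocopiesP; split => // [u v uT vT uv|u uT|u uT]; apply: sub; auto.
Qed.

(** An [r.+1]-clique is an [r]-clique with one of its [d] common neighbours, and the copies number
    [d * (d - 1)], which is at least [l * d] unless [d <= l.+1]. With [l] a large constant, few
    copies imply few [r.+1]-cliques. *)
Lemma card_cliques_ocopies A l : graph A ->
  l * #|cliques A setT r.+1| <= l * l.+1 * #|V| ^ r + #|ocopies A|.
Proof.
move=> [symA irrA].
have h1 : #|cliques A setT r.+1| <= \sum_(T in cliques A setT r) #|cnbr A T|.
  rewrite -card_pairs_in.
  set L := [set p | _].
  apply: leq_trans (leq_imset_card (fun p : {set V} * V => p.2 |: p.1) L).
  apply/subset_leq_card/subsetP => S; rewrite inE subsetT /= => /andP[/eqP cS /cliqueP cl].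
  have [x xS] : exists x, x \in S by apply/set0Pn; rewrite -cards_eq0 cS.
  apply/imsetP; exists (S :\ x, x); last by rewrite /= setD1K.
  rewrite !inE subsetT /=; apply/andP; split; last first.
    by apply/forall_inP => u; rewrite !inE => /andP[ux uS]; apply: cl.
  apply/andP; split; first by move: cS; rewrite (cardsD1 x) xS add1n => -[->].
  by apply/cliqueP => u v; rewrite !inE => /andP[_ uS] /andP[_ vS]; apply: cl.
have h2 T : l * #|cnbr A T| <= l * l.+1 + #|cnbr A T| * #|cnbr A T|.-1.
  have [h|h] := leqP #|cnbr A T| l.+1; first by rewrite (leq_trans _ (leq_addr _ _)) ?leq_mul2l ?h ?orbT.
  by rewrite (leq_trans _ (leq_addl _ _)) // mulnC leq_mul2l; apply/orP; right; lia.
have h3 : #|cliques A setT r| <= #|V| ^ r.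
  apply: leq_trans (leq_bin_exp _ _).
  rewrite -(card_draws V r); apply/subset_leq_card/subsetP => T.
  by rewrite !inE => /and3P[_ ->].
apply: leq_trans (_ : l * (\sum_(T in cliques A setT r) #|cnbr A T|) <= _).
  by rewrite leq_mul2l h1 orbT.
rewrite card_ocopies big_distrr /=.
apply: leq_trans (_ : \sum_(T in cliques A setT r) (l * l.+1 + #|cnbr A T| * #|cnbr A T|.-1) <= _).
  by apply: leq_sum => T _; apply: h2.
by rewrite big_split /= leq_add2r sum_nat_const mulnC leq_mul2l h3 orbT.
Qed.

Definition verts t := t.2.1 |: (t.2.2 |: t.1).

Lemma ocopy_notin A T x y : graph A -> (T, (x, y)) \in ocopies A ->
  (x \notin T) /\ (y \notin T).
Proof.
move=> [_ irrA] /ocopiesP[_ _ hx hy _].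
by split; [apply/negP => /hx | apply/negP => /hy]; rewrite irrA.
Qed.

Lemma card_verts A t : graph A -> t \in ocopies A -> #|verts t| = r.+2.
Proof.
move=> gA; case: t => T [x y] tc; have [xT yT] := ocopy_notin gA tc.
case/ocopiesP: tc => cT _ _ _ xy.
by rewrite /verts /= !cardsU1 !inE negb_or xy xT yT cT.
Qed.

Lemma ocopy_adj A T x y u v : graph A -> (T, (x, y)) \in ocopies A ->
  u \in verts (T, (x, y)) -> v \in verts (T, (x, y)) -> u != v ->
  (u, v) != (x, y) -> (u, v) != (y, x) -> A u v.
Proof.
move=> [symA _] /ocopiesP[_ cl hx hy _]; rewrite !inE /= !xpair_eqE.
case/or3P=> [/eqP->|/eqP->|uT] /or3P[/eqP->|/eqP->|vT]; rewrite ?eqxx ?andbT //=.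
- by move=> *; rewrite symA hx.
- by move=> *; rewrite symA hy.
- by move=> *; rewrite hx.
- by move=> *; rewrite hy.
- by move=> uv _ _; apply: cl.
Qed.

(** Fixing the vertices of [X] leaves [n ^ (r.+2 - #|X|)] vertex sets at most, and a vertex set
    carries at most [r.+2 ^ 2] ordered pairs, each of which determines the clique. Every error term
    on copies with several bad edges rests on this bound. *)
Lemma card_ocopies_through A (X : {set V}) : graph A ->
  #|V| ^ #|X| * #|[set t in ocopies A | X \subset verts t]| <= r.+2 ^ 2 * #|V| ^ r.+2.
Proof.
move=> gA; set S := [set t in _ | _].
have [rX|Xr] := ltnP r.+2 #|X|.
  rewrite (_ : #|S| = 0) ?muln0 //; apply/eqP; rewrite cards_eq0 -subset0.
  apply/subsetP => t; rewrite inE => /andP[tc /subset_leq_card].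
  by rewrite (card_verts gA tc) leqNgt rX.
pose Qs := [set Q : {set V} | (#|Q| == r.+2) && (X \subset Q)].
have hQ : #|Qs| <= #|V| ^ (r.+2 - #|X|).
  have inj : {in Qs &, injective (fun Q => Q :\: X)}.
    move=> Q Q'; rewrite !inE => /andP[_ /setIidPr h] /andP[_ /setIidPr h'] e.
    by rewrite -(setID Q X) -(setID Q' X) e h h'.
  rewrite -(card_in_imset inj).
  apply: leq_trans (leq_bin_exp _ _).
  rewrite -(card_draws V); apply/subset_leq_card/subsetP => _ /imsetP[Q + ->].
  by rewrite !inE => /andP[/eqP cQ XQ]; rewrite cardsD cQ (setIidPr XQ).
have hS : #|S| <= r.+2 ^ 2 * #|Qs|.
  pose L := [set q : {set V} * (V * V) | (q.1 \in Qs) && (q.2 \in setX q.1 q.1)].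
  have -> : r.+2 ^ 2 * #|Qs| = #|L|.
    rewrite (card_pairs_in Qs (fun Q => setX Q Q)) mulnC -sum_nat_const.
    by apply: eq_bigr => Q; rewrite inE cardsX => /andP[/eqP -> _].
  have inj : {in S &, injective (fun t => (verts t, t.2))}.
    have K t : t \in S -> t.1 = verts t :\: [set t.2.1; t.2.2].
      case: t => T [x y]; rewrite inE => /andP[/(ocopy_notin gA)[xT yT] _].
      apply/setP => u; rewrite !inE /=.
      have [->|_] := eqVneq u x; first by rewrite (negPf xT).
      by have [->|_] := eqVneq u y; first by rewrite (negPf yT).
    move=> t t' tS t'S /eqP; rewrite xpair_eqE => /andP[/eqP ev /eqP e2].
    by rewrite (surjective_pairing t) (surjective_pairing t') (K _ tS) (K _ t'S) ev e2.
  rewrite -(card_in_imset inj); apply/subset_leq_card/subsetP => q /imsetP[t].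
  rewrite inE => /andP[tc Xt] ->; rewrite !inE /= (card_verts gA tc) Xt /=.
  by rewrite !eqxx ?orbT.
apply: leq_trans (_ : #|V| ^ #|X| * (r.+2 ^ 2 * #|V| ^ (r.+2 - #|X|)) <= _).
  by rewrite leq_mul2l (leq_trans hS) ?orbT // leq_mul2l hQ orbT.
by rewrite mulnCA leq_mul2l -expnD subnKC // leqnn orbT.
Qed.
End Copies.

(** * Copies created by a bad edge *)

Section Families.
Variables (I V : finType).
Implicit Types (D : I -> {set V}) (J K : {set I}).

Lemma card_family_prod D : #|family D| = \prod_i #|D i|.
Proof. by rewrite card_family foldrE big_map big_enum. Qed.

Lemma card_family_bound D K m : {in K, forall i, #|D i| <= 1} ->
  (forall i, i \notin K -> #|D i| <= m) -> #|family D| <= m ^ #|~: K|.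
Proof.
move=> h hm; rewrite card_family_prod (bigID (mem K)) /= -[leqRHS]mul1n.
apply: leq_mul.
  apply: (big_ind (fun k => k <= 1)) => //.
  by move=> a b ha hb; apply: (leq_mul ha hb).
rewrite (eq_bigl (mem (~: K))); last by move=> i; rewrite !inE.
by rewrite -prod_nat_const; apply: leq_prod => i iK; apply: hm; rewrite -in_setC.
Qed.

Lemma card_family_le D K : {in K, forall i, #|D i| <= 1} ->
  #|family D| <= #|V| ^ #|~: K|.
Proof. by move=> h; apply: card_family_bound => // i _; apply: max_card. Qed.

Lemma card_family_fix D K J (h : I -> V) : {in K, forall i, #|D i| <= 1} ->
  [disjoint J & K] ->
  #|V| ^ #|J| * #|[set g in family D | [forall i in J, g i == h i]]| <= #|V| ^ #|~: K|.
Proof.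
move=> h1 dis.
pose D' i := if i \in J then D i :&: [set h i] else D i.
have sub : [set g in family D | [forall i in J, g i == h i]] \subset family D'.
  apply/subsetP => g; rewrite inE => /andP[/familyP gD /forall_inP gJ].
  apply/familyP => i; rewrite /D'; case: ifP => [iJ|_]; last exact: gD.
  by rewrite !inE gJ // andbT; apply: gD.
have h1' : {in J :|: K, forall i, #|D' i| <= 1}.
  move=> i; rewrite inE /D'; case: (i \in J) => /= [_|/h1 //].
  by rewrite -(cards1 (h i)) subset_leq_card // subsetIr.
apply: leq_trans (_ : #|V| ^ #|J| * #|V| ^ #|~: (J :|: K)| <= _).
  by rewrite leq_mul2l (leq_trans (subset_leq_card sub)) ?orbT ?card_family_le.
rewrite -expnD setCU (_ : #|J| + _ = #|~: K|) // -(cardsID J (~: K)) setDE [~: K :&: ~: J]setIC.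
congr (_ + _); apply: eq_card => i; rewrite !inE.
by case: (boolP (i \in J)) => iJ; rewrite ?(disjointFr dis iJ) ?andbF.
Qed.
End Families.

Lemma card_arcsE (V : finType) (A : rel V) : #|arcs A| = \sum_p (A p.1 p.2 : nat).
Proof. by rewrite -sum1dep_card big_mkcond. Qed.

Section Coloring.
Variables (V : finType) (r : nat) (f : V -> 'I_r).
Implicit Types (A : rel V).

Definition part l := [set v | f v == l].
Definition Kpart : rel V := fun u v => f u != f v.
Definition bad A : rel V := fun u v => A u v && (f u == f v).
Definition mis A : rel V := fun u v => ~~ A u v && (f u != f v).

Lemma graph_Kpart : graph Kpart.
Proof. by split=> [u v|u]; rewrite /Kpart ?eqxx // eq_sym. Qed.

Lemma arcs_balance A :
  #|arcs A| + #|arcs (mis A)| = #|arcs (bad A)| + #|arcs Kpart|.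
Proof.
rewrite !card_arcsE -!big_split; apply: eq_bigr => -[u v] _ /=.
by rewrite /mis /bad /Kpart; case: (A u v); case: (f u == f v).
Qed.

Lemma sum_part : \sum_l #|part l| = #|V|.
Proof.
rewrite -[RHS]sum1_card (partition_big f xpredT) //=.
by apply: eq_bigr => l _; rewrite sum1dep_card; apply: eq_card => v; rewrite !inE.
Qed.

Lemma card_arcs_Kpart : #|arcs Kpart| + \sum_l #|part l| ^ 2 = #|V| ^ 2.
Proof.
have -> : \sum_l #|part l| ^ 2 = #|arcs (fun u v => f u == f v)|.
  rewrite card_arcs.
  rewrite (partition_big f xpredT) //=; apply: eq_bigr => l _.
  rewrite -mulnn -sum_nat_const.
  rewrite (eq_bigl (fun v => f v == l)); last by move=> v; rewrite inE.
  apply: eq_bigr => v /eqP e; apply: eq_card => w; by rewrite !inE e eq_sym.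
rewrite -mulnn -card_prod -cardsT -(cardsID (arcs Kpart) setT) setTI; congr (_ + _).
by apply: eq_card => p; rewrite !inE andbT negbK.
Qed.

(* The copy given by a vertex z, a transversal g and a further vertex y: the pair is {g_(f y), y}. *)
Definition fan (z : V) (gy : {ffun 'I_r -> V} * V) : {set V} * (V * V) :=
  (z |: [set gy.1 l | l in [set~ f gy.2]], (gy.1 (f gy.2), gy.2)).

(** Nothing but distinctness relates [y] to [g (f y)]: they are the ends of the removed edge,
    adjacent or not. The parameters [D] and [Y] let one count serve both around a vertex and along a
    bad edge. *)
Definition fans A (D : 'I_r -> {set V}) (Y : {set V}) : {set {ffun 'I_r -> V} * V} :=
  [set gy | [&& gy.1 \in family D, gy.2 \in Y, gy.2 != gy.1 (f gy.2),
     [forall l, (l != f gy.2) ==> A (gy.1 l) gy.2] &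
     [forall l, forall l', (l != l') ==> A (gy.1 l) (gy.1 l')]]].

Lemma fansP A (D : 'I_r -> {set V}) (Y : {set V}) (g : {ffun 'I_r -> V}) y :
  reflect [/\ forall l, g l \in D l, y \in Y, y != g (f y), forall l, l != f y -> A (g l) y &
              forall l l', l != l' -> A (g l) (g l')] ((g, y) \in fans A D Y).
Proof.
rewrite inE; apply: (iffP and5P) => /=.
  case=> /familyP h1 h2 h3 /forallP h4 /forallP h5; split=> //.
    by move=> l; apply/implyP.
  by move=> l l'; apply/implyP; move: l'; apply/forallP.
case=> h1 h2 h3 h4 h5; split=> //.
- exact/familyP.
- by apply/forallP => l; apply/implyP; apply: h4.
- by apply/forallP => l; apply/forallP => l'; apply/implyP; apply: h5.
Qed.

Section Fan.
Variables (A : rel V) (z : V) (D : 'I_r -> {set V}) (Y : {set V}).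
Hypothesis gA : graph A.
Hypothesis DP : forall l u, u \in D l -> (f u == l) && A z u.
Hypothesis YP : forall y, y \in Y -> A z y.

Lemma fan_ocopies gy : gy \in fans A D Y -> fan z gy \in ocopies r A.
Proof.
have [symA irrA] := gA; case: gy => g y /fansP[h1 h2 h3 h4 h5].
have fg l : f (g l) = l by have /andP[/eqP] := DP (h1 l).
have zg l : A z (g l) by have /andP[] := DP (h1 l).
apply/ocopiesP => /=; split.
- rewrite cardsU1 card_imset; last exact: can_inj fg.
  rewrite cardsC1 card_ord (_ : z \notin _ = true).
    by rewrite add1n prednK // (leq_ltn_trans _ (ltn_ord (f z))).
  by apply/negP => /imsetP[l _ e]; move: (zg l); rewrite -e irrA.
- move=> u v; rewrite !inE => /orP[/eqP->|/imsetP[l _ ->]] /orP[/eqP->|/imsetP[l' _ ->]].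
  + by rewrite eqxx.
  + by move=> _; apply: zg.
  + by move=> _; rewrite symA; apply: zg.
  + by move=> h; apply: h5; apply: contraNneq h => ->.
- move=> u; rewrite !inE => /orP[/eqP->|/imsetP[l + ->]]; first exact: zg.
  by rewrite !inE; apply: h5.
- move=> u; rewrite !inE => /orP[/eqP->|/imsetP[l + ->]]; first exact: YP.
  by rewrite !inE; apply: h4.
- by rewrite eq_sym.
Qed.

(** The transversal is read off from the colours: [g (f y)] is stored in the pair, and any other
    [g l] is the vertex of colour [l] in the clique that differs from [z]. *)
Lemma fan_inj : {in fans A D Y &, injective (fan z)}.
Proof.
have [symA irrA] := gA; move=> [g y] [g' y'] /fansP[h1 _ _ _ _] /fansP[h1' _ _ _ _].
rewrite /fan /= => /eqP; rewrite !xpair_eqE => /and3P[/eqP eT /eqP ex /eqP ey].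
rewrite -ey in eT ex *; congr pair; apply/ffunP => l.
have [->//|ly] := eqVneq l (f y).
have : g l \in z |: [set g' l | l in [set~ f y]].
  by rewrite -eT !inE imset_f ?orbT // !inE.
rewrite !inE => /orP[/eqP e|/imsetP[l' _ e]].
  by have /andP[_] := DP (h1 l); rewrite e irrA.
have /andP[/eqP e1 _] := DP (h1 l); have /andP[/eqP e2 _] := DP (h1' l').
by rewrite e; congr (g' _); rewrite -e1 e e2.
Qed.

Lemma card_fans_le (P : pred ({set V} * (V * V))) :
  (forall gy, gy \in fans A D Y -> P (fan z gy)) ->
  #|fans A D Y| <= #|[set t in ocopies r A | P t]|.
Proof.
move=> h; rewrite -(card_in_imset fan_inj); apply/subset_leq_card/subsetP => t.
by move=> /imsetP[gy gyD ->]; rewrite inE fan_ocopies // h.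
Qed.

(* K collects the coordinates l in which the transversal is fixed. *)
Lemma card_fans (K : {set 'I_r}) :
  {in K, forall l, #|D l| <= 1} -> {in Y, forall y, f y \notin K} ->
  (forall l l' u w, l \in K -> l != l' -> u \in D l -> w \in D l' -> A u w) ->
  (forall l u y, l \in K -> u \in D l -> y \in Y -> A u y) ->
  #|V| ^ 2 * (\prod_l #|D l| * #|Y|) <=
  #|V| ^ 2 * (#|fans A D Y| + #|~: K| * \prod_l #|D l|)
  + 2 * r ^ 2 * #|arcs (mis A)| * #|V| ^ #|~: K|.+1.
Proof.
have [symA irrA] := gA.
move=> K1 YK KD KY; set n := #|V|; set s := #|~: K|.
rewrite -card_family_prod.
pose All := [set gy : {ffun 'I_r -> V} * V | (gy.1 \in family D) && (gy.2 \in Y)].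
have -> : #|family D| * #|Y| = #|All|.
  by rewrite (card_pairs (mem (family D)) (fun _ => mem Y)) -sum_nat_const;
    apply: eq_bigr => g _; apply: eq_card => y; rewrite inE.
(* A pair [(g, y)] fails to be a fan for one of three reasons: [y = g (f y)], a missing pair between
   [y] and [g], or a missing pair inside [g]. A missing arc together with its coordinates fixes two
   of the [s + 1] free choices, hence spoils at most [n ^ s.-1] pairs. *)
pose E0 := [set gy in All | gy.2 == gy.1 (f gy.2)].
pose E1 := [set gy in All | [exists l, (l != f gy.2) && ~~ A (gy.1 l) gy.2]].
pose E2 := [set gy in All | [exists l, exists l', (l != l') && ~~ A (gy.1 l) (gy.1 l')]].
have cov : #|All| <= #|fans A D Y| + #|E0| + #|E1| + #|E2|.
  have : All \subset fans A D Y :|: E0 :|: E1 :|: E2.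
    apply/subsetP => -[g y] gyA; rewrite !inE.
    case: (boolP (y == _)) => e0; rewrite ?orbT //=.
      by move: gyA; rewrite !inE => /andP[-> ->]; rewrite !orbT.
    move: gyA; rewrite !inE /= => /andP[-> ->] /=; rewrite !orbF.
    case: (boolP [exists l, _ && ~~ A (g l) y]) => [|e1]; rewrite ?orbT //=.
    case: (boolP [exists l, [exists l', _ && ~~ A (g l) (g l')]]) => [|e2]; rewrite ?orbT //=.
    rewrite !orbF; apply/andP; split.
      apply/forallP => l; apply/implyP => h; apply: contraNT e1 => h'.
      by apply/existsP; exists l; rewrite h.
    apply/forallP => l; apply/forallP => l'; apply/implyP => h; apply: contraNT e2 => h'.
    by apply/existsP; exists l; apply/existsP; exists l'; rewrite h.
  move/subset_leq_card/leq_trans; apply.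
  by do 3![apply: leq_trans (leq_card_setU _ _) _; rewrite leq_add2r].
have b0 : #|E0| <= s * #|family D|.
  have inj : {in E0 &, injective (fun gy : {ffun 'I_r -> V} * V => (f gy.2, gy.1))}.
    move=> [g y] [g' y']; rewrite !inE /= => /andP[_ /eqP e] /andP[_ /eqP e'] [e1 e2].
    by congr pair => //; rewrite e e' e2 e1.
  rewrite -(card_in_imset inj).
  have -> : s * #|family D| = #|[set p : 'I_r * {ffun 'I_r -> V} | (p.1 \in ~: K) && (p.2 \in family D)]|.
    rewrite (card_pairs (mem (~: K)) (fun _ => mem (family D))) -sum_nat_const.
    by apply: eq_bigr => l _; apply: eq_card => y; rewrite inE.
  apply/subset_leq_card/subsetP => _ /imsetP[[g y] + ->].
  by rewrite !inE /= => /andP[/andP[-> /YK ->]].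
have b1 : n * #|E1| <= r * #|arcs (mis A)| * n ^ s.
  pose J := [set i : 'I_r * (V * V) | (i.1 \in ~: K) && (i.2 \in arcs (mis A))].
  have cJ : #|J| <= r * #|arcs (mis A)|.
    rewrite (card_pairs_in (~: K) (fun _ => arcs (mis A))) sum_nat_const leq_mul2r.
    by rewrite (leq_trans (max_card _)) ?card_ord ?orbT.
  apply: leq_trans (_ : #|J| * n ^ s <= _); last by rewrite leq_mul2r cJ orbT.
  apply: (card_cover_le (P := fun (i : 'I_r * (V * V)) (gy : {ffun 'I_r -> V} * V) => (gy.1 i.1 == i.2.1) && (gy.2 == i.2.2))).
    move=> [g y]; rewrite !inE /= => /andP[/andP[/familyP gD yY] /existsP[l /andP[ly nA]]].
    exists (l, (g l, y)); last by rewrite /= !eqxx.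
    rewrite !inE /= /mis nA /=.
    have /andP[/eqP -> _] := DP (gD l); rewrite ly andbT.
    by apply/negP => lK; rewrite (KY _ _ _ lK (gD l) yY) in nA.
  move=> [l [u w]]; rewrite !inE /= => /andP[lK _].
  have d1 : [disjoint [set l] & K] by rewrite disjoints1.
  have := card_family_fix (fun=> u) K1 d1; rewrite cards1 expn1; apply: leq_trans.
  rewrite leq_mul2l; apply/orP; right.
  apply: leq_trans (_ : #|[set (g, w) | g in [set g in family D | [forall i in [set l], g i == u]]]| <= _).
    apply/subset_leq_card/subsetP => -[g y]; rewrite !inE /=.
    case/andP => /andP[/andP[gD _] _] /andP[gl /eqP ->]; apply: imset_f.
    by rewrite !inE gD; apply/forall_inP => i /set1P ->.
  exact: leq_imset_card.
have b2 : n ^ 2 * #|E2| <= r ^ 2 * #|arcs (mis A)| * (n ^ s * n).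
  pose J := [set i : ('I_r * 'I_r) * (V * V) | ((i.1.1 \in ~: K) && (i.1.2 \in ~: K) && (i.1.1 != i.1.2)) && (i.2 \in arcs (mis A))].
  have cJ : #|J| <= r ^ 2 * #|arcs (mis A)|.
    pose P := [set i : 'I_r * 'I_r | (i.1 \in ~: K) && (i.2 \in ~: K) && (i.1 != i.2)].
    have -> : J = [set i | (i.1 \in P) && (i.2 \in arcs (mis A))].
      by apply/setP => i; rewrite !inE.
    rewrite (card_pairs_in P (fun _ => arcs (mis A))) sum_nat_const leq_mul2r.
    by rewrite (leq_trans (max_card _)) ?card_prod ?card_ord ?orbT.
  apply: leq_trans (_ : #|J| * (n ^ s * n) <= _); last by rewrite leq_mul2r cJ orbT.
  apply: (card_cover_le (P := fun (i : ('I_r * 'I_r) * (V * V)) (gy : {ffun 'I_r -> V} * V) => (gy.1 i.1.1 == i.2.1) && (gy.1 i.1.2 == i.2.2))).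
    move=> [g y]; rewrite !inE /= => /andP[/andP[/familyP gD yY] /existsP[l /existsP[l' /andP[ll nA]]]].
    exists ((l, l'), (g l, g l')); last by rewrite /= !eqxx.
    rewrite !inE /= /mis nA /= ll.
    have /andP[/eqP -> _] := DP (gD l); have /andP[/eqP -> _] := DP (gD l'); rewrite ll !andbT.
    apply/andP; split; apply/negP => lK.
      by rewrite (KD _ _ _ _ lK ll (gD l) (gD l')) in nA.
    by rewrite symA (KD _ _ _ _ lK _ (gD l') (gD l)) // eq_sym in nA.
  move=> [[l l'] [u w]]; rewrite !inE /= => /andP[/andP[/andP[lK l'K] ll] _].
  have d1 : [disjoint [set l; l'] & K].
    rewrite -setI_eq0 -subset0; apply/subsetP => i; rewrite !inE.
    by case/andP => /orP[/eqP ->|/eqP ->] iK; rewrite ?iK in lK l'K.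
  pose h i := if i == l then u else w.
  have := card_family_fix h K1 d1; rewrite cards2 ll => hh.
  apply: leq_trans (leq_mul hh (leqnn n)); rewrite -mulnA leq_mul2l; apply/orP; right.
  apply: leq_trans (_ : #|[set p : {ffun 'I_r -> V} * V | (p.1 \in [set g in family D | [forall i in [set l; l'], g i == h i]]) && (p.2 \in [set: V])]| <= _).
    apply/subset_leq_card/subsetP => -[g y]; rewrite !inE /=.
    case/andP => /andP[/andP[gD _] _] /andP[/eqP gl /eqP gl']; rewrite gD andbT /=.
    apply/forall_inP => i; rewrite !inE /h => /orP[/eqP ->|/eqP ->]; first by rewrite eqxx gl.
    by rewrite [l' == l]eq_sym (negPf ll) gl'.
  by rewrite (card_pairs_in _ (fun=> setT)) sum_nat_const cardsT.
have := leq_mul (leqnn (n ^ 2)) cov; move/leq_trans; apply.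
rewrite !mulnDr (expnSr n s).
have b1' : n ^ 2 * #|E1| <= r ^ 2 * #|arcs (mis A)| * (n ^ s * n).
  rewrite -mulnn -mulnA; apply: leq_trans (leq_mul (leqnn n) b1) _.
  rewrite mulnC -mulnA leq_mul2r -mulnn.
  have [->|r0] := posnP r; by rewrite ?leq_pmull ?orbT // leq_mul2r leq_pmulr ?orbT.
have b0' := leq_mul (leqnn (n ^ 2)) b0.
lia.
Qed.
End Fan.
End Coloring.

Lemma card_split3 (T : finType) (S : {set T}) (P Q : pred T) :
  #|S| = #|[set t in S | ~~ P t]| +
         (#|[set t in S | P t && ~~ Q t]| + #|[set t in S | P t && Q t]|).
Proof.
rewrite -!sum1dep_card -sum1_card !big_mkcondr -!big_split /=; apply: eq_bigr => t _.
by case: (P t); case: (Q t).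
Qed.

Section LowerCount.
Variables (V : finType) (r : nat) (f : V -> 'I_r) (A : rel V).
Hypothesis gA : graph A.
Implicit Types (Z : {set V}) (p : V * V) (t : {set V} * (V * V)).

Definition rainbow (T : {set V}) := [forall u in T, forall v in T, (f u == f v) ==> (u == v)].

Lemma rainbowP (T : {set V}) : reflect {in T &, injective f} (rainbow T).
Proof.
apply: (iffP forall_inP) => [H u v uT vT /eqP e|H u uT].
  by apply/eqP; move: (H u uT) => /forall_inP/(_ v vT)/implyP; apply.
by apply/forall_inP => v vT; apply/implyP => /eqP e; apply/eqP/H.
Qed.

Lemma rainbow_Nbad (T : {set V}) u v : rainbow T -> u \in T -> v \in T -> bad f A u v -> False.
Proof.
move=> /rainbowP h uT vT /andP[Auv /eqP e].
by rewrite (h _ _ uT vT e) (proj2 gA) in Auv.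
Qed.

Definition vpart Z z l := (part f l :&: nbr A z) :\: Z.
Definition vrest Z z := nbr A z :\: Z.
(** Along a bad edge [p] the vertex [p.2] plays the part of [z] in [fan], and the coordinate of its
    colour is frozen at [p.1]. As [erest] avoids that colour, both ends of [p] land in the
    clique. *)
Definition epart Z p l :=
  if l == f p.1 then [set p.1] else (part f l :&: nbr A p.1 :&: nbr A p.2) :\: Z.
Definition erest Z p := (nbr A p.1 :&: nbr A p.2) :\: (Z :|: part f (f p.1)).

Definition free_bad Z := [set p in arcs (bad f A) | (p.1 \notin Z) && (p.2 \notin Z)].

(** Uniqueness is asked inside the clique [t.1] only: the two vertices of the pair of a fan have one
    colour and may themselves form a bad edge. *)
Definition unique_bad p t :=
  [&& p.1 \in t.1, p.2 \in t.1 &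
   [forall u in t.1, forall v in t.1, ((f u == f v) && (u != v)) ==>
     (((u, v) == p) || ((v, u) == p))]].

Lemma vpartP Z z l u : u \in vpart Z z l -> (f u == l) && A z u.
Proof. by rewrite !inE => /andP[_]. Qed.

Lemma vrestP Z z y : y \in vrest Z z -> A z y.
Proof. by rewrite !inE => /andP[_]. Qed.

Lemma epartP Z p l u : p \in free_bad Z -> u \in epart Z p l -> (f u == l) && A p.2 u.
Proof.
rewrite /epart !inE => /andP[/andP[Ap fp] _]; case: ifP => [/eqP ->|_]; rewrite !inE.
  by move=> /eqP ->; rewrite eqxx (proj1 gA).
by move=> /andP[_ /andP[/andP[-> _]]].
Qed.

Lemma erestP Z p y : y \in erest Z p -> A p.2 y.
Proof. by rewrite !inE => /andP[_ /andP[]]. Qed.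

Lemma fan_vpart Z z gy : gy \in fans f A (vpart Z z) (vrest Z z) -> z \in Z ->
  verts (fan f z gy) :&: Z = [set z].
Proof.
case: gy => g y /fansP[h1 h2 _ _ _] zZ; apply/setP => u.
rewrite !inE /=; have [->|uz] := eqVneq u z; first by rewrite zZ !orbT.
apply/negbTE/negP => /andP[/or4P[/eqP->|/eqP->|//|/imsetP[l _ ->]]] /=.
- by move: (h1 (f y)); rewrite !inE => /andP[/negPf ->].
- by move: h2; rewrite !inE => /andP[/negPf ->].
- by move: (h1 l); rewrite !inE => /andP[/negPf ->].
Qed.

Lemma fan_epart Z p gy : p \in free_bad Z -> gy \in fans f A (epart Z p) (erest Z p) ->
  [disjoint verts (fan f p.2 gy) & Z] /\ unique_bad p (fan f p.2 gy).
Proof.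
case: gy p => g y [a b] pZ /fansP[h1 h2 _ _ _].
have := pZ; rewrite !inE /= => /andP[/andP[Aab /eqP fab] /andP[aZ bZ]].
have gZ l : g l \notin Z.
  move: (h1 l); rewrite /epart; case: ifP => _; rewrite !inE /=; first by move/eqP->.
  by case/andP.
have fg l : f (g l) = l by have /andP[/eqP] := epartP pZ (h1 l).
have ga : g (f a) = a by move: (h1 (f a)); rewrite /epart eqxx inE => /eqP.
have yZ : y \notin Z by move: h2; rewrite !inE negb_or => /andP[/andP[]].
have ya : f y != f a by move: h2; rewrite !inE negb_or => /andP[/andP[]].
split.
  rewrite -setI_eq0 -subset0; apply/subsetP => u; rewrite !inE /=.
  by case/andP => /or4P[/eqP->|/eqP->|/eqP->|/imsetP[l _ ->]];
    rewrite ?(negPf (gZ _)) ?(negPf yZ) ?(negPf bZ).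
apply/and3P; split => /=.
- rewrite !inE; apply/orP; right; apply/imsetP; exists (f a); rewrite ?ga //.
  by rewrite !inE eq_sym.
- by rewrite !inE eqxx.
apply/forall_inP => u uT; apply/forall_inP => v vT; apply/implyP => /andP[/eqP fuv uv].
move: uT vT; rewrite !inE => /orP[/eqP eu|/imsetP[l _ eu]] /orP[/eqP ev|/imsetP[l' _ ev]]; subst u v.
- by rewrite eqxx in uv.
- by move: fuv; rewrite fg => <-; rewrite -fab ga eqxx orbT.
- by move: fuv; rewrite fg => ->; rewrite -fab ga eqxx.
- by move: fuv; rewrite !fg => e; rewrite e eqxx in uv.
Qed.

Lemma unique_bad_overlap t : #|[set p | bad f A p.1 p.2 && unique_bad p t]| <= 2.
Proof.
have [->|[[a b]]] := set_0Vmem [set p | bad f A p.1 p.2 && unique_bad p t].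
  by rewrite cards0.
rewrite inE => /andP[_ /and3P[_ _ /forall_inP H]].
apply: leq_trans (_ : #|[set (a, b); (b, a)]| <= _); last first.
  by rewrite cards2; case: (_ != _).
apply/subset_leq_card/subsetP => -[u v]; rewrite !inE /= => /andP[/andP[Auv fuv] /and3P[uT vT _]].
have uv : u != v by apply: contraTneq Auv => ->; rewrite (proj2 gA).
move: (H u uT) => /forall_inP/(_ v vT); rewrite fuv uv /=.
by rewrite ![(v, u) == _]xpair_eqE [(u, v) == (b, a)]xpair_eqE [(v == a) && _]andbC.
Qed.

(** The copies are split into those meeting [Z], those off [Z] with two clique vertices of one
    colour, and those off [Z] with a rainbow clique. A fan at [z] meets [Z] in [z] alone, so the
    first sum counts no copy twice; a bad edge is two arcs, whence the factor 2. *)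
Lemma lower_count Z :
  2 * \sum_(z in Z) #|fans f A (vpart Z z) (vrest Z z)| +
  \sum_(p in free_bad Z) #|fans f A (epart Z p) (erest Z p)| +
  2 * #|[set t in ocopies r A | [disjoint verts t & Z] && rainbow t.1]|
  <= 2 * #|ocopies r A|.
Proof.
set S := ocopies r A; pose S1 := [set t in S | ~~ [disjoint verts t & Z]].
pose S2 := [set t in S | [disjoint verts t & Z] && ~~ rainbow t.1]; set S3 := [set t in S | _].
have -> : #|S| = #|S1| + (#|S2| + #|S3|).
  exact: card_split3.
rewrite !mulnDr addnA leq_add2r; apply: leq_add.
  rewrite leq_mul2l -[leqRHS]mul1n /=.
  apply: leq_trans (sum_card_overlap (P := fun z t => verts t :&: Z == [set z]) (J := mem Z) _).
    apply: leq_sum => z zZ.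
    have gyP gy := @fan_vpart Z z gy ^~ zZ.
    apply: leq_trans (card_fans_le gA (@vpartP Z z) (@vrestP Z z) (P := fun t => (verts t :&: Z == [set z])) _) _.
      by move=> gy /gyP ->.
    apply/subset_leq_card/subsetP => t /setIdP[tS /eqP e].
    apply/setIdP; split; last by rewrite e.
    apply/setIdP; split=> //; rewrite -setI_eq0; apply/set0Pn; exists z.
    by move/setP/(_ z): e; rewrite !inE eqxx.
  move=> t _; have [->|[z]] := set_0Vmem [set z | (mem Z) z && (verts t :&: Z == [set z])].
    by rewrite cards0.
  rewrite inE => /andP[_ /eqP ->]; rewrite -(cards1 z); apply/subset_leq_card/subsetP => z'.
  by rewrite !inE => /andP[_ /eqP/set1_inj ->].
apply: leq_trans (sum_card_overlap (P := unique_bad) (J := mem (free_bad Z)) _).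
  apply: leq_sum => p pZ.
  apply: leq_trans (card_fans_le gA (fun l u => @epartP Z p l u pZ) (@erestP Z p)
    (P := fun t => [disjoint verts t & Z] && unique_bad p t) _) _.
    by move=> gy /(fan_epart pZ)[-> ->].
  apply/subset_leq_card/subsetP => t /setIdP[tS /andP[dis up]].
  apply/setIdP; split=> //; apply/setIdP; split=> //; rewrite dis /=.
  apply/negP => /rainbow_Nbad H.
  have /and3P[h1 h2 _] := up; apply: H h1 h2 _.
  by move: pZ; rewrite !inE => /andP[].
move=> t _; apply: leq_trans (unique_bad_overlap t).
by apply/subset_leq_card/subsetP => p; rewrite !inE => /andP[/andP[-> _] ->].
Qed.
End LowerCount.

(** * Recolouring a vertex and maximum cuts *)

Section MaxCut.
Variables (V : finType) (r : nat) (A : rel V).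
Hypothesis gA : graph A.

Definition recolor (f : {ffun V -> 'I_r}) v l : {ffun V -> 'I_r} :=
  [ffun u => if u == v then l else f u].

(** Isolates the arcs at [v], so that two relations which differ only at [v] can be compared through
    the degree of [v]. *)
Lemma card_arcs_star (B : rel V) (v : V) : symmetric B -> irreflexive B ->
  #|arcs B| = #|arcs (fun x y => [&& B x y, x != v & y != v])| + 2 * #|nbr B v|.
Proof.
move=> symB irrB; have E (C : rel V) : #|arcs C| = \sum_x \sum_y (C x y : nat).
  by rewrite card_arcsE pair_big.
rewrite !E (bigD1 v) //= [X in _ = X + _](bigD1 v) //=.
have -> : \sum_y [&& B v y, v != v & y != v] = 0.
  by rewrite big1 // => y _; rewrite eqxx andbF.
have -> : \sum_y B v y = #|nbr B v| by rewrite -sum1dep_card [RHS]big_mkcond.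
have -> : \sum_(x | x != v) \sum_y B x y
   = \sum_(x | x != v) \sum_y [&& B x y, x != v & y != v] + \sum_(x | x != v) B x v.
  rewrite -big_split; apply: eq_bigr => x xv /=.
  rewrite (bigD1 v) //= [X in _ = X + _](bigD1 v) //= eqxx !andbF add0n addnC; congr (_ + _).
  by apply: eq_bigr => y ->; rewrite xv !andbT.
have -> : \sum_(x | x != v) B x v = #|nbr B v|.
  rewrite -sum1dep_card [RHS]big_mkcond [RHS](bigD1 v) //= irrB add0n.
  by apply: eq_bigr => x _; rewrite symB; case: (B v x).
by rewrite mul2n -addnn addnCA addnA addnC addnA.
Qed.

Lemma graph_bad (f : V -> 'I_r) : graph (bad f A).
Proof.
by case: gA => s i; split=> [u v|u]; rewrite /bad ?i // s [f v == _]eq_sym.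
Qed.

(** Recolouring [v] with [l] makes its neighbours of colour [l] the bad ones and changes no bad edge
    away from [v]. *)
Lemma max_cut_degree (f : {ffun V -> 'I_r}) v l :
  (forall f' : {ffun V -> 'I_r}, #|arcs (bad f A)| <= #|arcs (bad f' A)|) ->
  #|nbr (bad f A) v| <= #|part f l :&: nbr A v|.
Proof.
move=> /(_ (recolor f v l)).
rewrite (card_arcs_star v (proj1 (graph_bad _)) (proj2 (graph_bad _))).
rewrite [leqRHS](card_arcs_star v (proj1 (graph_bad _)) (proj2 (graph_bad _))).
have -> : #|arcs (fun x y => [&& bad (recolor f v l) A x y, x != v & y != v])|
        = #|arcs (fun x y => [&& bad f A x y, x != v & y != v])|.
  apply: eq_card => -[x y]; rewrite !inE /= /bad !ffunE.
  by case: (x == v); case: (y == v); rewrite ?andbF.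
rewrite leq_add2l leq_mul2l /= => /leq_trans; apply.
apply/subset_leq_card/subsetP => u; rewrite !inE /bad !ffunE eqxx.
case: ifP => [/eqP ->|_]; first by rewrite (proj2 gA).
by move=> /andP[-> /eqP ->]; rewrite eqxx.
Qed.
End MaxCut.

Local Open Scope ring_scope.

(** * First-order lower bound on the number of copies *)

Section RealLemmas.
Variable R : realFieldType.

(** For a given sum, the product over the box [[0, m]] is least when all entries but one equal [m].
    The powers of [m] on both sides avoid a division. *)
Lemma prod_ge_linear (m : R) (s : seq R) : 0 <= m -> all (fun x => (0 <= x) && (x <= m)) s ->
  m ^+ size s * (\sum_(x <- s) x - ((size s)%:R - 1) * m) <= m * \prod_(x <- s) x.
Proof.
move=> m0; elim: s => [|x s IH]; first by rewrite !big_nil /= expr0; lra.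
move=> /= /andP[/andP[x0 xm] H]; rewrite !big_cons.
have Sle : \sum_(y <- s) y <= (size s)%:R * m.
  elim: s H {IH} => [|y s IH]; rewrite ?big_nil ?mul0r //= big_cons => /andP[/andP[_ ym] /IH].
  rewrite -natr1; lra.
move: (IH H) Sle; rewrite -natr1 exprS.
move: (\sum_(y <- s) y) (\prod_(y <- s) y) ((size s)%:R : R) => S P k {}IH Sle.
have Pk : 0 <= m ^+ size s by rewrite exprn_ge0.
move: (m ^+ size s) Pk IH => w w0 IH.
have h1 := ler_wpM2l x0 IH.
have h2 : 0 <= w * ((m - x) * (m - (S - (k - 1) * m))).
  by rewrite mulr_ge0 // mulr_ge0; lra.
lra.
Qed.

Lemma bernoulli_pow (x : R) k : 0 <= x <= 1 -> 1 - k%:R * x <= (1 - x) ^+ k.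
Proof.
move=> /andP[x0 x1]; elim: k => [|k IH]; first by rewrite expr0; lra.
rewrite exprS -natr1; have := ler_wpM2l (_ : 0 <= 1 - x) IH.
have : 0 <= k%:R * x ^+ 2 by rewrite mulr_ge0 ?sqr_ge0.
rewrite expr2; set y := (1 - x) ^+ k => h h'; have := h' (ltac:(lra)); lra.
Qed.

(** The leading coefficient of the number of ordered copies with a given bad edge: [r - 1] free
    coordinates of density [1 / r] and a further vertex outside the class,
    [(1 / r) ^ (r - 1) * (1 - 1 / r)]. *)
Definition kap r : R := (r%:R - 1) / r%:R ^+ r.

Lemma kap_gt0 r : (2 <= r)%N -> 0 < kap r.
Proof.
move=> r2; have r0 : 0 < r%:R :> R by rewrite ltr0n; lia.
by rewrite divr_gt0 ?exprn_gt0 // subr_gt0 ltr1n.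
Qed.

Lemma kap_le1 r : (2 <= r)%N -> kap r <= 1.
Proof.
move=> r2; have r0 : 0 < r%:R :> R by rewrite ltr0n; lia.
have r1 : 1 <= r%:R :> R by rewrite ler1n; lia.
rewrite ler_pdivrMr ?exprn_gt0 // mul1r.
case: r r2 r0 r1 => // r _ r0 r1; rewrite exprS.
have := exprn_ege1 r r1; set w := _ ^+ r => w1.
by apply: le_trans (_ : r.+1%:R * 1 <= _); [lra | rewrite ler_wpM2l // ltW].
Qed.

Lemma kap_pow (r : nat) (th : R) : (2 <= r)%N -> 0 <= th <= r%:R^-1 ->
  kap r - r%:R * th <= (r%:R - 1) * (r%:R^-1 - th) ^+ r.
Proof.
move=> r2 /andP[t0 t1].
have r0 : 0 < r%:R :> R by rewrite ltr0n; lia.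
have rE : r%:R * r%:R^-1 = 1 :> R by rewrite divff // gt_eqF.
have -> : r%:R^-1 - th = r%:R^-1 * (1 - r%:R * th) by rewrite mulrBr mulr1 mulrA mulVf ?mul1r // gt_eqF.
have h : 1 - r%:R * (r%:R * th) <= (1 - r%:R * th) ^+ r.
  apply: bernoulli_pow; rewrite mulr_ge0 ?(ltW r0) //=.
  by rewrite -[leRHS]rE ler_wpM2l // ltW.
rewrite exprMn /kap -exprVn; set v := r%:R^-1 ^+ r.
have v0 : 0 <= v by rewrite exprn_ge0 // invr_ge0 ltW.
have r1 : 0 <= r%:R - 1 :> R by rewrite subr_ge0 ler1n; lia.
have h2 := ler_wpM2l v0 h; have h3 := ler_wpM2l r1 h2.
apply: le_trans h3.
have v1 : r%:R ^+ 2 * v <= 1.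
  have -> : v = r%:R ^- 2 * r%:R^-1 ^+ (r - 2).
    by rewrite /v -(subnKC r2) exprD subnKC // exprVn.
  rewrite mulrA divff ?mul1r; last by rewrite expf_neq0 // gt_eqF.
  by rewrite exprn_ile1 ?invr_ge0 ?(ltW r0) // invf_le1 // ler1n; lia.
have h4 : (r%:R - 1) * th * (r%:R ^+ 2 * v) <= (r%:R - 1) * th * 1.
  by rewrite ler_wpM2l // mulr_ge0.
move: h4; rewrite expr2; lra.
Qed.

(* The first-order gain of a vertex with densities d l to the parts, compared with a vertex joined
   completely to the other parts. *)
Lemma gain (r : nat) (e : R) : (2 <= r)%N -> 0 < e -> exists2 kg : R * R, 0 < kg.1 /\ 0 < kg.2 &
  forall (d : 'I_r -> R) (c g : R), kap r / 2 <= c <= kap r -> 0 <= g <= kg.2 ->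
  (forall l, 0 <= d l <= r%:R^-1 + g) -> \sum_l d l <= 1 ->
  (forall l, e <= d l) \/ \sum_l d l <= 1 - r%:R^-1 - e ->
  kg.1 <= c * (1 - r%:R^-1 - \sum_l d l) + (\prod_l d l) * \sum_l d l.
Proof.
move=> r2 e0.
have r0 : 0 < r%:R :> R by rewrite ltr0n ltnW.
have k0 := kap_gt0 r2; have k1 := kap_le1 r2.
(* If all densities are at least [e], the product is at least [e ^+ r] and the sum at least [e], so
   the product term is at least [2 * tau]. *)
pose tau := e ^+ r.+1 / 2.
have tau0 : 0 < tau by rewrite divr_gt0 ?exprn_gt0.
pose w : R := r%:R^-1 ^+ r.-1.
have w0 : 0 < w by rewrite exprn_gt0 // invr_gt0.
(* One entry of the minimum for each case: a sum short by [e], a sum at most [tau] above [1 - r^-1],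
   and a larger sum. The bound on [g] makes [r * g] at most [tau / 2] and [tau ^+ 2 / 2]. *)
exists (Num.min (kap r * e / 2) (Num.min tau (w * tau ^+ 2 / 2)),
        Num.min (tau / (2 * r%:R)) (tau ^+ 2 / (2 * r%:R))) => /=.
  have h1 : 0 < kap r * e / 2 by rewrite divr_gt0 // mulr_gt0.
  have h2 : 0 < w * tau ^+ 2 / 2 by rewrite divr_gt0 // mulr_gt0 // exprn_gt0.
  have h3 : 0 < 2 * r%:R :> R by rewrite mulr_gt0.
  have h4 : 0 < tau ^+ 2 by rewrite exprn_gt0.
  split; rewrite !lt_min; first by rewrite h1 tau0 h2.
  by apply/andP; split; apply: divr_gt0.
move=> d c g /andP[c1 c2]; rewrite le_min => /andP[g0 /andP[g1 g2]] dP S1.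
set P := \prod_l d l; set S := \sum_l d l in S1 *.
have P0 : 0 <= P by apply: prodr_ge0 => l _; case/andP: (dP l).
have S0 : 0 <= S by apply: sumr_ge0 => l _; case/andP: (dP l).
have PS0 : 0 <= P * S by rewrite mulr_ge0.
have rE : r%:R * r%:R^-1 = 1 :> R by rewrite divff // gt_eqF.
rewrite !ge_min; case=> [he|hS]; last first.
  apply/orP; left; have : kap r / 2 * e <= c * (1 - r%:R^-1 - S); last lra.
  by apply: ler_pM => //; lra.
have Pe : e ^+ r <= P.
  rewrite -[r in e ^+ r]card_ord -prodr_const; apply: ler_prod => l _.
  by rewrite (ltW e0) he.
have Se : e <= S.
  have lr : (0 < r)%N := ltnW r2.
  rewrite /S (bigD1 (Ordinal lr)) //= ler_wpDr // sumr_ge0 // => l _.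
  by case/andP: (dP l).
have PSe : 2 * tau <= P * S.
  rewrite /tau mulrC divfK ?pnatr_eq0 // exprSr.
  by apply: ler_pM => //; [exact/exprn_ge0/ltW | exact: ltW].
have [hs|hs] := lerP (S - (1 - r%:R^-1)) tau.
  apply/orP; right; apply/orP; left.
  have [hs0|hs0] := lerP (S - (1 - r%:R^-1)) 0.
    have : 0 <= c * (1 - r%:R^-1 - S) by rewrite mulr_ge0; lra.
    lra.
  have : c * (S - (1 - r%:R^-1)) <= 1 * tau by apply: ler_pM; lra.
  lra.
apply/orP; right; apply/orP; right.
(* The sum now exceeds [1 - r^-1] by [sg > tau]. The linear bound gives a product of about [w * sg],
   and since [kap r = (1 - r^-1) * w], the product term beats the loss [c * sg] by about
   [w * sg ^+ 2]. *)
set m1 := r%:R^-1 + g.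
have m10 : 0 < m1 by rewrite ltr_wpDr // invr_gt0.
have hP : m1 ^+ r.-1 * (S - (r%:R - 1) * m1) <= P.
  have := @prod_ge_linear m1 [seq d l | l <- enum 'I_r] (ltW m10).
  rewrite size_map size_enum_ord !big_map /=.
  have -> : all (fun x => (0 <= x) && (x <= m1)) [seq d l | l <- enum 'I_r].
    by rewrite all_map; apply/allP => l _ /=; apply: dP.
  move/(_ isT); rewrite -/S -/P -[in m1 ^+ r](prednK (ltnW r2)).
  by rewrite exprS -mulrA ler_pM2l.
have E1 : (r%:R - 1) * m1 = (1 - r%:R^-1) + (r%:R - 1) * g by rewrite /m1; lra.
have r1 : 1 <= r%:R :> R by rewrite ler1n ltnW.
have rg1 : r%:R * g <= tau / 2.
  have := ler_wpM2l (ltW r0) g1; rewrite (_ : r%:R * (tau / _) = tau / 2) //.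
  by field; rewrite gt_eqF.
have rg2 : r%:R * g <= tau ^+ 2 / 2.
  have := ler_wpM2l (ltW r0) g2; rewrite (_ : r%:R * (tau ^+ 2 / _) = tau ^+ 2 / 2) //.
  by field; rewrite gt_eqF.
set sg := S - (1 - r%:R^-1) in hs.
have SE : S = 1 - r%:R^-1 + sg by rewrite /sg; lra.
have hP2 : w * (sg - (r%:R - 1) * g) <= P.
  apply: le_trans hP; rewrite E1 (_ : S - _ = sg - (r%:R - 1) * g); last by rewrite /sg; lra.
  apply: ler_wpM2r; first by rewrite /sg in hs *; lra.
  by apply: lerXn2r; rewrite ?nnegrE ?invr_ge0 ?(ltW r0) ?(ltW m10) // /m1; lra.
have hP3 := ler_wpM2r S0 hP2.
have kE : kap r = (1 - r%:R^-1) * w.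
  have hr : r%:R ^+ r = r%:R ^+ r.-1 * r%:R :> R by rewrite -exprSr prednK // ltnW.
  rewrite /kap /w hr exprVn.
  by rewrite invfM mulrA mulrAC mulrBl mul1r rE.
have hc : c * sg <= (1 - r%:R^-1) * w * sg by rewrite -kE ler_wpM2r //; lra.
have hgS : (r%:R - 1) * g * S <= tau ^+ 2 / 2.
  apply: le_trans rg2; apply: le_trans (_ : r%:R * g * 1 <= _); last by rewrite mulr1.
  by apply: ler_pM => //; [rewrite mulr_ge0 // subr_ge0 | rewrite ler_wpM2r //; lra].
have hs2 : tau ^+ 2 <= sg ^+ 2 by rewrite lerXn2r ?nnegrE //; lra.
have h5 : w * (tau ^+ 2 / 2) <= w * (sg ^+ 2 - (r%:R - 1) * g * S).
  by rewrite ler_wpM2l ?(ltW w0) //; lra.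
have E2 : w * (sg ^+ 2 - (r%:R - 1) * g * S) = w * (sg - (r%:R - 1) * g) * S - (1 - r%:R^-1) * w * sg.
  by rewrite {2}SE; rewrite SE; ring.
have E3 : 1 - r%:R^-1 - S = - sg by rewrite /sg; lra.
rewrite E3; lra.
Qed.

End RealLemmas.

(** * Counting arcs and fans through densities *)

Section Counting.
Variables (V : finType) (r : nat) (f : V -> 'I_r).
Implicit Types (W X : {set V}).

Lemma card_by_color X : #|X| = (\sum_l #|part f l :&: X|)%N.
Proof.
rewrite -sum1_card (partition_big f xpredT) //=; apply: eq_bigr => l _.
by rewrite sum1dep_card; apply: eq_card => v; rewrite !inE andbC.
Qed.

Lemma card_Kpart_in W :
  (#|arcs_in (Kpart f) W| + \sum_l #|part f l :&: W| ^ 2 = #|W| ^ 2)%N.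
Proof.
have -> : (\sum_l #|part f l :&: W| ^ 2)%N = #|arcs_in (fun u v => f u == f v) W|.
  rewrite card_arcs_in (partition_big f xpredT) //=; apply: eq_bigr => l _.
  rewrite -mulnn -sum_nat_const [RHS](eq_bigl (mem (part f l :&: W))); last first.
    by move=> v; rewrite !inE andbC.
  apply: eq_bigr => v; rewrite inE => /andP[]; rewrite inE => /eqP <- _.
  by apply: eq_card => w; rewrite !inE andbC eq_sym.
have -> : (#|W| ^ 2)%N = #|setX W W| by rewrite cardsX mulnn.
rewrite -(cardsID (arcs (Kpart f)) (setX W W)); congr (_ + _)%N; apply: eq_card => p.
  by rewrite !inE andbC.
by rewrite !inE /Kpart negbK andbC.
Qed.

Lemma sum_sqr_ge (R : realFieldType) (x : 'I_r -> R) (r0 : (0 < r)%N) :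
  (\sum_l x l) ^+ 2 / r%:R <= \sum_l x l ^+ 2.
Proof.
set s := \sum_l x l; have r0' : 0 < r%:R :> R by rewrite ltr0n.
have : 0 <= \sum_l (x l - s / r%:R) ^+ 2 by apply: sumr_ge0 => l _; apply: sqr_ge0.
have -> : \sum_l (x l - s / r%:R) ^+ 2 = \sum_l x l ^+ 2 - s ^+ 2 / r%:R.
  rewrite (eq_bigr (fun l => x l ^+ 2 + ((- 2 * (s / r%:R)) * x l + (s / r%:R) ^+ 2))); last first.
    by move=> l _; ring.
  rewrite !big_split /= -mulr_sumr -/s sumr_const card_ord -mulr_natr.
  by field; rewrite gt_eqF.
by rewrite subr_ge0.
Qed.

Lemma card_Kpart_le (R : realFieldType) W : (0 < r)%N ->
  #|arcs_in (Kpart f) W|%:R <= (1 - r%:R^-1) * #|W|%:R ^+ 2 :> R.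
Proof.
move=> r0; have := card_Kpart_in W; move/(congr1 (fun k => k%:R : R)).
rewrite natrD natrX natr_sum => H.
have := sum_sqr_ge (fun l => #|part f l :&: W|%:R : R) r0.
rewrite -natr_sum -card_by_color.
rewrite (eq_bigr (fun l => (#|part f l :&: W| ^ 2)%:R)); last by move=> l _; rewrite natrX.
move: H; move: (\sum_l _) (#|_|%:R : R) (#|_|%:R ^+ 2) => S K w; lra.
Qed.

(** An arc touches [Z], or is bad off [Z], or is bichromatic off [Z]. Solved for the middle term,
    this bounds the bad arcs off [Z] from below. *)
Lemma card_arcs_free_bad (A : rel V) (Z : {set V}) : graph A ->
  (#|arcs A| <= 2 * (\sum_(z in Z) #|nbr A z|) + #|free_bad f A Z| + #|arcs_in (Kpart f) (~: Z)|)%N.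
Proof.
move=> [symA _]; pose S1 := [set p : V * V | (p.1 \in Z) && (p.2 \in nbr A p.1)].
pose S2 := [set p : V * V | (p.2 \in Z) && (p.1 \in nbr A p.2)].
have c1 : #|S1| = (\sum_(z in Z) #|nbr A z|)%N by rewrite card_pairs_in.
have c2 : (#|S2| <= #|S1|)%N.
  rewrite -(card_imset _ (can_inj (@swap_pairK V V))); apply/subset_leq_card/subsetP => q.
  by move=> /imsetP[p + ->]; rewrite !inE.
rewrite mul2n -addnn -c1.
have : arcs A \subset S1 :|: S2 :|: free_bad f A Z :|: arcs_in (Kpart f) (~: Z).
  apply/subsetP => -[u v]; rewrite !inE /bad /Kpart /= => Auv.
  rewrite [A v u]symA Auv !andbT /=.
  by case: (u \in Z); case: (v \in Z); case: (f u == f v).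
move/subset_leq_card/leq_trans; apply.
apply: leq_trans (leq_card_setU _ _) _; rewrite leq_add2r.
apply: leq_trans (leq_card_setU _ _) _; rewrite leq_add2r.
by apply: leq_trans (leq_card_setU _ _) _; rewrite leq_add2l.
Qed.
End Counting.

Section FanBounds.
Variables (R : realFieldType) (V : finType) (r : nat) (f : V -> 'I_r) (A : rel V).
Hypothesis gA : graph A.
Hypothesis r2 : (2 <= r)%N.
Local Notation N := (#|V|%:R : R).

(** The [+ 1] in the size hypothesis pays for the coincidences [y = g (f y)], that is for the
    summand [r.-1 * \prod] in [card_fans]. *)
Lemma card_efans (Z : {set V}) p (th gam : R) :
  p \in free_bad f A Z -> 0 <= th <= r%:R^-1 -> 0 < N ->
  #|arcs (mis f A)|%:R <= gam * N ^+ 2 ->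
  (forall l, l != f p.1 -> (r%:R^-1 - th) * N + 1 <= #|epart f A Z p l|%:R) ->
  (kap R r - r%:R * th - 2 * r%:R ^+ 2 * gam) * N ^+ r
    <= #|fans f A (epart f A Z p) (erest f A Z p)|%:R.
Proof.
move=> pZ th01 N0 hm hl.
set k := f p.1; set F := fans _ _ _ _.
have CK : #|~: [set k]| = r.-1 by rewrite cardsC1 card_ord.
have kk : epart f A Z p k = [set p.1] by rewrite /epart eqxx.
have main : (#|V| ^ 2 * (\prod_l #|epart f A Z p l| * #|erest f A Z p|) <=
  #|V| ^ 2 * (#|F| + r.-1 * \prod_l #|epart f A Z p l|)
  + 2 * r ^ 2 * #|arcs (mis f A)| * #|V| ^ r)%N.
  have := card_fans gA (fun l u => @epartP V r f A gA Z p l u pZ) (Y := erest f A Z p) (K := [set k]).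
  rewrite CK prednK; last exact: ltnW.
  apply.
  - by move=> l /set1P ->; rewrite kk cards1.
  - move=> y; rewrite !inE negb_or => /andP[/andP[_ h] _]; by rewrite eq_sym eq_sym.
  - move=> l l' u w /set1P -> kl; rewrite kk => /set1P ->.
    by rewrite /epart eq_sym (negPf kl) !inE => /andP[_ /andP[/andP[_]]].
  - by move=> l u y /set1P ->; rewrite kk => /set1P -> ; rewrite !inE => /andP[_ /andP[]].
have Esum : #|erest f A Z p| = (\sum_(l in ~: [set k]) #|epart f A Z p l|)%N.
  rewrite (card_by_color f) (bigD1 k) //= [X in (X + _)%N](_ : _ = 0%N) ?add0n.
    apply: eq_big => l; rewrite ?inE // => lk; apply: eq_card => v.
    rewrite /epart (negPf lk) !inE negb_or; case: eqP => [->|_] //=.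
      by rewrite lk andbT.
    by rewrite andbF.
  by apply/eqP; rewrite cards_eq0 -subset0; apply/subsetP => v; rewrite !inE /k;
    case: (_ == _); rewrite ?orbT.
have Eprod : (\prod_l #|epart f A Z p l|)%N = (\prod_(l in ~: [set k]) #|epart f A Z p l|)%N.
  rewrite (bigD1 k) //= kk cards1 mul1n; by apply: eq_bigl => l; rewrite !inE.
move: main; rewrite Esum Eprod => main.
pose x := (r%:R^-1 - th) * N.
have x0 : 0 <= x by rewrite mulr_ge0 ?(ltW N0) // subr_ge0; case/andP: th01.
set P := (\prod_(l in _) _)%N in main; set Y := (\sum_(l in _) _)%N in main.
have hP : x ^+ r.-1 <= P%:R.
  rewrite -CK -prodr_const /P natr_prod; apply: ler_prod => l; rewrite !inE => lk.
  by rewrite x0 (le_trans _ (hl l lk)) // lerDl.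
have hY : (r%:R - 1) * (x + 1) <= Y%:R.
  have -> : r%:R - 1 = #|~: [set k]|%:R :> R by rewrite CK -subn1 natrB // ltnW.
  rewrite mulr_natl -sumr_const /Y natr_sum; apply: ler_sum => l; rewrite !inE; exact: hl.
move: main; rewrite -(ler_nat R) !(natrM, natrD, natrX).
have -> : r.-1%:R = r%:R - 1 :> R by rewrite -subn1 natrB // ltnW.
set F' := #|F|%:R; set P' := P%:R in hP *; set Y' := Y%:R in hY *.
set M := #|arcs _|%:R in hm *; set X := N ^+ r; set rr := r%:R in hY *.
move=> main.
have r1 : 0 <= rr - 1 by rewrite subr_ge0 ler1n ltnW.
have h1 : P' * Y' <= F' + (rr - 1) * P' + 2 * rr ^+ 2 * gam * X.
  have N2 : 0 < N ^+ 2 by rewrite exprn_gt0.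
  rewrite -(ler_pM2l N2); apply: le_trans main _.
  have hX : 0 <= X by rewrite exprn_ge0 // ltW.
  rewrite [leRHS]mulrDr lerD2l.
  rewrite [leRHS](_ : _ = 2 * rr ^+ 2 * (gam * N ^+ 2) * X); last by ring.
  by rewrite ler_wpM2r // ler_wpM2l // mulr_ge0 // sqr_ge0.
have h2 : (rr - 1) * x ^+ r <= P' * (Y' - (rr - 1)).
  have -> : x ^+ r = x ^+ r.-1 * x by rewrite -exprSr prednK // ltnW.
  rewrite mulrCA; apply: ler_pM => //; [exact: exprn_ge0 | exact: mulr_ge0 |].
  move: hY; rewrite mulrDr mulr1; lra.
have h3 : (kap R r - rr * th) * X <= (rr - 1) * x ^+ r.
  rewrite /x exprMn mulrA ler_wpM2r ?exprn_ge0 ?(ltW N0) //.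
  exact: kap_pow.
move: h1 h2 h3; rewrite !mulrBl mulrBr; lra.
Qed.

(** Here no coordinate is frozen. The error [r / N] comes from the coincidences [y = g (f y)], the
    error [2 * r ^+ 2 * gam] from the missing pairs. *)
Lemma card_vfans (Z : {set V}) z (gam : R) : 0 < N ->
  #|arcs (mis f A)|%:R <= gam * N ^+ 2 ->
  (\prod_l (#|vpart f A Z z l|%:R / N) * \sum_l (#|vpart f A Z z l|%:R / N)
     - (r%:R / N + 2 * r%:R ^+ 2 * gam)) * (N * N ^+ r)
  <= #|fans f A (vpart f A Z z) (vrest A Z z)|%:R.
Proof.
move=> N0 hm; set F := fans _ _ _ _.
have main : (#|V| ^ 2 * (\prod_l #|vpart f A Z z l| * #|vrest A Z z|) <=
  #|V| ^ 2 * (#|F| + r * \prod_l #|vpart f A Z z l|)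
  + 2 * r ^ 2 * #|arcs (mis f A)| * #|V| ^ r.+1)%N.
  have := card_fans gA (@vpartP V r f A Z z) (Y := vrest A Z z) (K := set0).
  rewrite setC0 cardsT card_ord; apply.
  - by move=> l; rewrite inE.
  - by move=> y _; rewrite in_set0.
  - by move=> l l' u w; rewrite inE.
  - by move=> l l' u; rewrite inE.
have Esum : #|vrest A Z z| = (\sum_l #|vpart f A Z z l|)%N.
  rewrite (card_by_color f); apply: eq_bigr => l _; apply: eq_card => v.
  by rewrite !inE; do !case: (_ \in _); rewrite ?andbF ?andbT.
have Ple : ((\prod_l #|vpart f A Z z l|)%N%:R : R) <= N ^+ r.
  rewrite natr_prod -[r in N ^+ r]card_ord -prodr_const; apply: ler_prod => l _.
  by rewrite ler0n ler_nat max_card.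
have E1 : \prod_l (#|vpart f A Z z l|%:R / N) = (\prod_l #|vpart f A Z z l|)%N%:R / N ^+ r.
  rewrite big_split /= natr_prod prodr_const card_ord exprVn //.
have E2 : \sum_l (#|vpart f A Z z l|%:R / N) = #|vrest A Z z|%:R / N.
  by rewrite -mulr_suml Esum natr_sum.
rewrite E1 E2; move: main Ple; rewrite -(ler_nat R) !(natrM, natrD, natrX).
move: (\prod_l #|vpart f A Z z l|)%N => P; rewrite (exprS N r).
move: (#|vrest A Z z|%:R : R) (#|F|%:R : R) (P%:R : R) => Y' F' P' main Ple.
set X := N ^+ r in main Ple *.
have X0 : 0 < X by rewrite exprn_gt0.
have -> : (P' / X * (Y' / N) - (r%:R / N + 2 * r%:R ^+ 2 * gam)) * (N * X)
  = P' * Y' - r%:R * X - 2 * r%:R ^+ 2 * gam * (N * X).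
  by field; rewrite !gt_eqF.
have N2 : 0 < N ^+ 2 by rewrite exprn_gt0.
rewrite -(ler_pM2l N2).
have hNX : 0 <= 2 * r%:R ^+ 2 * (N * X) by rewrite !mulr_ge0 ?sqr_ge0 ?(ltW N0) ?(ltW X0).
have h1 := ler_wpM2l hNX hm.
have h2 : N ^+ 2 * (r%:R * P') <= N ^+ 2 * (r%:R * X).
  by rewrite ler_wpM2l ?(ltW N2) // ler_wpM2l.
lra.
Qed.

Lemma card_epart (Z : {set V}) p l : p \in free_bad f A Z -> l != f p.1 ->
  (#|part f l| <= #|epart f A Z p l| + #|nbr (mis f A) p.1| + #|nbr (mis f A) p.2| + #|Z|)%N.
Proof.
case: p => a b; rewrite !inE /= => /andP[/andP[_ /eqP fab] _] la.
have : part f l \subset epart f A Z (a, b) l :|: nbr (mis f A) a :|: nbr (mis f A) b :|: Z.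
  apply/subsetP => v; rewrite /epart /= (negPf la) !inE => /eqP fv.
  rewrite fv eqxx /mis fv -fab eq_sym la !andbT /=.
  by case: (A a v); case: (A b v); case: (v \in Z).
move/subset_leq_card/leq_trans; apply.
do 2![apply: leq_trans (leq_card_setU _ _) _; rewrite leq_add2r].
exact: leq_card_setU.
Qed.

Lemma card_nbr_mis v : (#|nbr A v| + #|nbr (mis f A) v| + #|part f (f v)| =
  #|nbr (bad f A) v| + #|V|)%N.
Proof.
rewrite -(cardsID (part f (f v)) (nbr A v)) -(cardsC (part f (f v))).
have -> : nbr A v :&: part f (f v) = nbr (bad f A) v.
  by apply/setP => u; rewrite !inE /bad [f v == _]eq_sym.
have -> : #|~: part f (f v)| = (#|nbr A v :\: part f (f v)| + #|nbr (mis f A) v|)%N.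
  rewrite -(cardsID (nbr A v) (~: _)); congr (_ + _)%N.
    by apply: eq_card => u; rewrite !inE.
  by apply: eq_card => u; rewrite !inE /mis [f v == _]eq_sym.
clear gA r2; lia.
Qed.
End FanBounds.

Section FirstOrder.
Variables (R : realFieldType) (V : finType) (r : nat) (f : V -> 'I_r) (A : rel V).
Hypothesis gA : graph A.
Hypothesis r2 : (2 <= r)%N.
Local Notation N := (#|V|%:R : R).
Variables (Z : {set V}) (t e : R).
Hypothesis N0 : 0 < N.
Hypothesis t0 : 0 <= t.
Hypothesis e0 : 0 <= e.
Hypothesis tN : 1 <= t * N.
Hypothesis partN : forall l, (r%:R^-1 - t) * N <= #|part f l|%:R.
Hypothesis misN : #|arcs (mis f A)|%:R <= t * N ^+ 2.
Hypothesis ZN : #|Z|%:R <= t * N.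
Hypothesis Zmis : forall v, v \notin Z -> #|nbr (mis f A) v|%:R <= e * N.
Hypothesis te : 3 * t + 2 * e <= r%:R^-1.

(** The summand [3 * t] collects the deviation of a class size, the set [Z] and the [+ 1] of
    [card_efans]; [2 * e] stands for the missing pairs at the two ends of the edge, and the last
    term for all missing pairs. *)
Definition edge_cost : R := kap R r - r%:R * (3 * t + 2 * e) - 2 * r%:R ^+ 2 * t.

Lemma edge_cost_le p : p \in free_bad f A Z ->
  edge_cost * N ^+ r <= #|fans f A (epart f A Z p) (erest f A Z p)|%:R.
Proof.
move=> pZ; apply: card_efans => //.
  by rewrite te andbT addr_ge0 // mulr_ge0.
move=> l lp; have := card_epart pZ lp; rewrite -(ler_nat R) !natrD.
move: (pZ); rewrite !inE => /andP[_ /andP[/Zmis h1 /Zmis h2]].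
move: h1 h2 (partN l) ZN tN.
move: (#|epart _ _ _ _ _|%:R : R) (#|nbr _ p.1|%:R : R) (#|nbr _ p.2|%:R : R) => *; lra.
Qed.

Lemma bad_edge_copies p : p \in free_bad f A Z ->
  edge_cost * N ^+ r <= #|[set t in ocopies r A | (p.1 \in t.1) && (p.2 \in t.1)]|%:R.
Proof.
move=> pZ; apply: le_trans (edge_cost_le pZ) _; rewrite ler_nat.
apply: (card_fans_le gA (fun l u => @epartP V r f A gA Z p l u pZ) (@erestP V r f A Z p)).
by move=> gy /(fan_epart gA pZ)[_ /and3P[-> ->]].
Qed.

Lemma weighted_lower_count :
  #|free_bad f A Z|%:R * (edge_cost * N ^+ r) +
  2 * \sum_(z in Z) #|fans f A (vpart f A Z z) (vrest A Z z)|%:R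
  <= 2 * #|ocopies r A|%:R.
Proof.
have : (2 * (\sum_(z in Z) #|fans f A (vpart f A Z z) (vrest A Z z)|) +
  \sum_(p in free_bad f A Z) #|fans f A (epart f A Z p) (erest f A Z p)|
  <= 2 * #|ocopies r A|)%N.
  by apply: leq_trans (lower_count f gA Z); rewrite leq_addr.
rewrite -(ler_nat R) natrD !natrM !natr_sum; apply: le_trans.
rewrite addrC lerD2l mulr_natl -sumr_const.
exact: ler_sum edge_cost_le.
Qed.

Definition vdens z l : R := #|vpart f A Z z l|%:R / N.
(** A vertex of degree below [(1 - r^-1) * N] forces as many additional bad edges elsewhere, each at
    the price [edge_cost]; the second summand counts the fans at [z]. *)
Definition vgain z : R :=
  edge_cost * (1 - r%:R^-1 - \sum_l vdens z l) + (\prod_l vdens z l) * \sum_l vdens z l.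

Lemma sum_vdens z : (\sum_l vdens z l) * N = #|vrest A Z z|%:R.
Proof.
rewrite /vdens -mulr_suml divfK ?gt_eqF // -natr_sum; congr (_%:R).
rewrite (card_by_color f); apply: eq_bigr => l _; apply: eq_card => v.
by rewrite !inE; do !case: (_ \in _); rewrite ?andbF ?andbT.
Qed.

(** Arcs of [A] that neither touch [Z] nor join two classes are bad, so their number is forced. Each
    vertex of [Z] brings the error [2 * t] in the arc count, [r * t] for coincidences and
    [2 * r ^+ 2 * t] for missing pairs. *)
Lemma first_order_count (q : nat) : 0 <= edge_cost ->
  (1 - r%:R^-1) * N ^+ 2 - r%:R + 2 * q%:R <= #|arcs A|%:R ->
  N ^+ r * (edge_cost * (q%:R - r%:R / 2) +
    N * \sum_(z in Z) (vgain z - (2 + r%:R + 2 * r%:R ^+ 2) * t)) <= #|ocopies r A|%:R.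
Proof.
move=> c0 hA; set err := (_ * t).
have X0 : 0 < N ^+ r by rewrite exprn_gt0.
have cle1 : edge_cost <= 1.
  have := kap_le1 R r2; rewrite /edge_cost.
  have : 0 <= r%:R * (3 * t + 2 * e) by rewrite !(mulr_ge0, addr_ge0).
  have : 0 <= 2 * r%:R ^+ 2 * t by rewrite !mulr_ge0 ?exprn_ge0.
  lra.
have hF : N ^+ r * (N * \sum_(z in Z) ((\prod_l vdens z l) * \sum_l vdens z l - (r%:R + 2 * r%:R ^+ 2) * t))
    <= \sum_(z in Z) #|fans f A (vpart f A Z z) (vrest A Z z)|%:R.
  rewrite !mulr_sumr; apply: ler_sum => z _.
  apply: le_trans (card_vfans gA Z z N0 misN).
  rewrite mulrA [N ^+ r * N]mulrC [leLHS]mulrC.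
  apply: ler_wpM2r; first by rewrite mulr_ge0 ?ltW.
  rewrite lerD2l lerN2.
  have : r%:R / N <= r%:R * t; last by rewrite mulrDl; lra.
  rewrite ler_wpM2l // -(ler_pM2r N0) mulVf ?gt_eqF //.
have hB : 2 * (q%:R - r%:R / 2) + 2 * (N * \sum_(z in Z) (1 - r%:R^-1 - \sum_l vdens z l - 2 * t))
    <= #|free_bad f A Z|%:R.
  have := card_arcs_free_bad f Z gA; rewrite -(ler_nat R) 2!natrD natrM => h1.
  have r0 : (0 < r)%N by rewrite ltnW.
  have h2 := card_Kpart_le f R (~: Z) r0.
  have h3 : #|~: Z|%:R = N - #|Z|%:R :> R by rewrite cardsCs setCK natrB // max_card.
  have h4 : (\sum_(z in Z) #|nbr A z|)%N%:R <= \sum_(z in Z) ((\sum_l vdens z l) * N + t * N).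
    rewrite natr_sum; apply: ler_sum => z _; rewrite sum_vdens.
    apply: le_trans (_ : #|vrest A Z z|%:R + #|Z|%:R <= _); last by rewrite lerD2l.
    rewrite -natrD ler_nat -(cardsID Z (nbr A z)) addnC leq_add2l.
    by rewrite subset_leq_card // subsetIr.
  have E : 2 * (N * \sum_(z in Z) (1 - r%:R^-1 - \sum_l vdens z l - 2 * t))
    = 2 * ((1 - r%:R^-1) * (N * #|Z|%:R)) - 2 * \sum_(z in Z) ((\sum_l vdens z l) * N + t * N)
      - 2 * (t * N * #|Z|%:R).
    have EZ (x : R) : x * #|Z|%:R = \sum_(z in Z) x by rewrite sumr_const mulr_natr.
    rewrite (EZ N) (EZ (t * N)) !mulr_sumr -!sumrN -!big_split /=.
    by apply: eq_bigr => z _; ring.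
  rewrite E; rewrite h3 in h2.
  have h5 : (1 - r%:R^-1) * #|Z|%:R ^+ 2 <= t * N * #|Z|%:R.
    have rV0 : 0 <= r%:R^-1 :> R by rewrite invr_ge0.
    have rV1 : 0 <= 1 - r%:R^-1 :> R by rewrite subr_ge0 invf_le1 ?ler1n ?ltr0n.
    apply: le_trans (_ : 1 * #|Z|%:R ^+ 2 <= _).
      by rewrite ler_wpM2r ?sqr_ge0 //; lra.
    by rewrite mul1r expr2 ler_wpM2r.
  have h6 : 0 <= t * N * #|Z|%:R by rewrite !mulr_ge0 // ltW.
  move: h1 h2 h4 h5 h6 hA.
  move: ((\sum_(z in Z) #|nbr A z|)%N%:R : R) (#|free_bad _ _ _|%:R : R) => S1 FB.
  move: (\sum_(z in Z) (_ + _)) => S2.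
  rewrite (_ : (1 - r%:R^-1) * (N - #|Z|%:R) ^+ 2 = (1 - r%:R^-1) * N ^+ 2
    - 2 * ((1 - r%:R^-1) * (N * #|Z|%:R)) + (1 - r%:R^-1) * #|Z|%:R ^+ 2); last by ring.
  move: (#|arcs _|%:R : R) (#|arcs_in _ _|%:R : R) => a1 a2.
  move=> h1 h2 h4 h5 h6 hA; lra.
have W := weighted_lower_count.
have h7 := ler_wpM2r (mulr_ge0 c0 (ltW X0)) hB.
have h8 : 0 <= (1 - edge_cost) * (N ^+ r * (N * \sum_(z in Z) (2 * t))).
  rewrite mulr_ge0 ?subr_ge0 // mulr_ge0 ?(ltW X0) // mulr_ge0 ?(ltW N0) //.
  by apply: sumr_ge0 => _ _; rewrite mulr_ge0.
have E2 : \sum_(z in Z) (vgain z - err)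
   = edge_cost * \sum_(z in Z) (1 - r%:R^-1 - \sum_l vdens z l - 2 * t)
   + \sum_(z in Z) ((\prod_l vdens z l) * \sum_l vdens z l - (r%:R + 2 * r%:R ^+ 2) * t)
   - (1 - edge_cost) * \sum_(z in Z) (2 * t).
  rewrite !mulr_sumr -sumrN -!big_split /=; apply: eq_bigr => z _.
  by rewrite /vgain /err; ring.
rewrite E2; move: W hF h7 h8.
move: (\sum_(z in Z) _) (\sum_(z in Z) _) (\sum_(z in Z) _) (\sum_(z in Z) _) (N ^+ r) (#|free_bad _ _ _|%:R : R) => S1 S2 S3 S4 X FB.
lra.
Qed.
End FirstOrder.

(** * Absence of atypical vertices *)

Section Typical.
Variables (R : realFieldType) (V : finType) (r : nat) (f : V -> 'I_r) (A : rel V).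
Hypothesis gA : graph A.
Hypothesis r2 : (2 <= r)%N.
Local Notation N := (#|V|%:R : R).
Hypothesis N0 : 0 < N.

Definition cut_maximal :=
  forall v l, (#|nbr (bad f A) v| <= #|part f l :&: nbr A v|)%N.

(** The variance of the class sizes is exactly what [Kpart f] lacks to [(1 - r^-1) * N ^+ 2]. Since
    [A] nearly reaches that number with few bad arcs, the variance and the number of missing arcs
    are both small. *)
Lemma part_sizes (gam t : R) : 0 <= t ->
  #|arcs (bad f A)|%:R <= gam * N ^+ 2 -> r%:R <= gam * N ^+ 2 -> 2 * gam <= t ^+ 2 ->
  (1 - r%:R^-1) * N ^+ 2 - r%:R <= #|arcs A|%:R ->
  (forall l, `|#|part f l|%:R - r%:R^-1 * N| <= t * N) /\
  #|arcs (mis f A)|%:R <= 2 * gam * N ^+ 2.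
Proof.
move=> t0 hb hr gt hA.
have hK := card_Kpart_in f setT.
have KE : arcs_in (Kpart f) setT = arcs (Kpart f).
  by apply/setP => p; rewrite in_set !in_setT !andbT.
rewrite KE cardsT in hK.
have {hK} : #|arcs (Kpart f)|%:R + \sum_l #|part f l|%:R ^+ 2 = N ^+ 2.
  rewrite -natrX -hK natrD natr_sum; congr (_ + _).
  by apply: eq_bigr => l _; rewrite natrX setIT.
have hbal : #|arcs A|%:R + #|arcs (mis f A)|%:R = #|arcs (bad f A)|%:R + #|arcs (Kpart f)|%:R :> R.
  by rewrite -!natrD (arcs_balance f A).
have hKle := card_Kpart_le f R setT (ltnW r2); rewrite KE cardsT in hKle.
move=> hK.
have E : \sum_l (#|part f l|%:R - r%:R^-1 * N) ^+ 2
   = \sum_l #|part f l|%:R ^+ 2 - r%:R^-1 * N ^+ 2.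
  have r0 : r%:R != 0 :> R by rewrite pnatr_eq0 -lt0n ltnW.
  rewrite (eq_bigr (fun l => #|part f l|%:R ^+ 2 + ((- 2 * (r%:R^-1 * N)) * #|part f l|%:R
     + (r%:R^-1 * N) ^+ 2))); last by move=> l _; ring.
  rewrite !big_split /= -mulr_sumr -natr_sum (sum_part f) sumr_const card_ord -mulr_natr.
  by field.
split; last first.
  have := ler0n R #|arcs (bad f A)|; lra.
move=> l; have tN0 : 0 <= t * N by rewrite mulr_ge0 // ltW.
rewrite -ler_sqr ?nnegrE // real_normK ?num_real // exprMn.
apply: le_trans (_ : 2 * gam * N ^+ 2 <= _); last by rewrite ler_wpM2r ?sqr_ge0.
apply: le_trans (_ : \sum_l (#|part f l|%:R - r%:R^-1 * N) ^+ 2 <= _).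
  by rewrite [leRHS](bigD1 l) //= lerDl sumr_ge0 // => *; apply: sqr_ge0.
have := ler0n R #|arcs (mis f A)|; rewrite E; lra.
Qed.

(** Both alternatives of [gain] occur. If the bad degree exceeds [x / 4 * N], then by cut maximality
    so does the degree into every class. Otherwise the missing degree exceeds [x * N], and the total
    degree is too small. *)
Lemma atypical_gain (Z : {set V}) (t e x k g : R) z : cut_maximal ->
  0 <= t -> 0 < x -> t <= x / 8 -> t <= g ->
  kap R r / 2 <= edge_cost r t e <= kap R r ->
  (forall l, `|#|part f l|%:R - r%:R^-1 * N| <= t * N) -> #|Z|%:R <= t * N ->
  (forall (d : 'I_r -> R) (c g' : R), kap R r / 2 <= c <= kap R r -> 0 <= g' <= g ->
    (forall l, 0 <= d l <= r%:R^-1 + g') -> \sum_l d l <= 1 ->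
    (forall l, x / 8 <= d l) \/ \sum_l d l <= 1 - r%:R^-1 - x / 8 ->
    k <= c * (1 - r%:R^-1 - \sum_l d l) + (\prod_l d l) * \sum_l d l) ->
  (x * N < #|nbr (bad f A) z|%:R) || (x * N < #|nbr (mis f A) z|%:R) ->
  k <= vgain f A Z t e z.
Proof.
move=> mc t0 x0 tx tg hc hs hZ hg hz.
have dN l : vdens R f A Z z l * N = #|vpart f A Z z l|%:R by rewrite divfK ?gt_eqF.
have vp l : #|vpart f A Z z l|%:R <= #|part f l|%:R :> R.
  by rewrite ler_nat; apply/subset_leq_card/subsetP => v; rewrite !inE => /andP[_ /andP[]].
have SN := sum_vdens f A Z N0 z.
apply: (hg _ _ t) => //.
- by rewrite t0.
- move=> l; rewrite divr_ge0 ?(ltW N0) //= -(ler_pM2r N0) dN mulrDl.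
  apply: le_trans (vp l) _; have := ler_normlW (hs l); lra.
- by rewrite -(ler_pM2r N0) SN mul1r ler_nat max_card.
have [hb|hb] := ltrP (x / 4 * N) #|nbr (bad f A) z|%:R.
  left => l; rewrite -(ler_pM2r N0) dN.
  have h1 : (#|nbr (bad f A) z| <= #|vpart f A Z z l| + #|Z|)%N.
    apply: leq_trans (mc z l) _; rewrite -(cardsID Z (_ :&: _)) addnC leq_add2l.
    by rewrite subset_leq_card // subsetIr.
  move: h1; rewrite -(ler_nat R) natrD => h1.
  have := ler_wpM2r (ltW N0) tx; lra.
right; rewrite -(ler_pM2r N0) SN.
have hm : x * N < #|nbr (mis f A) z|%:R.
  case/orP: hz => // h; have := mulr_gt0 x0 N0; lra.
have h1 : (#|vrest A Z z| <= #|nbr A z|)%N by rewrite subset_leq_card // subsetDl.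
move: h1 (card_nbr_mis f A z) => h1 /(congr1 (fun k => k%:R : R)).
rewrite !natrD; move: h1; rewrite -(ler_nat R) => h1 h2.
have := hs (f z); rewrite ler_norml => /andP[h3 _].
have := mulr_gt0 x0 N0; have := ler_wpM2r (ltW N0) tx; lra.
Qed.

Lemma card_atypical (gam e0 : R) : 0 < e0 ->
  #|arcs (bad f A)|%:R <= gam * N ^+ 2 -> #|arcs (mis f A)|%:R <= 2 * gam * N ^+ 2 ->
  #|[set v | (e0 * N < #|nbr (bad f A) v|%:R) || (e0 * N < #|nbr (mis f A) v|%:R)]|%:R * e0
   <= 3 * gam * N.
Proof.
move=> e00 hb hm; set Z := [set v | _].
rewrite -(ler_pM2r N0) -mulrA.
apply: le_trans (_ : (#|arcs (bad f A)| + #|arcs (mis f A)|)%N%:R <= _); last first.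
  by rewrite natrD; lra.
rewrite !card_arcs -big_split natr_sum /= mulr_natl -sumr_const mulr_suml.
rewrite [leRHS](bigID (mem Z)) /= -[leLHS]addr0; apply: lerD; last first.
  by apply: sumr_ge0 => v _; rewrite ler0n.
apply: ler_sum => v; rewrite inE natrD => /orP[h|h]; apply: le_trans (ltW h) _.
  by rewrite lerDl.
by rewrite lerDr.
Qed.
End Typical.

Ltac positivity := repeat first
  [ done | apply/andP; split | apply: divr_gt0 | apply: mulr_gt0 | apply: addr_gt0 | apply: exprn_gt0 ].

(** Two thresholds are needed. Vertices beyond [e' * N] go to [Z], where their contribution is at
    least nonnegative; one vertex beyond [e * N] contributes a multiple of [k' * N]. The price of a
    bad edge is only known up to about [2 * r * e'], so [e'] is chosen small against [k']. *)
Lemma typical_structure (R : realFieldType) r (e : R) : (2 <= r)%N -> 0 < e -> e <= 1 ->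
  exists gam eta Lam : R, [/\ 0 < gam, 0 < eta &
  forall (V : finType) (f : V -> 'I_r) (A : rel V) (q : nat), let N := #|V|%:R : R in
  graph A -> cut_maximal f A -> Lam <= N -> #|arcs (bad f A)|%:R <= gam * N ^+ 2 ->
  (1 - r%:R^-1) * N ^+ 2 - r%:R + 2 * q%:R <= #|arcs A|%:R -> q%:R <= N ->
  #|ocopies r A|%:R <= kap R r * q%:R * N ^+ r + eta * (N * N ^+ r) ->
  [/\ forall v, #|nbr (bad f A) v|%:R <= e * N, forall v, #|nbr (mis f A) v|%:R <= e * N,
      forall l, `|#|part f l|%:R - r%:R^-1 * N| <= e * N &
      #|arcs (mis f A)|%:R <= e * N ^+ 2]].
Proof.
move=> r2 e0 e1.
have k0 := kap_gt0 R r2; have k1 := kap_le1 R r2.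
have rr0 : 0 < r%:R :> R by rewrite ltr0n ltnW.
have rr2 : 2 <= r%:R :> R by rewrite ler_nat.
have rV : r%:R * r%:R^-1 = 1 :> R by rewrite divff // gt_eqF.
have d8 (x : R) : 0 < x -> 0 < x / 8 by move=> x0; rewrite divr_gt0.
have [[k' g'] /= [k'0 g'0] Hg'] := gain r2 (d8 _ e0).
pose e' := Num.min e (Num.min (k' / (64 * r%:R)) (kap R r / (16 * r%:R))).
have e'0 : 0 < e' by rewrite !lt_min; positivity.
have [[k'' g''] /= [k''0 g''0] Hg''] := gain r2 (d8 _ e'0).
pose K : R := 4 + 4 * r%:R + 4 * r%:R ^+ 2.
have K0 : 0 < K by rewrite /K; positivity.
pose t := Num.min (Num.min g' g'') (Num.min (e' / 8) (Num.min (k' / (16 * K))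
  (Num.min (k'' / K) (kap R r / (8 * K))))).
have t0 : 0 < t.
  by rewrite !lt_min; positivity.
pose gam := Num.min (t ^+ 2 / 2) (Num.min (t * e' / 3) (t / 2)).
have gam0 : 0 < gam by rewrite !lt_min; positivity.
exists gam, (k' / 8), (Num.max 1 (Num.max t^-1 (r%:R / gam))); split=> //; first exact: d8.
move=> V f A q gA mc; set N : R := #|V|%:R; rewrite !ge_max => /and3P[N1 Nt Ng] hb hA qN hcop.
have N0 : 0 < N by apply: lt_le_trans N1.
have : e' <= e' by []; rewrite {2}/e' !le_min => /and3P[e'e e'k' e'k].
have : t <= t by []; rewrite {2}/t !le_min => /andP[/andP[tg' tg''] /and4P[te' tk' tk'' tk]].
have : gam <= gam by []; rewrite {2}/gam !le_min => /and3P[gt2 gte gt].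
have {}e'k' : r%:R * e' <= k' / 64.
  by move: e'k'; rewrite ler_pdivlMr ?mulr_gt0 // => h; clear -h; lra.
have {}e'k : r%:R * e' <= kap R r / 16.
  by move: e'k; rewrite ler_pdivlMr ?mulr_gt0 // => h; clear -h; lra.
have {}tk' : K * t <= k' / 16.
  by move: tk'; rewrite ler_pdivlMr ?mulr_gt0 // => h; clear -h; lra.
have {}tk'' : K * t <= k'' by move: tk''; rewrite ler_pdivlMr // mulrC.
have {}tk : K * t <= kap R r / 8.
  by move: tk; rewrite ler_pdivlMr ?mulr_gt0 // => h; clear -h; lra.
clearbody gam t; clearbody e'.
have tN : 1 <= t * N by rewrite -(ler_pM2l t0) mulrV ?unitf_gt0 // in Nt.
have rgN : r%:R <= gam * N ^+ 2.
  apply: le_trans (_ : gam * N <= _).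
    by move: Ng; rewrite ler_pdivrMr // mulrC.
  by rewrite ler_wpM2l ?(ltW gam0) // expr2 ler_peMl // ltW.
have hA' : (1 - r%:R^-1) * N ^+ 2 - r%:R <= #|arcs A|%:R.
  by have := ler0n R q; clear -hA; lra.
have gt2' : 2 * gam <= t ^+ 2 by clear -gt2; lra.
have [hs hm] := part_sizes r2 (ltW t0) hb rgN gt2' hA'.
have hN2 : 0 <= N ^+ 2 by rewrite sqr_ge0.
have hm' : #|arcs (mis f A)|%:R <= t * N ^+ 2.
  by apply: le_trans hm _; rewrite ler_wpM2r //; clear -gt; lra.
pose Z := [set v | (e' * N < #|nbr (bad f A) v|%:R) || (e' * N < #|nbr (mis f A) v|%:R)].
have hZ : #|Z|%:R <= t * N.
  have := card_atypical N0 e'0 hb hm; rewrite -/Z => h.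
  rewrite -(ler_pM2r e'0); apply: le_trans h _.
  have := ler_wpM2r (ltW N0) gte; clear; lra.
have Zmis v : v \notin Z -> #|nbr (mis f A) v|%:R <= e' * N.
  by rewrite inE negb_or -!leNgt => /andP[].
have Kt : K * t = 4 * t + 4 * r%:R * t + 4 * r%:R ^+ 2 * t by rewrite /K; ring.
have rt0 : 0 <= r%:R * t by rewrite mulr_ge0 // ltW.
have r2t0 : 0 <= r%:R ^+ 2 * t by rewrite mulr_ge0 ?sqr_ge0 // ltW.
have partN l : (r%:R^-1 - t) * N <= #|part f l|%:R.
  by have := hs l; rewrite ler_norml => /andP[h _]; clear -h; lra.
have te : 3 * t + 2 * e' <= r%:R^-1.
  rewrite -(ler_pM2l rr0) rV; clear -e'k tk Kt rt0 r2t0 k1 t0; lra.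
have cE : edge_cost r t e' = kap R r - 3 * (r%:R * t) - 2 * (r%:R * e') - 2 * (r%:R ^+ 2 * t).
  by rewrite /edge_cost; ring.
have hc : kap R r / 2 <= edge_cost r t e' <= kap R r.
  rewrite cE; have : 0 <= r%:R * e' by rewrite mulr_ge0 ?ltW.
  clear -e'k tk Kt rt0 r2t0 t0 k0 => h; apply/andP; split; lra.
have c0 : 0 <= edge_cost r t e' by case/andP: hc => h _; clear -h k0; lra.
have fo := first_order_count gA r2 N0 (ltW t0) (ltW e'0) tN partN hm' hZ Zmis te c0 hA.
have errE : (2 + r%:R + 2 * r%:R ^+ 2) * t <= K * t.
  by rewrite Kt; clear -rt0 r2t0 t0; lra.
have pos z : z \in Z -> 0 <= vgain f A Z t e' z - (2 + r%:R + 2 * r%:R ^+ 2) * t.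
  rewrite inE => hz.
  have := atypical_gain N0 mc (ltW t0) e'0 te' tg'' hc hs hZ Hg'' hz; clear -errE tk''; lra.
have noatyp v : ~~ ((e * N < #|nbr (bad f A) v|%:R) || (e * N < #|nbr (mis f A) v|%:R)).
  apply/negP => hv.
  have eN : e' * N <= e * N by rewrite ler_wpM2r // ltW.
  have vZ : v \in Z.
    by rewrite inE; case/orP: hv => h; rewrite (le_lt_trans eN h) ?orbT.
  have te8 : t <= e / 8 by clear -te' e'e; lra.
  have hk := atypical_gain N0 mc (ltW t0) e0 te8 tg' hc hs hZ Hg' hv.
  have X0 : 0 < N ^+ r by rewrite exprn_gt0.
  move: (le_trans fo hcop).
  rewrite [leRHS](_ : _ = N ^+ r * (kap R r * q%:R + k' / 8 * N)); last by ring.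
  rewrite ler_pM2l // (bigD1 v) //=.
  have h0 : 0 <= \sum_(z in Z | z != v) (vgain f A Z t e' z - (2 + r%:R + 2 * r%:R ^+ 2) * t).
    by apply: sumr_ge0 => z /andP[/pos].
  move: h0; move: (\sum_(z in Z | _) _) => S S0.
  (* After division by [N ^+ r] the vertex [v] alone contributes [k' / 2 * N], while the upper bound
     leaves room for [k' / 8 + k' / 8 + k' / 16] times [N]. *)
  have h1 : N * (k' / 2) <= N * (vgain f A Z t e' v - (2 + r%:R + 2 * r%:R ^+ 2) * t + S).
    by rewrite ler_wpM2l ?(ltW N0) //; clear -hk errE tk' S0 k'0; lra.
  have h2 : (kap R r - edge_cost r t e') * q%:R <= k' / 8 * N.
    apply: ler_pM => //; [case/andP: hc => _; clear; lra|rewrite cE].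
    clear -e'k' tk' Kt rt0 r2t0 t0 k'0; lra.
  have h3 : edge_cost r t e' * (r%:R / 2) <= k' / 16 * N.
    apply: le_trans (_ : 1 * (r%:R * (t * N)) <= _).
      apply: ler_pM => //; [clear -rr0; lra| case/andP: hc => _; clear -k1; lra |].
      have := ler_wpM2l (ltW rr0) tN; clear -rr0; lra.
    rewrite mul1r mulrA ler_wpM2r ?(ltW N0) //; clear -tk' Kt r2t0 t0 rt0; lra.
  have h4 : 0 < k' * N by rewrite mulr_gt0.
  move: h1 h2 h3 h4; move: (N * (_ + S)) => Y; clear; lra.
split.
- by move=> v; move: (noatyp v); rewrite negb_or -!leNgt => /andP[].
- by move=> v; move: (noatyp v); rewrite negb_or -!leNgt => /andP[].
- move=> l; apply: le_trans (hs l) _; rewrite ler_wpM2r ?(ltW N0) //; clear -te' e'e t0 e0; lra.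
- apply: le_trans hm' _; rewrite ler_wpM2r //; clear -te' e'e t0 e0; lra.
Qed.

Local Close Scope ring_scope.

(** * Copies with a single bad edge *)

Lemma leq_sum_cover (I T : finType) (S : {set T}) (J : {set I}) (P : I -> pred T) k :
  (forall t, t \in S -> k <= #|[set i in J | P i t]|) ->
  k * #|S| <= \sum_(i in J) #|[set t in S | P i t]|.
Proof.
move=> H.
have -> : \sum_(i in J) #|[set t in S | P i t]| = \sum_(t in S) #|[set i in J | P i t]|.
  rewrite (eq_bigr (fun i => \sum_(t in S) (P i t : nat))); last first.
    by move=> i _; rewrite -sum1dep_card big_mkcondr.
  rewrite exchange_big /=; apply: eq_bigr => t _.
  by rewrite -sum1dep_card big_mkcondr.
by rewrite mulnC -sum_nat_const; apply: leq_sum.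
Qed.

Section UpperCount.
Variables (V : finType) (r : nat) (f : V -> 'I_r) (A : rel V).
Hypothesis gA : graph A.
Implicit Types (p : V * V) (t : {set V} * (V * V)).

Lemma pigeonhole (S : {set V}) : r < #|S| ->
  exists u v, [/\ u \in S, v \in S, u != v & f u = f v].
Proof.
move=> rS; have : ~~ rainbow f S.
  apply/negP => /rainbowP inj; move: rS; rewrite -(card_in_imset inj) ltnNge.
  by rewrite (leq_trans (max_card _)) ?card_ord.
rewrite negb_forall => /existsP[u]; rewrite negb_imply => /andP[uS].
rewrite negb_forall => /existsP[v]; rewrite !negb_imply => /andP[vS /andP[/eqP fuv uv]].
by exists u, v.
Qed.

Lemma mono_bad T x y u v : (T, (x, y)) \in ocopies r A ->
  u \in verts (T, (x, y)) -> v \in verts (T, (x, y)) -> u != v -> f u = f v ->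
  (u, v) != (x, y) -> (u, v) != (y, x) -> bad f A u v.
Proof.
move=> tc uQ vQ uv fuv h1 h2; apply/andP; split; last exact/eqP.
exact: (ocopy_adj gA tc).
Qed.

(** Without one end of the removed edge, a copy is a clique of [r + 1] vertices in [r] colours. *)
Lemma ocopy_bad_avoid T x y : (T, (x, y)) \in ocopies r A ->
  exists u v, [/\ u \in y |: T, v \in y |: T & bad f A u v].
Proof.
move=> tc; have [xT yT] := ocopy_notin gA tc.
have xy : x != y by case/ocopiesP: tc.
have cT : #|T| = r by case/ocopiesP: tc.
have [|u [v [uS vS uv fuv]]] := @pigeonhole (y |: T); first by rewrite cardsU1 yT cT.
have xS : x \notin y |: T by rewrite !inE negb_or xy.
exists u, v; split=> //; apply: (mono_bad tc) => //.
- by rewrite /verts /= inE uS orbT.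
- by rewrite /verts /= inE vS orbT.
- by apply: contraNneq xS => -[<- _].
- by apply: contraNneq xS => -[_ <-].
Qed.

Lemma ocopies_swap T x y : (T, (x, y)) \in ocopies r A -> (T, (y, x)) \in ocopies r A.
Proof. by case/ocopiesP=> *; apply/ocopiesP; split=> //; rewrite eq_sym. Qed.

Lemma verts_swap (T : {set V}) (x y : V) : verts (T, (y, x)) = verts (T, (x, y)).
Proof. by rewrite /verts /= setUCA. Qed.

Lemma ocopy_bad t : t \in ocopies r A ->
  exists u v, [/\ u \in verts t, v \in verts t & bad f A u v].
Proof.
case: t => T [x y] /ocopy_bad_avoid[u [v [uS vS b]]].
by exists u, v; split=> //; rewrite /verts /= inE ?uS ?vS orbT.
Qed.

(** In contrast with [unique_bad], all [r + 2] vertices are inspected; this is what lets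
    [sole_bad_fan] recover a transversal from the copy. *)
Definition sole_bad p t := [&& p.1 \in verts t, p.2 \in verts t, bad f A p.1 p.2 &
  [forall u in verts t, forall v in verts t, bad f A u v ==> (((u, v) == p) || ((v, u) == p))]].

Lemma sole_badP p t u v : sole_bad p t -> u \in verts t -> v \in verts t -> bad f A u v ->
  (u, v) = p \/ (v, u) = p.
Proof.
case/and4P=> _ _ _ /forall_inP H uQ vQ buv.
by move: (H u uQ) => /forall_inP/(_ v vQ)/implyP/(_ buv)/orP[]/eqP; [left|right].
Qed.

Lemma sole_bad_sym a b t : sole_bad (a, b) t -> sole_bad (b, a) t.
Proof.
case/and4P=> /= h1 h2 h3 h4; apply/and4P; split=> //=.
  by rewrite (proj1 (graph_bad gA f)).
apply/forall_inP => u uQ; apply/forall_inP => v vQ; apply/implyP => buv.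
move: h4 => /forall_inP/(_ u uQ)/forall_inP/(_ v vQ)/implyP/(_ buv).
by rewrite !xpair_eqE => /orP[]/andP[-> ->]; rewrite ?orbT.
Qed.

(* Deleting b from a copy whose only monochromatic edge is ab leaves a pair x, y of the same colour
   and a transversal. *)
Lemma sole_bad_fan a b T x y : (T, (x, y)) \in ocopies r A -> sole_bad (a, b) (T, (x, y)) ->
  [/\ a \in T, b \in T & exists g : {ffun 'I_r -> V},
    [/\ (T, (x, y)) = fan f b (g, y), forall l, f (g l) = l, g (f a) = a & f y != f a]].
Proof.
move=> tc sb; set Q := verts (T, (x, y)) in sb *.
have [xT yT] := ocopy_notin gA tc.
have [cT _ _ _ xy] := ocopiesP _ _ _ _ _ tc.
have QE u : (u \in Q) = [|| u == x, u == y | u \in T] by rewrite !inE.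
have [aQ bQ bab _] := and4P sb; rewrite /= in aQ bQ bab.
have sole u v : u \in Q -> v \in Q -> bad f A u v -> (u = a /\ v = b) \/ (u = b /\ v = a).
  by move=> uQ vQ h; case: (sole_badP sb uQ vQ h) => -[-> ->]; [left|right].
have avoid z : (exists u v, [/\ u \in z |: T, v \in z |: T & bad f A u v]) ->
    z \in Q -> (a \in z |: T) /\ (b \in z |: T).
  move=> [u [v [uS vS buv]]] zQ.
  have sub w : w \in z |: T -> w \in Q.
    by rewrite !inE => /orP[/eqP ->|->]; [move: zQ; rewrite QE | rewrite !orbT].
  by case: (sole _ _ (sub _ uS) (sub _ vS) buv) => -[<- <-].
have yQ : y \in Q by rewrite QE eqxx orbT.
have xQ : x \in Q by rewrite QE eqxx.
(* The cliques [y |: T] and [x |: T] both contain a bad edge, which can only be [ab], so [a] and [b]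
   lie in their intersection [T]. *)
have [ay by_] := avoid y (ocopy_bad_avoid tc) yQ.
have [ax bx] := avoid x (ocopy_bad_avoid (ocopies_swap tc)) xQ.
have aT : a \in T.
  by move: ay ax; rewrite !inE => /orP[/eqP ->|//]; rewrite eq_sym (negPf xy).
have bT : b \in T.
  by move: by_ bx; rewrite !inE => /orP[/eqP ->|//]; rewrite eq_sym (negPf xy).
have TQ u : u \in T -> u \in Q by rewrite QE => ->; rewrite !orbT.
have ab : a != b by apply: contraTneq bab => ->; rewrite /bad (proj2 gA).
(* The [r + 1] vertices other than [b] contain two of one colour; these form no bad edge, hence are
   the removed pair. *)
have fxy : f x = f y.
  have [|u [v [uS vS uv fuv]]] := @pigeonhole (Q :\ b).
    have := card_verts gA tc; rewrite -/Q (cardsD1 b) (TQ b bT) add1n => -[->]; exact: ltnSn.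
  move: uS vS; rewrite !inE -!QE => /andP[ub uQ] /andP[vb vQ].
  have [[e1 e2]|h1] := eqVneq (u, v) (x, y); first by rewrite -e1 -e2.
  have [[e1 e2]|h2] := eqVneq (u, v) (y, x); first by rewrite -e1 -e2.
  case: (sole _ _ uQ vQ (mono_bad tc uQ vQ uv fuv h1 h2)) => -[e1 e2].
    by rewrite e2 eqxx in vb.
  by rewrite e1 eqxx in ub.
(* Without [b] and [y] no bad edge and no removed pair is left, so these [r] vertices form a
   transversal. *)
pose S := x |: (T :\ b).
have SQ u : u \in S -> u \in Q.
  by rewrite !inE => /orP[/eqP ->|/andP[_ ->]]; rewrite ?eqxx ?orbT.
have yS : y \notin S by rewrite !inE negb_or eq_sym xy (negPf yT) andbF.
have bS : b \notin S.
  by rewrite !inE eqxx orbF; apply: contraNneq xT => <-.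
have Sinj : {in S &, injective f}.
  move=> u v uS vS fuv; apply/eqP; apply/negPn/negP => uv.
  have h1 : (u, v) != (x, y) by apply: contraNneq yS => -[_ <-].
  have h2 : (u, v) != (y, x) by apply: contraNneq yS => -[<- _].
  case: (sole _ _ (SQ _ uS) (SQ _ vS) (mono_bad tc (SQ _ uS) (SQ _ vS) uv fuv h1 h2)) => -[e1 e2].
    by rewrite -e2 vS in bS.
  by rewrite -e1 uS in bS.
have cS : #|S| = r.
  rewrite cardsU1 !inE (negPf xT) andbF add1n /=.
  by move: cT; rewrite (cardsD1 b) bT add1n.
have fS l : exists2 u, u \in S & f u == l.
  have : l \in f @: S.
    suff -> : f @: S = setT by rewrite inE.
    by apply/eqP; rewrite eqEcard subsetT cardsT card_ord (card_in_imset Sinj) cS leqnn.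
  by case/imsetP => u uS ->; exists u.
pose g := [ffun l => odflt a [pick u in S | f u == l]].
have gP l : g l \in S /\ f (g l) = l.
  rewrite ffunE; case: pickP => [u /andP[uS /eqP fu]|h] //=.
  by have [u uS fu] := fS l; move: (h u); rewrite /= uS fu.
have gu u : u \in S -> g (f u) = u.
  by move=> uS; have [h1 h2] := gP (f u); apply: Sinj.
have aS : a \in S by rewrite !inE ab aT orbT.
have xS : x \in S by rewrite !inE eqxx.
split=> //; exists g; split.
- rewrite /fan /= -fxy gu //; congr pair; apply/setP => u.
  rewrite !inE; have [->|ub] /= := eqVneq u b; first by rewrite bT.
  apply/idP/imsetP => [uT|[l + ->]].
    have uS : u \in S by rewrite !inE ub uT orbT.
    exists (f u); last by rewrite gu.
    rewrite !inE; apply/eqP => /(Sinj _ _ uS xS) e.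
    by rewrite e (negPf xT) in uT.
  rewrite !inE => lx; have [h1 h2] := gP l.
  move: h1; rewrite !inE => /orP[/eqP e|/andP[_ //]].
  by rewrite -h2 e eqxx in lx.
- by move=> l; have [] := gP l.
- exact: gu.
- apply/eqP => fya.
  have xa : x != a by apply: contraNneq xT => ->.
  have h1 : (x, a) != (x, y) by apply: contraNneq yT => -[<-].
  have h2 : (x, a) != (y, x) by apply: contraNneq xy => -[->].
  have fxa : f x = f a by rewrite fxy.
  case: (sole _ _ xQ aQ (mono_bad tc xQ aQ xa fxa h1 h2)) => -[e1 e2].
    by rewrite e1 eqxx in xa.
  by rewrite e1 bT in xT.
Qed.

Lemma sole_bad_or_two t : t \in ocopies r A ->
  (exists p, sole_bad p t) \/
  (exists x y y', [/\ [set x; y; y'] \subset verts t, y != y', bad f A x y & bad f A x y']) \/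
  (exists p p' : V * V, [/\ [set p.1; p.2; p'.1; p'.2] \subset verts t,
     [disjoint [set p.1; p.2] & [set p'.1; p'.2]], bad f A p.1 p.2 & bad f A p'.1 p'.2]).
Proof.
move=> tc; have [u [v [uQ vQ buv]]] := ocopy_bad tc.
have [symB irrB] := graph_bad gA f.
case: (boolP (sole_bad (u, v) t)) => [h|]; first by left; exists (u, v).
rewrite /sole_bad /= uQ vQ buv /= negb_forall => /existsP[x].
rewrite negb_imply => /andP[xQ]; rewrite negb_forall => /existsP[y].
rewrite !negb_imply => /andP[yQ /andP[bxy]].
rewrite negb_or !xpair_eqE => /andP[h1 h2]; right.
have sub3 a b c : a \in verts t -> b \in verts t -> c \in verts t -> [set a; b; c] \subset verts t.
  by move=> ha hb hc; rewrite !subUset !sub1set ha hb hc.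
have [e|xu] := eqVneq x u.
  left; exists u, v, y; split; rewrite ?sub3 //; last by rewrite -e.
  by move: h1; rewrite e eqxx /= eq_sym.
have [e|xv] := eqVneq x v.
  left; exists v, u, y; split; rewrite ?sub3 //; [|by rewrite symB|by rewrite -e].
  by move: h2; rewrite e eqxx andbT eq_sym.
have [e|yu] := eqVneq y u.
  left; exists u, v, x; split; rewrite ?sub3 //; [by rewrite eq_sym|].
  by rewrite symB -e.
have [e|yv] := eqVneq y v.
  left; exists v, u, x; split; rewrite ?sub3 //; [by rewrite eq_sym|by rewrite symB|].
  by rewrite symB -e.
right; exists (u, v), (x, y); split=> //=.
  by rewrite !subUset !sub1set uQ vQ xQ yQ.
rewrite -setI_eq0 -subset0; apply/subsetP => w; rewrite !inE.
by case/andP => /orP[]/eqP -> /orP[]/eqP e; rewrite e eqxx in xu xv yu yv.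
Qed.
End UpperCount.

(** * Exchange of edges *)

Section EdgeOperations.
Variable V : finType.
Implicit Types (A : rel V) (a b u v : V).

Definition same_edge a b : rel V :=
  fun x y => ((x == a) && (y == b)) || ((x == b) && (y == a)).
Definition del_edge A a b : rel V := fun x y => A x y && ~~ same_edge a b x y.
Definition add_edge A a b : rel V := fun x y => A x y || same_edge a b x y.

Lemma same_edge_sym a b x y : same_edge a b x y = same_edge a b y x.
Proof. by rewrite /same_edge orbC andbC [(x == a) && _]andbC. Qed.

Lemma graph_del A a b : graph A -> graph (del_edge A a b).
Proof.
case=> symA irrA; split=> [x y|x]; rewrite /del_edge ?irrA //.
by rewrite symA same_edge_sym.
Qed.

Lemma graph_add A a b : graph A -> a != b -> graph (add_edge A a b).
Proof.
case=> symA irrA ab; split=> [x y|x]; rewrite /add_edge.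
  by rewrite symA same_edge_sym.
rewrite irrA /same_edge /=; apply/negbTE/negP => /orP[]/andP[/eqP -> /eqP e];
  by rewrite e eqxx in ab.
Qed.

Lemma card_same_edge a b : a != b -> #|arcs (same_edge a b)| = 2.
Proof.
move=> ab; rewrite (_ : arcs _ = [set (a, b); (b, a)]); last first.
  by apply/setP => -[x y]; rewrite !inE /same_edge /= !xpair_eqE.
by rewrite cards2 xpair_eqE (negPf ab).
Qed.

Lemma card_arcs_del A a b : graph A -> A a b -> #|arcs A| = (#|arcs (del_edge A a b)| + 2)%N.
Proof.
move=> [symA irrA] Aab; have ab : a != b by apply: contraTneq Aab => ->; rewrite irrA.
rewrite -(card_same_edge ab) -(cardsID (arcs (same_edge a b)) (arcs A)) addnC; congr (_ + _).
  by apply: eq_card => p; rewrite !inE andbC.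
apply: eq_card => -[x y]; rewrite !inE /same_edge /= andbC.
by apply/andb_idr => /orP[]/andP[/eqP -> /eqP ->]; rewrite // symA.
Qed.

Lemma card_arcs_add A a b : graph A -> ~~ A a b -> a != b ->
  #|arcs (add_edge A a b)| = (#|arcs A| + 2)%N.
Proof.
move=> gA nA ab.
have gadd := graph_add gA ab.
have Aab : add_edge A a b a b by rewrite /add_edge /same_edge !eqxx orbT.
rewrite (card_arcs_del gadd Aab); congr (_ + _); apply: eq_card => -[x y].
rewrite !inE /del_edge /add_edge /=; case: (boolP (same_edge a b x y)) => [|_]; last by rewrite orbF andbT.
rewrite andbF; case/orP=> /andP[/eqP -> /eqP ->]; rewrite ?(negPf nA) //.
by rewrite (proj1 gA) (negPf nA).
Qed.

Lemma subgraph_arcs A k : graph A -> 2 * k <= #|arcs A| ->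
  exists A', [/\ graph A', subrel A' A & #|arcs A'| = 2 * k \/ #|arcs A'| = (2 * k).+1].
Proof.
move: {2}#|arcs A| (leqnn #|arcs A|) => m; elim: m A => [|m IH] A Am gA kA.
  by exists A; split=> //; left; move: (leq_trans kA Am); rewrite leqn0 => /eqP ->; move: Am; rewrite leqn0 => /eqP.
have [h|h] := leqP #|arcs A| (2 * k).+1.
  by exists A; split=> //; move: h; rewrite leq_eqVlt ltnS => /orP[/eqP ->|h]; [right|left; apply/eqP; rewrite eqn_leq h].
have : 0 < #|arcs A| by apply: leq_ltn_trans h.
case/card_gt0P => -[a b]; rewrite inE /= => Aab.
have E := card_arcs_del gA Aab.
have [| |A' [g' sub' c']] := IH (del_edge A a b) _ (graph_del a b gA) _; [lia|lia|].
by exists A'; split=> // x y /sub' /andP[].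
Qed.

Lemma even_arcs A : graph A -> exists k, #|arcs A| = 2 * k.
Proof.
move: {2}#|arcs A| (leqnn #|arcs A|) => m; elim: m A => [|m IH] A Am gA.
  by exists 0; apply/eqP; rewrite muln0 -leqn0.
have [->|] := posnP #|arcs A|; first by exists 0.
case/card_gt0P => -[a b]; rewrite inE /= => Aab.
have E := card_arcs_del gA Aab.
have [|k Ek] := IH (del_edge A a b) _ (graph_del a b gA); first by lia.
by exists k.+1; rewrite E Ek mulnS addnC.
Qed.

Lemma exact_subgraph A k : graph A -> 2 * k <= #|arcs A| ->
  exists A', [/\ graph A', subrel A' A & #|arcs A'| = 2 * k].
Proof.
move=> gA /(subgraph_arcs gA)[A' [gA' sub [e|e]]]; exists A'; split=> //.
by have [j ej] := even_arcs gA'; lia.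
Qed.

(** Competitors may have more arcs than [A], which suits exchanges that gain edges. By [optimal_eq]
    minimality among graphs of equal size implies this. *)
Definition optimal r A := forall A', graph A' -> #|arcs A| <= #|arcs A'| ->
  #|ocopies r A| <= #|ocopies r A'|.

Lemma optimal_eq r A : graph A ->
  (forall A', graph A' -> #|arcs A'| = #|arcs A| -> #|ocopies r A| <= #|ocopies r A'|) ->
  optimal r A.
Proof.
move=> gA H A' gA' le; have [k ek] := even_arcs gA.
have [|A2 [g2 s2 c2]] := @exact_subgraph A' k gA'; first by rewrite -ek.
by apply: leq_trans (H A2 g2 _) (subset_leq_card (ocopies_sub r s2)); rewrite c2.
Qed.
End EdgeOperations.

Section Exchange.
Variables (V : finType) (r : nat) (f : V -> 'I_r).
Implicit Types (A : rel V) (a b u v : V).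
Local Notation n := #|V|.

(** A copy through [u] and [v], which have different colours, also contains a bad edge. If it avoids
    both, four vertices are fixed; otherwise three, but then the edge is one of the few bad edges at
    [u] or [v]. *)
Lemma card_ocopies_cross A u v : graph A -> f u != f v ->
  n ^ 4 * #|[set t in ocopies r A | (u \in verts t) && (v \in verts t)]|
  <= (#|arcs (bad f A)| + n * (#|nbr (bad f A) u| + #|nbr (bad f A) v|)) * (r.+2 ^ 2 * n ^ r.+2).
Proof.
move=> gA fuv; have [symB irrB] := graph_bad gA f.
have uv : u != v by apply: contraNneq fuv => ->.
set S := [set t in _ | _].
pose Ja := [set p in arcs (bad f A) | (p.1 \notin [set u; v]) && (p.2 \notin [set u; v])].
pose Jb := [set p in arcs (bad f A) | p.1 \in [set u; v]].
pose Sa := [set t in S | [exists p in Ja, (p.1 \in verts t) && (p.2 \in verts t)]].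
pose Sb := [set t in S | [exists p in Jb, (p.1 \in verts t) && (p.2 \in verts t)]].
have cov : S \subset Sa :|: Sb.
  apply/subsetP => t tS; rewrite in_setU; have /setIdP[tc _] := tS.
  have [x [y [xQ yQ bxy]]] := ocopy_bad f gA tc.
  have [xuv|xuv] := boolP (x \in [set u; v]).
    apply/orP; right; apply/setIdP; split=> //; apply/existsP; exists (x, y).
    by rewrite /= xQ yQ andbT inE inE bxy xuv.
  have [yuv|yuv] := boolP (y \in [set u; v]).
    apply/orP; right; apply/setIdP; split=> //; apply/existsP; exists (y, x).
    by rewrite /= xQ yQ andbT inE inE symB bxy yuv.
  apply/orP; left; apply/setIdP; split=> //; apply/existsP; exists (x, y).
  by rewrite /= xQ yQ andbT inE inE bxy xuv yuv.
have ha : n ^ 4 * #|Sa| <= #|arcs (bad f A)| * (r.+2 ^ 2 * n ^ r.+2).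
  apply: leq_trans (_ : #|Ja| * (r.+2 ^ 2 * n ^ r.+2) <= _); last first.
    by rewrite leq_mul2r subset_leq_card ?orbT //; apply/subsetP => p /setIdP[].
  apply: (card_cover_le (P := fun p t => (p.1 \in verts t) && (p.2 \in verts t))).
    by move=> t /setIdP[_ /existsP[p /andP[pJ h]]]; exists p.
  move=> [x y] /setIdP[]; rewrite inE !inE !negb_or /= => bxy /andP[/andP[xu xv] /andP[yu yv]].
  have xy : x != y by apply: contraTneq bxy => ->; rewrite irrB.
  have c4 : #|[set x; y; u; v]| = 4.
    rewrite -!setUA !cardsU1 cards1 !inE !negb_or xy xu xv yu yv uv; by [].
  have := card_ocopies_through r [set x; y; u; v] gA; rewrite c4; apply: leq_trans.
  rewrite leq_mul2l subset_leq_card ?orbT //; apply/subsetP => t.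
  move=> /setIdP[/setIdP[/setIdP[tc /andP[uQ vQ]] _] /andP[xQ yQ]].
  by apply/setIdP; split=> //; rewrite !subUset !sub1set xQ yQ uQ vQ.
have hb : n ^ 3 * #|Sb| <= (#|nbr (bad f A) u| + #|nbr (bad f A) v|) * (r.+2 ^ 2 * n ^ r.+2).
  have cJ : #|Jb| <= #|nbr (bad f A) u| + #|nbr (bad f A) v|.
    have -> : Jb = [set p | (p.1 \in [set u; v]) && (p.2 \in nbr (bad f A) p.1)].
      by apply/setP => p; rewrite !inE andbC.
    by rewrite (card_pairs_in _ (nbr (bad f A))) big_setU1 ?inE // big_set1.
  apply: leq_trans (_ : #|Jb| * (r.+2 ^ 2 * n ^ r.+2) <= _); last by rewrite leq_mul2r cJ orbT.
  apply: (card_cover_le (P := fun p t => (p.1 \in verts t) && (p.2 \in verts t))).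
    by move=> t /setIdP[_ /existsP[p /andP[pJ h]]]; exists p.
  move=> [x y] /setIdP[]; rewrite inE !inE /= => bxy xuv.
  have xy : x != y by apply: contraTneq bxy => ->; rewrite irrB.
  have yuv : (y != u) && (y != v).
    have /andP[_ /eqP fxy] := bxy.
    case/orP: xuv => /eqP e; subst x.
      by rewrite eq_sym xy /=; apply: contraNneq fuv => <-; rewrite fxy.
    by rewrite [y == v]eq_sym xy andbT; apply: contraNneq fuv => <-; rewrite fxy.
  have c3 : #|[set y; u; v]| = 3.
    rewrite -!setUA !cardsU1 cards1 !inE !negb_or uv; by case/andP: yuv => -> ->.
  have := card_ocopies_through r [set y; u; v] gA; rewrite c3; apply: leq_trans.
  rewrite leq_mul2l subset_leq_card ?orbT //; apply/subsetP => t.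
  move=> /setIdP[/setIdP[/setIdP[tc /andP[uQ vQ]] _] /andP[xQ yQ]].
  by apply/setIdP; split=> //; rewrite !subUset !sub1set yQ uQ vQ.
apply: leq_trans (_ : n ^ 4 * (#|Sa| + #|Sb|) <= _).
  by rewrite leq_mul2l (leq_trans (subset_leq_card cov)) ?orbT // leq_card_setU.
rewrite mulnDr mulnDl leq_add //.
by rewrite (expnS n 3) -mulnA (leq_trans (leq_mul (leqnn n) hb)) // mulnA.
Qed.

(* Compares A with the graph in which the bad edge ab is replaced by the missing edge uv. *)
Lemma exchange_missing A a b u v : graph A -> optimal r A -> bad f A a b -> mis f A u v ->
  #|[set t in ocopies r A | (a \in t.1) && (b \in t.1)]| * n ^ 4
  <= (#|arcs (bad f A)| + n * (#|nbr (bad f A) u| + #|nbr (bad f A) v|)) * (r.+2 ^ 2 * n ^ r.+2).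
Proof.
move=> gA opt /andP[Aab fab] /andP[nAuv fuv].
have ab : a != b by apply: contraTneq Aab => ->; rewrite (proj2 gA).
have uv : u != v by apply: contraNneq fuv => ->.
pose A1 := del_edge A a b; pose A2 := add_edge A1 u v.
have g1 : graph A1 by apply: graph_del.
have nA1 : ~~ A1 u v by rewrite /A1 /del_edge (negPf nAuv).
have g2 : graph A2 by apply: graph_add.
have c2 : #|arcs A2| = #|arcs A|.
  by rewrite (card_arcs_add g1 nA1 uv) -(card_arcs_del gA Aab).
have A2ab : A2 a b = false.
  rewrite /A2 /add_edge /A1 /del_edge /same_edge !eqxx andbF /=.
  apply/negbTE/negP => /orP[]/andP[/eqP e1 /eqP e2]; rewrite -e1 -e2 in fuv.
    by rewrite fab in fuv.
  by rewrite eq_sym fab in fuv.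
set Sab := [set t in ocopies r A | _]; set Suv := [set t in ocopies r A2 | (u \in verts t) && (v \in verts t)].
(* A copy in [A2] that misses [u] or [v] is a copy in [A], and its clique cannot contain both [a]
   and [b], which are no longer adjacent. *)
have : #|ocopies r A2| <= #|ocopies r A :\: Sab| + #|Suv|.
  apply: leq_trans (leq_card_setU _ _); apply/subset_leq_card/subsetP => t tc.
  rewrite in_setU in_setD; have [h|h] := boolP (t \in Suv); first by rewrite orbT.
  rewrite orbF; have nuv : ~~ ((u \in verts t) && (v \in verts t)).
    by apply: contra h => h; apply/setIdP.
  case: t tc {h} nuv => T [x y] tc nuv.
  have [cT cl hx hy xy] := ocopiesP _ _ _ _ _ tc.
  have inA w z : w \in verts (T, (x, y)) -> z \in verts (T, (x, y)) -> A2 w z -> A w z.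
    move=> wQ zQ /orP[/andP[]//|/orP[]/andP[/eqP e1 /eqP e2]]; subst w z.
      by rewrite wQ zQ in nuv.
    by rewrite wQ zQ in nuv.
  have TQ w : w \in T -> w \in verts (T, (x, y)) by move=> h; rewrite !inE h !orbT.
  have xQ : x \in verts (T, (x, y)) by rewrite !inE eqxx.
  have yQ : y \in verts (T, (x, y)) by rewrite !inE eqxx orbT.
  apply/andP; split.
    apply/negP => /setIdP[_ /= /andP[aT bT]].
    by move: (cl a b aT bT ab); rewrite A2ab.
  by apply/ocopiesP; split=> // [w z wT zT wz|w wT|w wT]; apply: inA; auto.
have := opt A2 g2; rewrite c2 leqnn => /(_ isT) h1 h2.
have {h2} : #|Sab| <= #|Suv|.
  have := leq_trans h1 h2; rewrite -(cardsID Sab (ocopies r A)) addnC leq_add2l.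
  by rewrite (setIidPr _) //; apply/subsetP => t /setIdP[].
rewrite mulnC => h3; apply: leq_trans (leq_mul (leqnn (n ^ 4)) h3) _.
apply: leq_trans (card_ocopies_cross g2 fuv) _.
have subB : subrel (bad f A2) (bad f A).
  move=> x y /andP[/orP[/andP[h _]|/orP[]/andP[/eqP-> /eqP->]] fxy].
  - by rewrite /bad h.
  - by rewrite fxy in fuv.
  - by rewrite eq_sym fxy in fuv.
rewrite leq_mul2r; apply/orP; right; apply: leq_add.
  by apply/subset_leq_card/subsetP => p; rewrite !inE; apply: subB.
by rewrite leq_mul2l leq_add ?orbT //; apply/subset_leq_card/subsetP => p; rewrite !inE; apply: subB.
Qed.
End Exchange.

Section SoleBad.
Variables (V : finType) (r : nat) (f : V -> 'I_r) (A : rel V).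
Hypothesis gA : graph A.
Local Notation n := #|V|.

Definition slots (a : V) (l : 'I_r) : {set V} := if l == f a then [set a] else part f l.

(** In the fan description [v] is either the further vertex [y], with [m ^ r.-1] transversals
    through [a], or a vertex of the transversal outside the class of [a], with [m ^ (r - 2)]
    transversals and at most [r.-1 * m] choices of [y]. *)
Lemma card_sole_bad_through a b v m : a != v -> b != v -> (forall l, #|part f l| <= m) -> 2 <= r ->
  #|[set t in ocopies r A | (v \in verts t) && sole_bad f A (a, b) t]| <= r * m ^ r.-1.
Proof.
move=> av bv hm r2; set S := [set t in _ | _].
pose G1 := [set gy : {ffun 'I_r -> V} * V | (gy.1 \in family (slots a)) && (gy.2 \in [set v])].
pose D2 l := if l == f v then [set v] else slots a l.
pose G2 := [set gy : {ffun 'I_r -> V} * V | (gy.1 \in family D2) && (gy.2 \in ~: part f (f a))].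
pose G := G1 :|: (if f v == f a then set0 else G2).
have S1 l : #|slots a l| <= m \/ l = f a.
  by rewrite /slots; case: eqP => [->|_]; [right | left].
have c1 : #|G1| <= m ^ r.-1.
  have -> : #|G1| = #|family (slots a)|.
    rewrite (card_pairs (mem (family (slots a))) (fun _ => mem [set v])).
    rewrite (eq_bigr (fun=> 1)) ?sum1_card // => g _; rewrite -[RHS](cards1 v).
    by apply: eq_card => y; rewrite inE.
  rewrite -[r.-1](_ : #|~: [set f a]| = _); last by rewrite cardsC1 card_ord.
  apply: card_family_bound => l; rewrite inE.
    by move/eqP ->; rewrite /slots eqxx cards1.
  by move=> /negPf h; rewrite /slots h.
have c2 : f v != f a -> #|G2| <= r.-1 * m ^ r.-1.
  move=> va; have -> : #|G2| = #|family D2| * #|~: part f (f a)|.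
    rewrite (card_pairs (mem (family D2)) (fun _ => mem (~: part f (f a)))) -sum_nat_const.
    by apply: eq_bigr => g _; apply: eq_card => y; rewrite inE.
  have e2 : #|~: [set f a; f v]| = r - 2.
    by have := cardsC [set f a; f v]; rewrite cards2 eq_sym va card_ord; clear -r2; lia.
  have h1 : #|family D2| <= m ^ (r - 2).
    rewrite -e2; apply: card_family_bound => l; rewrite !inE.
      case/orP=> /eqP ->; rewrite /D2 /slots ?eqxx ?cards1 //.
      by rewrite eq_sym (negPf va) cards1.
    by rewrite negb_or /D2 /slots => /andP[/negPf -> /negPf ->].
  have h2 : #|~: part f (f a)| <= r.-1 * m.
    have <- : #|[set~ f a]| = r.-1 by rewrite cardsC1 card_ord.
    rewrite -sum_nat_const.
    apply: leq_trans (_ : \sum_(l in [set~ f a]) #|part f l| <= _); last by apply: leq_sum => l _.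
    have -> : #|~: part f (f a)| = \sum_(l in [set~ f a]) #|part f l|.
      rewrite -sum1_card (partition_big f (mem [set~ f a])) /=; last first.
        by move=> w; rewrite !inE.
      apply: eq_bigr => l; rewrite !inE => la; rewrite sum1dep_card; apply: eq_card => w.
      by rewrite !inE; apply/andb_idl => /eqP ->.
    by [].
  apply: leq_trans (leq_mul h1 h2) _; rewrite mulnCA leq_mul2l -expnSr.
  by rewrite (_ : (r - 2).+1 = r.-1) ?leqnn ?orbT //; clear -r2; lia.
have cG : #|G| <= r * m ^ r.-1.
  apply: leq_trans (leq_card_setU _ _) _.
  have -> : r * m ^ r.-1 = m ^ r.-1 + r.-1 * m ^ r.-1 by rewrite -mulSn prednK // ltnW.
  apply: leq_add => //.
  by case: eqP => [_|/eqP /c2 //]; rewrite cards0.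
apply: leq_trans cG; apply: leq_trans (leq_imset_card (fan f b) G).
apply/subset_leq_card/subsetP => -[T [x y]] /setIdP[tc /andP[vQ sb]].
have [aT bT [g [tE fg ga fya]]] := sole_bad_fan gA tc sb.
apply/imsetP; exists (g, y) => //.
have gD l : g l \in slots a l.
  by rewrite /slots; case: eqP => [->|_]; rewrite inE ?ga // fg.
have [yv|yv] := eqVneq y v.
  by rewrite in_setU in_set /= yv in_set1 eqxx andbT; apply/orP; left; apply/familyP.
have gv : g (f v) = v.
  move: vQ; rewrite tE /verts /fan /= !inE => /or4P[/eqP ->|/eqP e|/eqP e|/imsetP[l _ ->]].
  - by rewrite fg.
  - by rewrite e eqxx in yv.
  - by rewrite e eqxx in bv.
  - by rewrite fg.
have fva : f v != f a.
  by apply: contraNneq av => e; rewrite -gv e ga.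
rewrite in_setU (negPf fva); apply/orP; right; rewrite in_set /= in_setC in_set fya andbT.
apply/familyP => l; rewrite /D2; case: eqP => [->|_]; last exact: gD.
by rewrite gv inE.
Qed.

(** Lying in no bad edge, [v] is a further fixed vertex: copies with two adjacent bad edges fix four
    vertices, those with two disjoint ones fix five. The factor [n ^ 5] clears both denominators,
    and the factor 2 reflects that a bad edge is two arcs. *)
Lemma card_ocopies_vertex v m d : (forall u, ~~ bad f A u v) -> (forall l, #|part f l| <= m) ->
  2 <= r -> (forall u, #|nbr (bad f A) u| <= d) ->
  2 * n ^ 5 * #|[set t in ocopies r A | v \in verts t]| <=
  n ^ 5 * (#|arcs (bad f A)| * (r * m ^ r.-1))
  + 2 * (#|arcs (bad f A)| * (n * d + #|arcs (bad f A)|)) * (r.+2 ^ 2 * n ^ r.+2).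
Proof.
move=> nb hm r2 hd; have [symB irrB] := graph_bad gA f.
set S := [set t in _ | _]; set B := bad f A in nb hd symB irrB *.
have nv u w : B u w -> (u != v) && (w != v).
  move=> h; apply/andP; split; apply: contraTneq h => ->; last exact: nb.
  by rewrite symB; apply: nb.
pose S1 := [set t in S | [exists p in arcs B, sole_bad f A p t]].
pose J2 := [set q : (V * V) * V | (q.1 \in arcs B) && (q.2 \in nbr B q.1.1 :\ q.1.2)].
pose P2 (q : (V * V) * V) (t : {set V} * (V * V)) := [set q.1.1; q.1.2; q.2] \subset verts t.
pose S2 := [set t in S | [exists q in J2, P2 q t]].
pose J3 := [set q : (V * V) * (V * V) | (q.1 \in arcs B) &&
  (q.2 \in [set p in arcs B | [disjoint [set q.1.1; q.1.2] & [set p.1; p.2]]])].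
pose P3 (q : (V * V) * (V * V)) (t : {set V} * (V * V)) :=
  [set q.1.1; q.1.2; q.2.1; q.2.2] \subset verts t.
pose S3 := [set t in S | [exists q in J3, P3 q t]].
have cov : S \subset S1 :|: S2 :|: S3.
  apply/subsetP => t tS; have /setIdP[tc _] := tS; rewrite !in_setU.
  case: (sole_bad_or_two f gA tc) => [[p sb]|[[x [y [y' [h1 h2 h3 h4]]]]|[p [p' [h1 h2 h3 h4]]]]].
  - apply/orP; left; apply/orP; left; apply/setIdP; split=> //; apply/existsP; exists p.
    by rewrite sb andbT inE; case/and4P: sb.
  - apply/orP; left; apply/orP; right; apply/setIdP; split=> //; apply/existsP; exists ((x, y), y').
    by rewrite -/B in h3 h4; rewrite /P2 /= h1 andbT !inE /= [y' == y]eq_sym h2 h3 h4.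
  - apply/orP; right; apply/setIdP; split=> //; apply/existsP; exists (p, p').
    by rewrite -/B in h3 h4; rewrite /P3 /= h1 andbT !inE /= h2 h3 h4.
have b1 : 2 * #|S1| <= #|arcs B| * (r * m ^ r.-1).
  apply: leq_trans (_ : \sum_(p in arcs B) #|[set t in S1 | sole_bad f A p t]| <= _).
    apply: leq_sum_cover => t /setIdP[tS /existsP[[a b] /andP[pB sb]]].
    have ab : a != b by apply: contraTneq pB => ->; rewrite inE /= irrB.
    rewrite (_ : 2 = #|[set (a, b); (b, a)]|); last by rewrite cards2 xpair_eqE (negPf ab).
    apply/subset_leq_card/subsetP => p; rewrite !inE => /orP[]/eqP ->.
      by rewrite sb andbT; rewrite inE in pB.
    by rewrite (sole_bad_sym gA sb) andbT /= symB; rewrite inE in pB.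
  rewrite -sum_nat_const; apply: leq_sum => -[a b]; rewrite inE /= => /nv /andP[av bv].
  apply: leq_trans (card_sole_bad_through av bv hm r2).
  apply/subset_leq_card/subsetP => t /setIdP[/setIdP[/setIdP[tc vQ] _] sb].
  by apply/setIdP; split=> //; rewrite vQ.
have b2 : n ^ 4 * #|S2| <= #|arcs B| * d * (r.+2 ^ 2 * n ^ r.+2).
  have cJ : #|J2| <= #|arcs B| * d.
    rewrite (card_pairs_in (arcs B) (fun p => nbr B p.1 :\ p.2)) -sum_nat_const.
    by apply: leq_sum => p _; apply: leq_trans (hd p.1); rewrite subset_leq_card ?subsetDl.
  apply: leq_trans (_ : #|J2| * (r.+2 ^ 2 * n ^ r.+2) <= _); last by rewrite leq_mul2r cJ orbT.
  apply: (card_cover_le (P := P2)).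
    by move=> t /setIdP[_ /existsP[q /andP[qJ h]]]; exists q.
  move=> [[x y] y']; rewrite !inE /= => /andP[bxy /andP[y'y bxy']].
  have /andP[xv yv] := nv _ _ bxy; have /andP[_ y'v] := nv _ _ bxy'.
  have xy : x != y by apply: contraTneq bxy => ->; rewrite irrB.
  have xy' : x != y' by apply: contraTneq bxy' => ->; rewrite irrB.
  have c4 : #|[set x; y; y'; v]| = 4.
    by rewrite -!setUA !cardsU1 cards1 !inE !negb_or xy xy' xv yv y'v [y == y']eq_sym y'y.
  have := card_ocopies_through r [set x; y; y'; v] gA; rewrite c4; apply: leq_trans.
  rewrite leq_mul2l subset_leq_card ?orbT //; apply/subsetP => t.
  move=> /setIdP[/setIdP[/setIdP[tc vQ] _] h].
  by apply/setIdP; split=> //; rewrite subUset sub1set vQ andbT.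
have b3 : n ^ 5 * #|S3| <= #|arcs B| * #|arcs B| * (r.+2 ^ 2 * n ^ r.+2).
  have cJ : #|J3| <= #|arcs B| * #|arcs B|.
    rewrite (card_pairs_in (arcs B) (fun q => [set p in arcs B | [disjoint [set q.1; q.2] & [set p.1; p.2]]])).
    rewrite -sum_nat_const; apply: leq_sum => p _; apply/subset_leq_card/subsetP => q.
    by case/setIdP.
  apply: leq_trans (_ : #|J3| * (r.+2 ^ 2 * n ^ r.+2) <= _); last by rewrite leq_mul2r cJ orbT.
  apply: (card_cover_le (P := P3)).
    by move=> t /setIdP[_ /existsP[q /andP[qJ h]]]; exists q.
  move=> [[x y] [x' y']]; rewrite !inE /= => /andP[bxy /andP[bxy' dis]].
  have /andP[xv yv] := nv _ _ bxy; have /andP[x'v y'v] := nv _ _ bxy'.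
  have xy : x != y by apply: contraTneq bxy => ->; rewrite irrB.
  have xy' : x' != y' by apply: contraTneq bxy' => ->; rewrite irrB.
  have dx w : w \in [set x; y] -> (w != x') && (w != y').
    by move=> h; move: (disjointFr dis h); rewrite !inE => /negbT; rewrite negb_or.
  have /andP[xx' xy2] := dx x (set21 _ _); have /andP[yx' yy'] := dx y (set22 _ _).
  have c5 : #|[set x; y; x'; y'; v]| = 5.
    by rewrite -!setUA !cardsU1 cards1 !inE !negb_or xy xx' xy2 xv yx' yy' yv xy' x'v y'v.
  have := card_ocopies_through r [set x; y; x'; y'; v] gA; rewrite c5; apply: leq_trans.
  rewrite leq_mul2l subset_leq_card ?orbT //; apply/subsetP => t.
  move=> /setIdP[/setIdP[/setIdP[tc vQ] _] h].
  by apply/setIdP; split=> //; rewrite subUset sub1set vQ andbT.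
have c : #|S| <= #|S1| + #|S2| + #|S3|.
  apply: leq_trans (subset_leq_card cov) _; apply: leq_trans (leq_card_setU _ _) _.
  by rewrite leq_add2r leq_card_setU.
set bd := #|arcs B| in b1 b2 b3 *; set X := r.+2 ^ 2 * _ in b2 b3 *.
have := leq_mul (leqnn (2 * n ^ 5)) c; move/leq_trans; apply.
have b1' := leq_mul (leqnn (n ^ 5)) b1.
have b2' : n ^ 5 * #|S2| <= n * (bd * d * X).
  by rewrite (expnS n 4) -mulnA leq_mul2l b2 orbT.
clear -b1' b2' b3; move: (n ^ 5) (r * m ^ r.-1) b1' b2' b3 => N M b1 b2 b3; nia.
Qed.
End SoleBad.

(** * Forest added to one class *)

Section LinearForest.
Variables (V : finType) (P : {set V}) (q : nat).
Hypothesis qP : q < #|P|.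

(** [H] is the number of matching edges in [forest], and [J] the number of edges that link
    consecutive ones. *)
Let H := minn q #|P|./2.
Let J := q - H.
Let idx (x : V) := index x (enum P).

Definition forest_step i j := (j == i.+1) && (i./2 < (if odd i then J else H)).

(* q edges of a path on P: the edges at even positions form a matching and are used first. *)
Definition forest : rel V := fun x y =>
  [&& x \in P, y \in P & forest_step (idx x) (idx y) || forest_step (idx y) (idx x)].

Lemma graph_forest : graph forest.
Proof.
split=> [x y|x]; rewrite /forest; first by rewrite orbC andbCA.
by rewrite /forest_step ltn_eqF ?ltnSn //= !andbF.
Qed.

Lemma forest_diff x y : forest x y -> idx y = (idx x).+1 \/ idx x = (idx y).+1.
Proof. by case/and3P=> _ _ /orP[]/andP[/eqP h _]; [left|right]. Qed.

Lemma forest_triangle_free x y z : forest x y -> forest y z -> forest x z -> False.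
Proof.
by move=> /forest_diff h1 /forest_diff h2 /forest_diff h3; clear -h1 h2 h3; lia.
Qed.

Lemma idx_inj : {in P &, injective idx}.
Proof. by move=> x y xP yP; apply: (index_inj x); rewrite mem_enum. Qed.

(** An inequality is enough: [exact_subgraph] trims a surplus, and the other properties survive the
    removal of edges. *)
Lemma card_forest : 2 * q <= #|arcs forest|.
Proof.
have [->|q0] := posnP q; first by rewrite muln0.
have [x0 x0P] : exists x, x \in P by apply/card_gt0P; apply: leq_ltn_trans qP.
pose e (k : 'I_q) := if k < H then k.*2 else (k - H).*2.+1.
have bnd (k : 'I_q) : (e k).+1 < #|P| /\ (e k)./2 < (if odd (e k) then J else H).
  have kq := ltn_ord k; rewrite /e; case: ifP => kH.
    rewrite odd_double doubleK; split=> //; move: kH; rewrite /H; clear -qP; lia.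
  rewrite oddS odd_double /= uphalf_double.
  move: kH; rewrite /J /H; clear -qP kq; lia.
pose F (p : 'I_q * bool) := let x := nth x0 (enum P) (e p.1) in
  let y := nth x0 (enum P) (e p.1).+1 in if p.2 then (x, y) else (y, x).
have idxn i : i < #|P| -> idx (nth x0 (enum P) i) = i.
  by move=> h; rewrite /idx index_uniq ?enum_uniq // -cardE.
have nthP i : i < #|P| -> nth x0 (enum P) i \in P.
  by move=> h; rewrite -mem_enum mem_nth // -cardE.
have -> : 2 * q = #|{: 'I_q * bool}| by rewrite card_prod card_ord card_bool mulnC.
have Finj : injective F.
  move=> [k b] [k' b'] eF.
  have [h1 _] := bnd k; have [h2 _] := bnd k'.
  have := congr1 (fun p : V * V => (idx p.1, idx p.2)) eF.
  rewrite /F /=; case: b b' {eF} => -[] /=; rewrite !idxn ?(ltnW h1) ?(ltnW h2) // => -[e1 e2];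
    try (by clear -e1 e2; lia); congr pair; apply: val_inj => /=;
    (have e3 : e k = e k' by clear -e1 e2; lia); clear -e3; move: e3; rewrite /e; do 2!case: ifP; lia.
rewrite -(card_imset _ Finj); apply/subset_leq_card/subsetP => _ /imsetP[[k b] _ ->].
have [h1 h2] := bnd k; have h1' := ltnW h1.
rewrite inE /forest /F; case: b => /=; rewrite !idxn // !nthP //= /forest_step eqxx h2 ?orbT //.
Qed.

(** Each of the [J] linking edges creates at most two cherries, that is four ordered ones. A cherry
    is encoded by its linking edge, the end of it that is the centre, and the order of the two
    leaves. *)
Lemma forest_cherries :
  \sum_x #|nbr forest x| * #|nbr forest x|.-1 <= 2 * ((2 * q).+1 - #|P|).
Proof.
apply: leq_trans (_ : 4 * J <= _); last by rewrite /J /H; clear -qP; lia.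
rewrite (eq_bigr (fun x => #|[set p : V * V | [&& p.1 \in nbr forest x, p.2 \in nbr forest x
   & p.1 != p.2]]|)); last by move=> x _; rewrite card_offdiag.
rewrite -(card_pairs xpredT (fun x (p : V * V) => [&& p.1 \in nbr forest x, p.2 \in nbr forest x
   & p.1 != p.2])).
set S := [set _ | _].
have SP x y z : (x, (y, z)) \in S -> [/\ x \in P, y \in P, z \in P &
   (idx y = (idx x).+1 /\ idx x = (idx z).+1) \/ (idx z = (idx x).+1 /\ idx x = (idx y).+1)] /\
   (idx x).-1./2 < J.
  rewrite !inE /= => /and3P[xy xz yz].
  have [/and3P[xP yP hy] /and3P[_ zP hz]] := (xy, xz).
  have ne : idx y <> idx z by move/(idx_inj yP zP) => e; rewrite e eqxx in yz.
  suff: ((idx y = (idx x).+1 /\ idx x = (idx z).+1) \/ (idx z = (idx x).+1 /\ idx x = (idx y).+1))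
      /\ (idx x).-1./2 < J by case.
  move: ne hy hz; rewrite /forest_step.
  move: (idx x) (idx y) (idx z) J H => a b c J' H' ne; clear -ne.
  by case/orP=> /andP[/eqP e1 h1] /orP[]/andP[/eqP e2 h2]; subst; move: ne h1 h2;
    do ![case: ifP]; lia.
pose G (s : V * (V * V)) : nat * (bool * bool) :=
  ((idx s.1).-1./2, (odd (idx s.1), idx s.2.1 == (idx s.1).+1)).
have J0 : S != set0 -> 0 < J.
  by case/set0Pn => -[x [y z]] /SP[_]; case: J.
have [->|/J0 {}J0] := eqVneq S set0; first by rewrite cards0.
pose G' (s : V * (V * V)) : 'I_J.-1.+1 * (bool * bool) := (inord (G s).1, (G s).2).
have -> : 4 * J = #|{: 'I_J.-1.+1 * (bool * bool)}|.
  by rewrite !card_prod !card_bool card_ord mulnC prednK.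
rewrite -(card_in_imset (_ : {in S &, injective G'})) ?max_card //.
move=> [x [y z]] [x' [y' z']] /SP[[xP yP zP h] hJ] /SP[[xP' yP' zP' h'] hJ'] [].
move/(congr1 val); rewrite /= !inordK ?prednK // => e1 e2 e3.
have ex : idx x = idx x'.
  by clear -e1 e2 h h'; lia.
have ey : idx y = idx y' by rewrite ex in e3; clear -e3 ex h h'; move: e3; do 2!case: eqP; lia.
have ez : idx z = idx z' by clear -ex ey h h'; lia.
by rewrite (idx_inj xP xP' ex) (idx_inj yP yP' ey) (idx_inj zP zP' ez).
Qed.
End LinearForest.

Section Construction.
Variables (V : finType) (r : nat) (f : V -> 'I_r) (B : rel V) (k : 'I_r).
Hypothesis gB : graph B.
Hypothesis Bk : forall x y, B x y -> f x = k.
Hypothesis triB : forall x y z, B x y -> B y z -> B x z -> False.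

Definition augment : rel V := fun x y => (f x != f y) || B x y.

Lemma Bk2 x y : B x y -> f y = k.
Proof. by rewrite (proj1 gB); apply: Bk. Qed.

Lemma graph_augment : graph augment.
Proof.
case: gB => symB irrB; split=> [x y|x]; rewrite /augment.
  by rewrite symB eq_sym.
by rewrite eqxx irrB.
Qed.

Lemma bad_augment x y : bad f augment x y = B x y.
Proof.
rewrite /bad /augment andb_orl andNb /=.
by apply/andb_idr => h; rewrite (Bk h) (Bk2 h).
Qed.

Lemma arcs_augment : #|arcs augment| = #|arcs (Kpart f)| + #|arcs B|.
Proof.
have := arcs_balance f augment.
have -> : #|arcs (mis f augment)| = 0.
  apply: eq_card0 => p; rewrite !inE /mis /augment negb_or negbK.
  by case: (_ == _); rewrite ?andbF.
rewrite addn0 => ->; rewrite addnC; congr (_ + _); apply: eq_card => p.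
by rewrite !inE bad_augment.
Qed.

Definition others := \prod_(l in [set~ k]) #|part f l|.

Lemma card_slots a : f a = k -> #|family (slots f a)| = others.
Proof.
move=> fa; rewrite card_family_prod (bigD1 (f a)) //= {1}/slots eqxx cards1 mul1n /others fa.
apply: eq_big => l; rewrite ?inE // => lk; by rewrite /slots fa (negPf lk).
Qed.

(** The vertex [y] must avoid the [r.-1] vertices of the transversal outside class [k]. This
    lower-order term is kept because [unbalanced_arith] compares quantities of that order. *)
Lemma card_sole a b : f a = k ->
  #|[set t in ocopies r augment | sole_bad f augment (a, b) t]|
  <= others * (#|V| - #|part f k| - r.-1).
Proof.
move=> fa; set S := [set t in _ | _].
pose G := [set gy : {ffun 'I_r -> V} * V | (gy.1 \in family (slots f a)) &&
  (gy.2 \in ~: part f k :\: [set gy.1 l | l in [set~ k]])].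
have gA := graph_augment.
have cG : #|G| = others * (#|V| - #|part f k| - r.-1).
  rewrite (card_pairs (mem (family (slots f a))) (fun g => mem (~: part f k :\: [set g l | l in [set~ k]]))).
  rewrite -(card_slots fa) -sum_nat_const; apply: eq_bigr => g /familyP gD.
  have fg l : f (g l) = l.
    by move: (gD l); rewrite /slots; case: eqP => [->|_]; rewrite inE => /eqP // ->.
  rewrite (eq_card (_ : _ =i ~: part f k :\: [set g l | l in [set~ k]])); last by move=> y; rewrite inE.
  rewrite cardsD (setIidPr _); last first.
    by apply/subsetP => _ /imsetP[l lk ->]; rewrite !inE fg in lk *.
  by rewrite cardsCs setCK card_imset ?cardsC1 ?card_ord //; apply: can_inj fg.
rewrite -cG; apply: leq_trans (leq_imset_card (fan f b) G).
apply/subset_leq_card/subsetP => -[T [x y]] /setIdP[tc sb].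
have [aT bT [g [tE fg ga fya]]] := sole_bad_fan gA tc sb.
have xy : x != y by case/ocopiesP: tc.
have xE : x = g (f y) by case: tE.
apply/imsetP; exists (g, y) => //; rewrite in_set /=; apply/andP; split.
  by apply/familyP => l; rewrite /slots; case: eqP => [->|_]; rewrite inE ?ga // fg.
rewrite in_setD in_setC in_set -fa fya andbT; apply/imsetP => -[l _ yE].
by move: xy; rewrite xE {1}yE fg -yE eqxx.
Qed.

(** Two adjacent bad edges at [c] would close a triangle of [B] unless their other ends are the
    removed pair, and two disjoint ones always give a triangle, all four vertices having colour [k].
    So the removed pair consists of two neighbours of [c], and the clique is a transversal through
    [c]. *)
Lemma card_cherry :
  #|[set t in ocopies r augment | ~~ [exists p, sole_bad f augment p t]]|
  <= (\sum_c #|nbr B c| * #|nbr B c|.-1) * others.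
Proof.
set S := [set t in _ | _].
have gA := graph_augment; have [symB irrB] := gB.
have cherry T x y : (T, (x, y)) \in S -> exists c, [/\ c \in T, B c x & B c y].
  case/setIdP=> tc ns; have [xT yT] := ocopy_notin gA tc.
  pose Q := verts (T, (x, y)).
  have adj u v : u \in Q -> v \in Q -> u != v -> f u = f v -> (u, v) != (x, y) -> (u, v) != (y, x) -> B u v.
    by move=> *; rewrite -bad_augment; apply: (mono_bad gA tc).
  have QT c : c \in Q -> c != x -> c != y -> c \in T.
    by rewrite !inE => /or3P[/eqP ->|/eqP ->|//]; rewrite eqxx.
  case: (sole_bad_or_two f gA tc) => [[p sb]|[[c [u [v [+ uv]]]]|[[a b] [[a' b'] [/= + dis]]]]].
  - by case/existsP: ns; exists p.
  - rewrite !bad_augment !subUset !sub1set => /andP[/andP[cQ uQ] vQ] cu cv.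
    have fuv : f u = f v by rewrite (Bk2 cu) (Bk2 cv).
    have cux : c != u by apply: contraTneq cu => ->; rewrite irrB.
    have cvx : c != v by apply: contraTneq cv => ->; rewrite irrB.
    have [[e1 e2]|h1] := eqVneq (u, v) (x, y).
      by subst u v; exists c; split=> //; apply: QT.
    have [[e1 e2]|h2] := eqVneq (u, v) (y, x).
      by subst u v; exists c; split=> //; apply: QT.
    by case: (triB cu (adj _ _ uQ vQ uv fuv h1 h2) cv).
  - rewrite !bad_augment !subUset !sub1set => /andP[/andP[/andP[aQ bQ] a'Q] b'Q] ab a'b'.
    have fa := Bk ab; have fb := Bk2 ab; have fa' := Bk a'b'; have fb' := Bk2 a'b'.
    have d w : w \in [set a; b] -> (w != a') && (w != b').
      by move=> h; move: (disjointFr dis h); rewrite !inE => /negbT; rewrite negb_or.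
    have /andP[aa' ab'] := d a (set21 _ _); have /andP[ba' bb'] := d b (set22 _ _).
    have tri z : z \in Q -> f z = k -> a != z -> b != z ->
        ((a, z) = (x, y)) \/ ((a, z) = (y, x)) \/ ((b, z) = (x, y)) \/ ((b, z) = (y, x)).
      move=> zQ fz az bz.
      have [|h1] := eqVneq (a, z) (x, y); first by left.
      have [|h2] := eqVneq (a, z) (y, x); first by right; left.
      have [|h3] := eqVneq (b, z) (x, y); first by right; right; left.
      have [|h4] := eqVneq (b, z) (y, x); first by right; right; right.
      have haz : B a z by apply: adj; rewrite ?fa ?fz.
      have hbz : B b z by apply: adj; rewrite ?fb ?fz.
      by case: (triB ab hbz haz).
    have n1 : a' != b' by apply: contraTneq a'b' => ->; rewrite irrB.
    have n2 : a != b by apply: contraTneq ab => ->; rewrite irrB.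
    have := tri a' a'Q fa' aa' ba'; have := tri b' b'Q fb' ab' bb'.
    by move=> [[e1 e2]|[[e1 e2]|[[e1 e2]|[e1 e2]]]] [[e3 e4]|[[e3 e4]|[[e3 e4]|[e3 e4]]]];
      subst; rewrite ?eqxx in n1 n2 aa' ab' ba' bb'.
pose G := [set q : V * ({ffun 'I_r -> V} * (V * V)) | (f q.1 == k) &&
   (q.2 \in [set h | (h.1 \in family (slots f q.1)) &&
     [&& h.2.1 \in nbr B q.1, h.2.2 \in nbr B q.1 & h.2.1 != h.2.2]])].
have cG : #|G| <= (\sum_c #|nbr B c| * #|nbr B c|.-1) * others.
  rewrite (card_pairs (fun c => f c == k) (fun c => mem [set h | (h.1 \in family (slots f c)) &&
     [&& h.2.1 \in nbr B c, h.2.2 \in nbr B c & h.2.1 != h.2.2]])).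
  rewrite big_distrl /= [leqRHS](bigID (fun c => f c == k)) /=; apply: leq_trans (leq_addr _ _).
  apply: leq_sum => c /eqP fc.
  rewrite (eq_card (_ : _ =i [set h : {ffun 'I_r -> V} * (V * V) | (h.1 \in family (slots f c)) &&
     [&& h.2.1 \in nbr B c, h.2.2 \in nbr B c & h.2.1 != h.2.2]])); last by move=> h; rewrite inE.
  rewrite (card_pairs (mem (family (slots f c))) (fun _ (p : V * V) => [&& p.1 \in nbr B c, p.2 \in nbr B c & p.1 != p.2])).
  by rewrite sum_nat_const card_offdiag (card_slots fc) mulnC.
apply: leq_trans cG.
pose F (q : V * ({ffun 'I_r -> V} * (V * V))) := ([set q.2.1 l | l in setT], q.2.2).
apply: leq_trans (leq_imset_card F G).
apply/subset_leq_card/subsetP => -[T [x y]] tS; have [c [cT cx cy]] := cherry _ _ _ tS.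
have /setIdP[tc _] := tS; have [cardT cl hx hy xy] := ocopiesP _ _ _ _ _ tc.
have [xT yT] := ocopy_notin gA tc.
have fc := Bk cx.
have Tinj : {in T &, injective f}.
  move=> u v uT vT fuv; apply/eqP; apply/negPn/negP => uv.
  have buv : B u v by rewrite -bad_augment /bad cl // fuv eqxx.
  have fx := Bk2 cx.
  have bux : B u x by rewrite -bad_augment /bad hx // (Bk buv) fx eqxx.
  have bvx : B v x by rewrite -bad_augment /bad hx // (Bk2 buv) fx eqxx.
  exact: (triB buv bvx bux).
have fT l : exists2 u, u \in T & f u == l.
  have : l \in f @: T.
    suff -> : f @: T = setT by rewrite inE.
    by apply/eqP; rewrite eqEcard subsetT cardsT card_ord (card_in_imset Tinj) cardT leqnn.
  by case/imsetP => u uT ->; exists u.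
pose g := [ffun l => odflt c [pick u in T | f u == l]].
have gP l : g l \in T /\ f (g l) = l.
  rewrite ffunE; case: pickP => [u /andP[uT /eqP fu]|h] //=.
  by have [u uT fu] := fT l; move: (h u); rewrite /= uT fu.
have gu u : u \in T -> g (f u) = u.
  by move=> uT; have [h1 h2] := gP (f u); apply: Tinj.
apply/imsetP; exists (c, (g, (x, y))).
  rewrite in_set /= fc eqxx in_set /= !inE cx cy xy !andbT.
  apply/familyP => l; rewrite /slots; case: eqP => [->|_]; last by rewrite inE; have [_ ->] := gP l.
  by rewrite gu // inE.
rewrite /F /=; congr pair; apply/setP => u; apply/idP/imsetP => [uT|[l _ ->]].
  by exists (f u); rewrite ?inE ?gu.
by have [] := gP l.
Qed.

Lemma card_ocopies_augment :
  2 * #|ocopies r augment| <= #|arcs B| * (others * (#|V| - #|part f k| - r.-1))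
  + 2 * ((\sum_c #|nbr B c| * #|nbr B c|.-1) * others).
Proof.
set S := ocopies r augment.
pose S1 := [set t in S | [exists p, sole_bad f augment p t]].
pose S2 := [set t in S | ~~ [exists p, sole_bad f augment p t]].
have c : #|S| <= #|S1| + #|S2|.
  apply: leq_trans (leq_card_setU _ _); apply/subset_leq_card/subsetP => t tS.
  rewrite in_setU; case: (boolP [exists p, sole_bad f augment p t]) => h; apply/orP; [left|right];
    exact/setIdP.
apply: leq_trans (leq_mul (leqnn 2) c) _; rewrite mulnDr; apply: leq_add; last first.
  by rewrite leq_mul2l card_cherry orbT.
apply: leq_trans (_ : \sum_(p in arcs B) #|[set t in S1 | sole_bad f augment p t]| <= _).
  apply: leq_sum_cover => t /setIdP[tS /existsP[[a b] sb]].
  have /and4P[_ _ /= + _] := sb; rewrite bad_augment => Bab.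
  have ab : a != b by apply: contraTneq Bab => ->; rewrite (proj2 gB).
  rewrite (_ : 2 = #|[set (a, b); (b, a)]|); last by rewrite cards2 xpair_eqE (negPf ab).
  apply/subset_leq_card/subsetP => p; rewrite !inE => /orP[]/eqP ->.
    by rewrite sb andbT.
  by rewrite (sole_bad_sym graph_augment sb) andbT /= (proj1 gB).
rewrite -sum_nat_const; apply: leq_sum => -[a b]; rewrite inE /= => Bab.
apply: leq_trans (card_sole b (Bk Bab)); apply/subset_leq_card/subsetP => t.
by case/setIdP => /setIdP[tS _] h; apply/setIdP.
Qed.
End Construction.

(** * Balanced partitions *)

Section Turan.
Variables (V : finType) (r : nat).
Hypothesis r0 : 0 < r.

(** Counted in arcs, hence twice the number of edges of the Turan graph. *)
Definition turan := \max_(f : {ffun V -> 'I_r}) #|arcs (Kpart f)|.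

Lemma turan_attained : exists f : {ffun V -> 'I_r}, #|arcs (Kpart f)| = turan.
Proof.
have h : 0 < #|{: {ffun V -> 'I_r}}|.
  by apply/card_gt0P; exists [ffun=> Ordinal r0].
by have [f hf] := @bigop.eq_bigmax {ffun V -> 'I_r} (fun f => #|arcs (Kpart f)|) h; exists f.
Qed.

Lemma turan_ge (f : {ffun V -> 'I_r}) : #|arcs (Kpart f)| <= turan.
Proof. by rewrite /turan (bigop.leq_bigmax f). Qed.

Lemma turan_balanced (f : {ffun V -> 'I_r}) : #|arcs (Kpart f)| = turan ->
  forall i j, #|part f i| <= #|part f j|.+1.
Proof.
move=> ft i j; rewrite leqNgt; apply/negP => lt.
have [v vi] : exists v, v \in part f i by apply/card_gt0P; apply: leq_ltn_trans lt.
rewrite inE in vi; have ij : i != j by apply: contraTneq lt => ->; rewrite ltnNge leqnSn.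
have := turan_ge (recolor f v j); rewrite -ft leqNgt => /negP; apply.
have [s1 i1] := graph_Kpart f; have [s2 i2] := graph_Kpart (recolor f v j).
rewrite (card_arcs_star v s1 i1) (card_arcs_star v s2 i2).
rewrite (eq_card (_ : arcs (fun x y => [&& Kpart (recolor f v j) x y, x != v & y != v])
  =i arcs (fun x y => [&& Kpart f x y, x != v & y != v]))); last first.
  move=> [x y]; rewrite !inE /= /Kpart !ffunE.
  by case: (x == v); case: (y == v); rewrite ?andbF.
rewrite ltn_add2l ltn_mul2l /=.
have -> : nbr (Kpart f) v = ~: part f i.
  by apply/setP => u; rewrite !inE /Kpart (eqP vi) eq_sym.
have -> : nbr (Kpart (recolor f v j)) v = ~: (v |: part f j).
  apply/setP => u; rewrite !inE /Kpart !ffunE eqxx.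
  by have [_|_] := eqVneq u v; rewrite ?eqxx //= eq_sym.
have vj : v \notin part f j by rewrite inE (eqP vi).
have := cardsC (part f i); have := cardsC (v |: part f j); rewrite cardsU1 vj.
clear -lt; lia.
Qed.

(** With [a] the smallest class size of [f], every integer [x] satisfies
    [(x - a) * (x - a - 1) >= 0], with equality at the class sizes of [f]. Summed over the classes,
    this shows that [f] has the least sum of squares. *)
Lemma turan_of_balanced (f : {ffun V -> 'I_r}) :
  (forall i j, #|part f i| <= #|part f j|.+1) -> #|arcs (Kpart f)| = turan.
Proof.
move=> bal; apply/eqP; rewrite eqn_leq turan_ge /=.
have [g <-] := turan_attained.
have [i0 _ hmin] := arg_minnP (fun l => #|part f l|) (erefl true : xpredT (Ordinal r0)).
set a := #|part f i0| in hmin.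
have cf l : #|part f l| ^ 2 + a * a.+1 = (2 * a).+1 * #|part f l|.
  have h1 := hmin l isT; have h2 := bal l i0; rewrite -/a in h2.
  have [->|->] : #|part f l| = a \/ #|part f l| = a.+1 by clear -h1 h2; lia.
  - by rewrite -mulnn; clear; nia.
  - by rewrite -mulnn; clear; nia.
have cg l : (2 * a).+1 * #|part g l| <= #|part g l| ^ 2 + a * a.+1.
  rewrite -mulnn; move: #|part g l| => x; clear.
  have [h|h] := leqP x a.
    have [k ->] : exists k, a = x + k by exists (a - x); lia.
    by nia.
  have [k ->] : exists k, x = a.+1 + k by exists (x - a.+1); lia.
  by nia.
have hf := card_arcs_Kpart f; have hg := card_arcs_Kpart g.
have e1 : \sum_l #|part f l| ^ 2 + r * (a * a.+1) = (2 * a).+1 * #|V|.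
  rewrite -(sum_part f) big_distrr /= -(eq_bigr _ (fun l _ => cf l)) big_split /=.
  by rewrite sum_nat_const card_ord.
have e2 : (2 * a).+1 * #|V| <= \sum_l #|part g l| ^ 2 + r * (a * a.+1).
  rewrite -(sum_part g) big_distrr /=.
  apply: leq_trans (leq_sum _ (fun l _ => cg l)) _.
  by rewrite big_split /= sum_nat_const card_ord.
have le : \sum_l #|part f l| ^ 2 <= \sum_l #|part g l| ^ 2.
  by rewrite -(leq_add2r (r * (a * a.+1))) e1.
by rewrite -(leq_add2r (\sum_l #|part g l| ^ 2)) hg -hf leq_add2l.
Qed.
End Turan.

Section Rebalance.
Variables (V : finType) (r : nat) (f : {ffun V -> 'I_r}) (A : rel V).
Hypothesis gA : graph A.
Hypothesis cross : forall x y, f x != f y -> A x y.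

(** All edges at [v] are rebuilt: in its new class [v] is joined to everything outside and to
    nothing inside, hence lies in no bad edge. *)
Definition moved v j : rel V := fun x y =>
  if (x == v) || (y == v) then recolor f v j x != recolor f v j y else A x y.

Lemma graph_moved v j : graph (moved v j).
Proof.
case: gA => symA irrA; split=> [x y|x]; rewrite /moved ?eqxx ?irrA ?if_same //.
by rewrite orbC symA [recolor f v j x == _]eq_sym.
Qed.

Lemma bad_moved v j x y : bad (recolor f v j) (moved v j) x y ->
  [/\ bad f A x y, x != v & y != v].
Proof.
rewrite /bad /moved; case: ifP => [_|/norP[xv yv]]; first by rewrite andNb.
by rewrite !ffunE (negPf xv) (negPf yv) => ->.
Qed.

Lemma card_arcs_moved v j : j != f v ->
  #|arcs (moved v j)| + 2 * (#|part f j|.+1 + #|nbr (bad f A) v|) = #|arcs A| + 2 * #|part f (f v)|.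
Proof.
move=> jv; have [s1 i1] := gA; have [s2 i2] := graph_moved v j.
rewrite (card_arcs_star v s1 i1) (card_arcs_star v s2 i2).
rewrite (eq_card (_ : arcs (fun x y => [&& moved v j x y, x != v & y != v])
  =i arcs (fun x y => [&& A x y, x != v & y != v]))); last first.
  move=> [x y]; rewrite !inE /= /moved.
  by case: (x == v); case: (y == v); rewrite ?andbF.
have -> : nbr (moved v j) v = ~: (v |: part f j).
  apply/setP => u; rewrite !inE /moved eqxx !ffunE eqxx.
  by have [_|_] := eqVneq u v; rewrite ?eqxx //= eq_sym.
have vj : v \notin part f j by rewrite inE eq_sym.
have h1 := cardsC (v |: part f j); rewrite cardsU1 vj in h1.
have h2 := card_nbr_mis f A v.
have h3 : #|nbr (mis f A) v| = 0.
  apply: eq_card0 => u; rewrite !inE /mis.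
  by case: (boolP (f v == f u)) => [_|/cross ->]; rewrite ?andbF.
move: h1 h2; rewrite h3; clear; lia.
Qed.

(** The move gains at least one edge, less the bad edges lost at [v]. If [v] had none, some bad edge
    [ab] can be deleted in exchange; if it had exactly one, that edge is [ab]. In both cases the
    copies with [a] and [b] in the clique disappear and only copies through [v] are new. *)
Lemma rebalance v j : optimal r A -> j != f v -> #|part f j|.+2 <= #|part f (f v)| ->
  #|nbr (bad f A) v| <= 1 -> (exists a b, bad f A a b) ->
  exists a b, bad f A a b /\
    #|[set t in ocopies r A | (a \in t.1) && (b \in t.1)]| <=
    #|[set t in ocopies r (moved v j) | v \in verts t]|.
Proof.
move=> opt jv big d1 [a0 [b0 bad0]].
have [symB irrB] := graph_bad gA f.
have cm := card_arcs_moved jv.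
have gM := graph_moved v j.
suff [a [b [A1 [bab g1 s1 c1 h1]]]] : exists a b A1, [/\ bad f A a b, graph A1, subrel A1 (moved v j),
    #|arcs A| <= #|arcs A1| & forall t, t \in ocopies r A1 -> v \notin verts t ->
      t \in ocopies r A :\: [set t in ocopies r A | (a \in t.1) && (b \in t.1)]].
  exists a, b; split=> //; set Sab := [set t in ocopies r A | _] in h1 *.
  set Sv := [set t in _ | _].
  have le1 : #|ocopies r A1| <= #|ocopies r A :\: Sab| + #|Sv|.
    apply: leq_trans (leq_card_setU _ _); apply/subset_leq_card/subsetP => t tc.
    rewrite in_setU; have [vQ|vQ] := boolP (v \in verts t); apply/orP; [right|left; exact: h1].
    by apply/setIdP; split=> //; apply: (subsetP (ocopies_sub r s1)).
  have le2 := leq_trans (opt A1 g1 c1) le1.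
  move: le2; rewrite -(cardsID Sab (ocopies r A)) addnC leq_add2l (setIidPr _) //.
  by apply/subsetP => t /setIdP[].
have sub_off A1 t : graph A1 -> subrel A1 (moved v j) -> t \in ocopies r A1 -> v \notin verts t ->
    t \in ocopies r A.
  move=> g1 s1; case: t => T [x y] tc vQ.
  have [cT cl hx hy xy] := ocopiesP _ _ _ _ _ tc.
  have inA w z : w \in verts (T, (x, y)) -> z \in verts (T, (x, y)) -> A1 w z -> A w z.
    move=> wQ zQ /s1; rewrite /moved; case: ifP => // /orP[]/eqP e; subst.
      by rewrite wQ in vQ.
    by rewrite zQ in vQ.
  have TQ w : w \in T -> w \in verts (T, (x, y)) by move=> h; rewrite !inE h !orbT.
  have xQ : x \in verts (T, (x, y)) by rewrite !inE eqxx.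
  have yQ : y \in verts (T, (x, y)) by rewrite !inE eqxx orbT.
  by apply/ocopiesP; split=> // [w z wT zT wz|w wT|w wT]; apply: inA; auto.
have [d0|dpos] := posnP #|nbr (bad f A) v|.
  have nbv u : ~~ bad f A v u.
    by apply/negP => h; have := card0_eq d0 u; rewrite inE h.
  have a0v : a0 != v by apply: contraTneq bad0 => ->; apply: nbv.
  have b0v : b0 != v by apply: contraTneq bad0 => ->; rewrite symB; apply: nbv.
  have M0 : moved v j a0 b0.
    by rewrite /moved (negPf a0v) (negPf b0v); case/andP: bad0.
  have ab : a0 != b0 by apply: contraTneq bad0 => ->; rewrite irrB.
  have gd := graph_del a0 b0 gM.
  have sd : subrel (del_edge (moved v j) a0 b0) (moved v j) by move=> x y /andP[].
  exists a0, b0, (del_edge (moved v j) a0 b0); split=> //.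
    have cd := card_arcs_del gM M0; move: cm; rewrite cd d0; clear -big; lia.
  move=> t tc vQ; rewrite in_setD (sub_off _ t gd sd tc vQ) andbT.
  apply/negP => /setIdP[_ /andP[aT bT]].
  case: t tc aT bT {vQ} => T [x y] /ocopiesP[_ cl _ _ _] aT bT.
  by have := cl _ _ aT bT ab; rewrite /del_edge /same_edge !eqxx andbF.
case/card_gt0P: (dpos) => w; rewrite inE => bvw.
have sM : subrel (moved v j) (moved v j) by [].
exists v, w, (moved v j); split=> //.
  by move: cm; clear -big d1; lia.
move=> t tc vQ; rewrite in_setD (sub_off _ t gM sM tc vQ) andbT.
by apply: contra vQ => /setIdP[_ /andP[vT _]]; rewrite !inE vT !orbT.
Qed.

Lemma part_recolor v j l m : (forall i, #|part f i| <= m) -> #|part (recolor f v j) l| <= m.+1.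
Proof.
move=> hm; apply: leq_trans (_ : #|v |: part f l| <= _).
  apply/subset_leq_card/subsetP => u; rewrite !inE ffunE; by case: (u == v).
by rewrite cardsU1 -add1n leq_add ?leq_b1.
Qed.
End Rebalance.

Local Open Scope ring_scope.

(** * Upper bound for optimal graphs, and maximum cuts with few bad edges *)

Lemma exists_forest (V : finType) (P : {set V}) (q : nat) : (q < #|P|)%N ->
  exists B : rel V, [/\ graph B, forall x y, B x y -> x \in P,
    forall x y z, B x y -> B y z -> B x z -> False, #|arcs B| = (2 * q)%N &
    (\sum_x #|nbr B x| * #|nbr B x|.-1 <= 2 * ((2 * q).+1 - #|P|))%N].
Proof.
move=> qP; have [B [gB sB cB]] := exact_subgraph (graph_forest P q) (card_forest qP).
exists B; split=> //.
- by move=> x y /sB /and3P[].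
- by move=> x y z /sB h1 /sB h2 /sB h3; apply: forest_triangle_free h1 h2 h3.
- apply: leq_trans (forest_cherries qP); apply: leq_sum => x _.
  have h : (#|nbr B x| <= #|nbr (forest P q) x|)%N.
    by apply/subset_leq_card/subsetP => y; rewrite !inE; apply: sB.
  by apply: leq_mul => //; clear -h; lia.
Qed.

Section RealBounds.
Variable R : realFieldType.

Lemma expr_diff_le (a y : R) k : 0 <= a -> a <= y -> y <= 1 -> y ^+ k - a ^+ k <= k%:R * (y - a).
Proof.
move=> a0 ay y1; elim: k => [|k IH]; first by rewrite !expr0 subrr mul0r.
rewrite !exprS -natr1.
have y0 : 0 <= y := le_trans a0 ay.
have h1 := ler_wpM2l y0 IH.
have h2 : y * (k%:R * (y - a)) <= 1 * (k%:R * (y - a)).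
  by rewrite ler_wpM2r // mulr_ge0 // subr_ge0.
have h3 : a ^+ k * (y - a) <= 1 * (y - a).
  by rewrite ler_wpM2r ?subr_ge0 // exprn_ile1 // (le_trans ay).
clear -h1 h2 h3; lra.
Qed.

Variables (V : finType) (r : nat).
Hypothesis r2 : (2 <= r)%N.
Local Notation N := (#|V|%:R : R).

Lemma balanced_parts (f : {ffun V -> 'I_r}) : #|arcs (Kpart f)| = turan V r ->
  forall l, `|#|part f l|%:R - r%:R^-1 * N| <= 1.
Proof.
move=> ft l; have bal := turan_balanced ft.
have r0 : 0 < r%:R :> R by rewrite ltr0n ltnW.
have E : r%:R * (#|part f l|%:R - r%:R^-1 * N) = \sum_i (#|part f l|%:R - #|part f i|%:R).
  rewrite big_split /= sumr_const card_ord sumrN -natr_sum (sum_part f).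
  by rewrite -(mulr_natl (#|part f l|%:R) r) mulrBr [r%:R * (_ * _)]mulrA divff ?mul1r // gt_eqF.
have b i : - 1 <= (#|part f l|%:R : R) - #|part f i|%:R <= 1.
  have := bal l i; have := bal i l; rewrite -!(ler_nat R) -!natr1; clear => h1 h2.
  by apply/andP; split; lra.
have S1 : \sum_(i < r) (1 : R) = r%:R by rewrite sumr_const card_ord.
rewrite ler_norml; apply/andP; split; rewrite -(ler_pM2l r0) E ?mulrN mulr1 -S1 -?sumrN;
  by apply: ler_sum => i _; case/andP: (b i).
Qed.

Lemma turan_lb : (1 - r%:R^-1) * N ^+ 2 - r%:R <= (turan V r)%:R.
Proof.
have [f ft] := turan_attained V (ltnW r2).
have hb := balanced_parts ft; rewrite -ft.
have := congr1 (fun k => k%:R : R) (card_arcs_Kpart f); rewrite natrD natrX natr_sum => hK.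
have E : \sum_l (#|part f l|%:R - r%:R^-1 * N) ^+ 2
   = \sum_l #|part f l|%:R ^+ 2 - r%:R^-1 * N ^+ 2.
  have r0 : r%:R != 0 :> R by rewrite pnatr_eq0 -lt0n ltnW.
  rewrite (eq_bigr (fun l => #|part f l|%:R ^+ 2 + ((- 2 * (r%:R^-1 * N)) * #|part f l|%:R
     + (r%:R^-1 * N) ^+ 2))); last by move=> l _; ring.
  rewrite !big_split /= -mulr_sumr -natr_sum (sum_part f) sumr_const card_ord -mulr_natr.
  by field.
have h : \sum_l (#|part f l|%:R - r%:R^-1 * N) ^+ 2 <= r%:R.
  apply: le_trans (_ : \sum_(i < r) (1 : R) <= _); last by rewrite sumr_const card_ord.
  apply: ler_sum => l _; rewrite -[leRHS](expr1n _ 2) -real_normK ?num_real //.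
  by rewrite lerXn2r ?nnegrE ?hb.
move: hK; rewrite (eq_bigr (fun l => #|part f l|%:R ^+ 2)); last by move=> l _; rewrite natrX.
move=> hK; rewrite E in h; clear -hK h; lra.
Qed.

Lemma card_others_le (f : V -> 'I_r) k (y : R) : (forall l, #|part f l|%:R <= y) ->
  (others f k)%:R <= y ^+ r.-1.
Proof.
move=> h; have <- : #|[set~ k]| = r.-1 by rewrite cardsC1 card_ord.
by rewrite /others natr_prod -prodr_const; apply: ler_prod => l _; rewrite ler0n h.
Qed.

(** The competitor is a forest inside one class of a Turan graph; the bound on [q] makes it fit into
    a class. Its cherries contribute only a multiple of [N ^+ r], absorbed by [eta]. *)
Lemma optimal_upper (A : rel V) (q : nat) (eta : R) : 0 < eta -> optimal r A ->
  (#|arcs A| <= turan V r + 2 * q)%N -> q%:R <= (r%:R^-1 - r%:R^-1 ^+ 2) * N -> r%:R ^+ 2 < N ->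
  r%:R + r%:R <= N -> (3 * r%:R + 6) / eta <= N ->
  #|ocopies r A|%:R <= kap R r * q%:R * N ^+ r + eta * (N * N ^+ r).
Proof.
move=> eta0 opt hA hq rN rN2 Neta.
have r0 : 0 < r%:R :> R by rewrite ltr0n ltnW.
have r1 : 1 <= r%:R :> R by rewrite ler1n ltnW.
have rE : r%:R * r%:R^-1 = 1 :> R by rewrite divff // gt_eqF.
have N0 : 0 < N by apply: lt_trans rN; rewrite exprn_gt0.
have [f ft] := turan_attained V (ltnW r2).
have hb := balanced_parts ft.
pose k := Ordinal (ltnW r2).
have hkl : r%:R^-1 * N - 1 <= #|part f k|%:R.
  by have := hb k; rewrite ler_norml => /andP[h _]; clear -h; lra.
have hl l : #|part f l|%:R <= r%:R^-1 * N + 1.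
  by have := hb l; rewrite ler_norml => /andP[_ h]; clear -h; lra.
have qk : (q < #|part f k|)%N.
  rewrite -(ltr_nat R); apply: lt_le_trans hkl; apply: le_lt_trans hq _.
  have : 1 < r%:R^-1 ^+ 2 * N.
    by rewrite exprVn -(ltr_pM2l (_ : 0 < r%:R ^+ 2)) ?exprn_gt0 // mulrA divff ?mul1r ?mulr1 ?expf_neq0 ?gt_eqF.
  clear; lra.
have [B [gB BP triB cB dB]] := exists_forest qk.
have Bk x y : B x y -> f x = k by move/BP; rewrite inE => /eqP.
have gA' := graph_augment f gB.
have le1 : (#|ocopies r A| <= #|ocopies r (augment f B)|)%N.
  by apply: opt => //; rewrite (arcs_augment gB Bk) ft cB.
have le2 := card_ocopies_augment gB Bk triB.
rewrite cB in le2.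
have le3 : (#|ocopies r A| <= q * (others f k * (#|V| - #|part f k|)) +
    (4 * q + 2) * others f k)%N.
  apply: leq_trans le1 _; rewrite -(leq_pmul2l (_ : 0 < 2)%N) //; apply: leq_trans le2 _.
  rewrite mulnDr; apply: leq_add.
    by rewrite -mulnA leq_mul2l /= !leq_mul2l leq_subr !orbT.
  rewrite leq_mul2l /= leq_mul2r (leq_trans dB) ?orbT //; clear; lia.
have {}le3 : #|ocopies r A|%:R <= q%:R * ((others f k)%:R * (N - #|part f k|%:R)) +
    (4 * q%:R + 2) * (others f k)%:R :> R.
  by move: le3; rewrite -(ler_nat R) natrD !natrM natrB ?max_card // natrD natrM.
apply: le_trans le3 _.
have ho : (others f k)%:R <= (r%:R^-1 * N + 1) ^+ r.-1 by apply: card_others_le.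
pose s : R := N^-1.
have sN : s * N = 1 by rewrite mulVf // gt_eqF.
have s0 : 0 <= s by rewrite invr_ge0 ltW.
pose w : R := r%:R^-1 ^+ r.-1.
have w1 : w <= 1 by rewrite exprn_ile1 ?invr_ge0 ?(ltW r0) // invf_le1.
have rV0 : 0 <= r%:R^-1 :> R by rewrite invr_ge0 ltW.
have w0 : 0 <= w by rewrite exprn_ge0.
have rs : r%:R * s + r%:R * s <= 1.
  by rewrite -(ler_pM2r N0) mulrDl -!mulrA sN !mulr1 mul1r.
have hy : (r%:R^-1 * N + 1) ^+ r.-1 <= (w + r%:R * s) * N ^+ r.-1.
  have -> : r%:R^-1 * N + 1 = (r%:R^-1 + s) * N by rewrite mulrDl sN.
  rewrite exprMn ler_wpM2r ?exprn_ge0 ?(ltW N0) //.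
  have h1 : r%:R^-1 + s <= 1.
    have : s <= r%:R * s by rewrite ler_peMl.
    have : r%:R^-1 <= 2^-1 :> R by rewrite lef_pV2 ?posrE // ler_nat.
    clear -rs; lra.
  have := @expr_diff_le r%:R^-1 (r%:R^-1 + s) r.-1 rV0 _ h1.
  rewrite lerDl s0 => /(_ isT); rewrite -/w.
  have : r.-1%:R * s <= r%:R * s by rewrite ler_wpM2r // ler_nat leq_pred.
  clear; lra.
have NrE : N ^+ r = N ^+ r.-1 * N by rewrite -exprSr prednK // ltnW.
have X0 : 0 <= N ^+ r.-1 by rewrite exprn_ge0 // ltW.
have ho2 := le_trans ho hy.
have hnk : N - #|part f k|%:R <= ((1 - r%:R^-1) + s) * N by rewrite mulrDl sN; clear -hkl; lra.
have hnk0 : 0 <= N - #|part f k|%:R by rewrite subr_ge0 ler_nat max_card.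
have h1 : (others f k)%:R * (N - #|part f k|%:R) <= (kap R r + 3 * r%:R * s) * N ^+ r.
  apply: le_trans (ler_pM (ler0n _ _) hnk0 ho2 hnk) _.
  rewrite NrE [leRHS](_ : _ = (kap R r + 3 * r%:R * s) * N ^+ r.-1 * N); last by ring.
  rewrite [leLHS](_ : _ = ((w + r%:R * s) * (1 - r%:R^-1 + s)) * N ^+ r.-1 * N); last by ring.
  rewrite ler_wpM2r ?(ltW N0) // ler_wpM2r //.
  have kE : kap R r = (1 - r%:R^-1) * w.
    have hr : r%:R ^+ r = r%:R ^+ r.-1 * r%:R :> R by rewrite -exprSr prednK // ltnW.
    by rewrite /kap /w hr exprVn invfM mulrA mulrAC mulrBl mul1r rE.
  have e1 : w * s <= r%:R * s by rewrite ler_wpM2r // (le_trans w1).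
  have e2 : r%:R * s * s <= r%:R * s.
    rewrite ler_piMr ?mulr_ge0 ?(ltW r0) //.
    have : s <= r%:R * s by rewrite ler_peMl.
    clear -rs s0; lra.
  have e3 : r%:R * s * r%:R^-1 = s by rewrite mulrAC rE mul1r.
  rewrite kE; clear -e1 e2 e3 s0 rs; lra.
have h2 : q%:R * ((others f k)%:R * (N - #|part f k|%:R)) <=
    kap R r * q%:R * N ^+ r + 3 * r%:R * N ^+ r.
  apply: le_trans (ler_wpM2l (ler0n _ q) h1) _.
  have qN : q%:R * s <= 1.
    rewrite -(ler_pM2r N0) -mulrA sN mulr1 mul1r; apply: le_trans hq _.
    rewrite ler_piMl ?(ltW N0) //.
    have rV1 : r%:R^-1 <= 1 :> R by rewrite invf_le1.
    have rV2 : 0 <= r%:R^-1 ^+ 2 :> R by rewrite sqr_ge0.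
    clear -rV1 rV2; lra.
  have Xr : 0 <= 3 * r%:R * N ^+ r by rewrite !mulr_ge0 ?exprn_ge0 // ?ltW.
  have h := ler_wpM2l Xr qN; clear -h h1; lra.
have h3 : (4 * q%:R + 2) * (others f k)%:R <= 6 * N ^+ r.
  have -> : 6 * N ^+ r = (6 * N) * N ^+ r.-1 by rewrite NrE; ring.
  apply: ler_pM => //; first by rewrite addr_ge0 ?mulr_ge0.
    have qN : q%:R <= N.
      apply: le_trans hq _; rewrite ler_piMl ?(ltW N0) //.
      have rV1 : r%:R^-1 <= 1 :> R by rewrite invf_le1.
      have rV2 : 0 <= r%:R^-1 ^+ 2 :> R by rewrite sqr_ge0.
      clear -rV1 rV2; lra.
    clear -qN rN2 r1; lra.
  by apply: card_others_le => l; rewrite ler_nat max_card.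
have h4 : (3 * r%:R + 6) * N ^+ r <= eta * (N * N ^+ r).
  rewrite mulrA ler_wpM2r ?exprn_ge0 ?(ltW N0) //.
  by move: Neta; rewrite ler_pdivrMr // [N * eta]mulrC.
clear -h2 h3 h4; lra.
Qed.
End RealBounds.

(** A smaller positive [e] preserves every condition [a * e < b] with [b > 0], whatever the sign of
    [a]. *)
Lemma small_enough (R : realFieldType) (s : seq (R * R)) : all (fun p => 0 < p.2) s ->
  exists e : R, [/\ 0 < e, e <= 1 & all (fun p => p.1 * e < p.2) s].
Proof.
elim: s => [|[a b] s IH] /=; first by exists 1; rewrite ltr01 lexx.
case/andP=> b0 hs; have [e [e0 e1 he]] := IH hs.
pose d := Num.min e (b / (2 * (`|a| + 1))).
have a1 : 0 < `|a| + 1 by rewrite ltr_wpDl.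
have d0 : 0 < d by rewrite lt_min e0 divr_gt0 // mulr_gt0.
have de : d <= e by rewrite ge_min lexx.
exists d; split=> //; first exact: le_trans de e1.
apply/andP; split.
  apply: le_lt_trans (_ : (`|a| + 1) * d < b).
    by rewrite ler_wpM2r ?(ltW d0) // (le_trans (ler_norm a)) // lerDl.
  have : d <= b / (2 * (`|a| + 1)) by rewrite ge_min lexx orbT.
  rewrite ler_pdivlMr ?mulr_gt0 //; clear -b0; lra.
apply/allP => p ps; have := allP he p ps; have [p0|p0] := lerP 0 p.1.
  by apply: le_lt_trans; rewrite ler_wpM2l.
by move=> _; apply: lt_trans (allP hs p ps); rewrite nmulr_rlt0.
Qed.

(** Few copies give few [r.+1]-cliques, hence by stability a colouring with few bad arcs. A
    colouring that minimises the bad arcs has no more of them and is cut maximal as well. *)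
Lemma maxcut_exists (R : archiRealFieldType) r (gam : R) : (2 <= r)%N -> 0 < gam ->
  exists Lam : R, forall (V : finType) (A : rel V), Lam <= #|V|%:R -> graph A ->
  (1 - r%:R^-1) * #|V|%:R ^+ 2 - r%:R <= #|arcs A|%:R :> R ->
  #|ocopies r A|%:R <= 2 * (#|V|%:R * #|V|%:R ^+ r) :> R ->
  exists f : {ffun V -> 'I_r}, cut_maximal f A /\ #|arcs (bad f A)|%:R <= gam * #|V|%:R ^+ 2.
Proof.
move=> r2 gam0; case: r r2 => [//|s] s1.
have g2 : 0 < gam / 2 by rewrite divr_gt0.
have [d d0 Hd] := clique_stability s g2.
(* The [2 * N ^+ r.+1] copies contribute [2 / l] to the clique density; this choice makes it less
   than [d / 2], and the other half of [d] covers the term [l.+1 * N ^+ r]. *)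
pose l := Num.bound (4 / d).
have hl : 4 / d < l%:R by apply: archi_boundP; rewrite divr_ge0 ?ltW.
have l0 : 0 < l%:R :> R by apply: le_lt_trans hl; rewrite divr_ge0 ?ltW.
exists (Num.max 1 (Num.max (2 * l.+1%:R / d) (2 * s.+1%:R / gam))).
move=> V A; set N : R := #|V|%:R; rewrite !ge_max => /and3P[N1 N2 N3] gA hA hc.
have N0 : 0 < N by apply: lt_le_trans N1.
have X0 : 0 < N ^+ s.+1 by rewrite exprn_gt0.
have hk : #|cliques A setT s.+2|%:R <= d * N ^+ s.+2.
  have := card_cliques_ocopies s.+1 l gA; rewrite -(ler_nat R) natrD !natrM natrX -/N => h.
  rewrite -(ler_pM2l l0) exprS; apply: le_trans h _; apply: le_trans (lerD (lexx _) hc) _.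
  have h1 : l.+1%:R * N ^+ s.+1 <= d / 2 * (N * N ^+ s.+1).
    rewrite mulrA ler_wpM2r ?(ltW X0) //.
    move: N2; rewrite ler_pdivrMr // => h; clear -h; lra.
  have h2 : 2 * (N * N ^+ s.+1) <= l%:R * (d / 2 * (N * N ^+ s.+1)).
    rewrite [leRHS]mulrA ler_wpM2r ?mulr_ge0 ?(ltW N0) ?(ltW X0) //.
    move: hl; rewrite ltr_pdivrMr // => h; clear -h; lra.
  have h3 := ler_wpM2l (ltW l0) h1; clear -h2 h3; lra.
have [c cs hm] := Hd V A setT gA hk.
pose f0 : {ffun V -> 'I_s.+1} := [ffun v => inord (c v)].
have hb0 : #|arcs (bad f0 A)|%:R <= gam * N ^+ 2.
  apply: le_trans (_ : #|mono_in A c setT|%:R <= _).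
    rewrite ler_nat; apply/subset_leq_card/subsetP => -[u v]; rewrite !inE /bad /= !ffunE.
    by move=> /andP[-> /eqP/(congr1 val)]; rewrite /= !inordK ?ltnS // => ->; rewrite eqxx.
  have e1 : arcs_in A setT = arcs A.
    by apply/setP => p; rewrite in_set !in_setT !andbT.
  rewrite e1 cardsT -/N in hm.
  have h3 : s.+1%:R <= gam / 2 * N ^+ 2.
    apply: le_trans (_ : gam / 2 * N <= _).
      by move: N3; rewrite ler_pdivrMr // => h; clear -h; lra.
    by rewrite ler_wpM2l ?(ltW g2) // expr2 ler_peMl // ltW.
  move: hm hA h3; move: ((1 - _) * N ^+ 2) => K; clear; lra.
have [f _ fmin] := arg_minnP (fun f : {ffun V -> 'I_s.+1} => #|arcs (bad f A)|) (erefl true : xpredT f0).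
exists f; split.
  by move=> v l'; apply: max_cut_degree => // f'; apply: fmin.
by apply: le_trans hb0; rewrite ler_nat fmin.
Qed.

(** * Structure of optimal graphs *)

Section CloseStructure.
Variables (R : realFieldType) (V : finType) (r : nat) (f : {ffun V -> 'I_r}) (A : rel V) (q : nat).
(** [e] is the precision of the approximate structure, and [e3] the resulting error in the number of
    bad arcs, tied to [e] by [e3E]. The conditions [E1] to [E7] say that [e] is small in terms of
    [r] and [eps]. *)
Variables (e e3 eps : R).
Local Notation N := (#|V|%:R : R).
Hypothesis r2 : (2 <= r)%N.
Hypothesis gA : graph A.
Hypothesis opt : optimal r A.
Hypothesis eN : 1 <= e * N.
Hypothesis N0 : 0 < N.
Hypothesis e0 : 0 < e.
Hypothesis badN : forall v, #|nbr (bad f A) v|%:R <= e * N.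
Hypothesis misN : forall v, #|nbr (mis f A) v|%:R <= e * N.
Hypothesis partN : forall l, `|#|part f l|%:R - r%:R^-1 * N| <= e * N.
Hypothesis misA : #|arcs (mis f A)|%:R <= e * N ^+ 2.
Hypothesis arcsA : #|arcs A| = (turan V r + 2 * q)%N.
Hypothesis qN : q%:R <= (r%:R^-1 - r%:R^-1 ^+ 2 - eps) * N.
Hypothesis copN : #|ocopies r A|%:R <= kap R r * q%:R * N ^+ r + e * (N * N ^+ r).
Hypothesis eps0 : 0 < eps.
Hypothesis E1 : 5 * e < r%:R^-1.
Hypothesis E2 : (5 * r%:R + 2 * r%:R ^+ 2) * e < kap R r / 2.
Hypothesis E3 : 4 * e < kap R r.
Hypothesis E4 : 7 * r.+2%:R ^+ 2 * e < kap R r / 2.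
Hypothesis E5 : e3 + 2 * e < 2 * r%:R^-1 ^+ 2.
Hypothesis E6 : r%:R * e3 / 2 + (2 * r%:R + 30 * r.+2%:R ^+ 2 + 5 * r%:R + 2 * r%:R ^+ 2) * e
  < r%:R * eps * r%:R^-1 ^+ r.-1.
Hypothesis E7 : r%:R * e3 / 2 < r%:R^-1.
Hypothesis e3E : kap R r * e3 = (2 + 25 * r%:R + 10 * r%:R ^+ 2) * e.

Let c := edge_cost r e e.

Lemma close_costE : c = kap R r - (5 * r%:R + 2 * r%:R ^+ 2) * e.
Proof. by rewrite /c /edge_cost; ring. Qed.

Lemma close_partN l : (r%:R^-1 - e) * N <= #|part f l|%:R.
Proof. have := partN l; rewrite ler_norml => /andP[h _]; lra. Qed.

Let tE1 : 3 * e + 2 * e <= r%:R^-1.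
Proof. move: E1; lra. Qed.

Let Z0 : #|set0 : {set V}|%:R <= e * N.
Proof. by rewrite cards0; apply: le_trans eN. Qed.

Lemma free_bad0 : free_bad f A set0 = arcs (bad f A).
Proof. by apply/setP => p; rewrite in_set !in_set0 !andbT. Qed.

Lemma close_edge_copies a b : bad f A a b ->
  c * N ^+ r <= #|[set t in ocopies r A | (a \in t.1) && (b \in t.1)]|%:R.
Proof.
move=> bab; have h : (a, b) \in free_bad f A set0 by rewrite free_bad0 inE.
exact: (bad_edge_copies gA r2 N0 (ltW e0) (ltW e0) eN close_partN misA Z0 (fun v _ => misN v) tE1 h).
Qed.

Lemma close_q_le : q%:R <= N.
Proof.
apply: le_trans qN _; rewrite ler_piMl ?(ltW N0) //.
have h1 : r%:R^-1 <= 1 :> R by rewrite invf_le1 ?ltr0n ?ler1n // ltnW.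
(* The square is needed only to discard it from the coefficient of [N]. *)
have h2 : 0 <= r%:R^-1 ^+ 2 :> R by rewrite sqr_ge0.
move: eps0; lra.
Qed.

(** With no exceptional set, every bad arc accounts for [c * N ^+ r] of twice the copies, so the
    upper bound on the copies limits the number of bad arcs. *)
Lemma close_bad_le : #|arcs (bad f A)|%:R <= 2 * q%:R + e3 * N.
Proof.
have k0 := kap_gt0 R r2.
have X0 : 0 < N ^+ r by rewrite exprn_gt0.
have h := weighted_lower_count gA r2 N0 (ltW e0) (ltW e0) eN close_partN misA Z0 (fun v _ => misN v) tE1.
rewrite big_set0 mulr0 addr0 free_bad0 -/c in h.
set bd : R := #|arcs (bad f A)|%:R in h *.
have bd0 : 0 <= bd by rewrite ler0n.
have h1 : bd * c <= 2 * kap R r * q%:R + 2 * e * N.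
  rewrite -(ler_pM2r X0) -[bd * c * _]mulrA; apply: le_trans h _.
  move: copN; lra.
rewrite close_costE in h1.
have h2 : bd * (kap R r / 2) <= bd * (kap R r - (5 * r%:R + 2 * r%:R ^+ 2) * e).
  by rewrite ler_wpM2l //; move: E2; lra.
(* A crude bound on [bd] comes first; it controls the product of [bd] with the error in the price
   [c]. *)
have h3 : e * N <= kap R r / 4 * N by rewrite ler_wpM2r ?(ltW N0) //; move: E3; lra.
have h4 : bd <= 5 * N.
  rewrite -(ler_pM2r k0); have := ler_wpM2l (ltW k0) close_q_le.
  lra.
have de0 : 0 <= (5 * r%:R + 2 * r%:R ^+ 2) * e.
  by rewrite !(mulr_ge0, addr_ge0) ?exprn_ge0 // ltW.
rewrite -(ler_pM2l k0) mulrDr [kap R r * (e3 * N)]mulrA e3E.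
have := ler_wpM2r de0 h4; lra.
Qed.

(** A missing pair forces a bad edge, since [A] has at least as many arcs as a Turan graph.
    Exchanging the two saves [c * N ^+ r] copies and creates only a small multiple [e] of [N ^+ r],
    against optimality. *)
Lemma close_complete x y : f x != f y -> A x y.
Proof.
move=> fxy; apply/negPn/negP => nA.
have hm : mis f A x y by rewrite /mis nA fxy.
have m0 : (0 < #|arcs (mis f A)|)%N by apply/card_gt0P; exists (x, y); rewrite inE.
have : (0 < #|arcs (bad f A)|)%N.
  have h1 := arcs_balance f A; have h2 := turan_ge f.
  by move: h1 h2 m0; rewrite arcsA; clear; lia.
case/card_gt0P => -[a b]; rewrite inE /= => bab.
have := exchange_missing gA opt bab hm; rewrite -(ler_nat R) natrM natrX natrM natrD natrM natrD natrM !natrX => h.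
have h1 := close_edge_copies bab.
have X0 : 0 < N ^+ r by rewrite exprn_gt0.
have h2 : #|arcs (bad f A)|%:R + N * (#|nbr (bad f A) x|%:R + #|nbr (bad f A) y|%:R) <= 7 * e * N ^+ 2.
  have hb := close_bad_le; have hq := close_q_le.
  have hbx := ler_wpM2l (ltW N0) (badN x); have hby := ler_wpM2l (ltW N0) (badN y).
  have he3 : e3 * N <= 2 * N.
    rewrite ler_wpM2r ?(ltW N0) //.
    have : r%:R^-1 ^+ 2 <= 1 :> R by rewrite exprn_ile1 ?invr_ge0 ?ler0n // invf_le1 ?ltr0n ?ler1n // ltnW.
    move: E5 e0; lra.
  have := ler_wpM2r (ltW N0) eN; move: N0; lra.
have R0 : 0 <= r.+2%:R ^+ 2 * N ^+ r.+2 by rewrite mulr_ge0 ?exprn_ge0 // ltW.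
have h3 := le_trans h (ler_wpM2r R0 h2).
have N4 : 0 <= N ^+ 4 by rewrite exprn_ge0 // ltW.
have h4 := le_trans (ler_wpM2r N4 h1) h3.
have : c <= 7 * r.+2%:R ^+ 2 * e.
  rewrite -(ler_pM2r (_ : 0 < N ^+ r * N ^+ 4)); last by rewrite mulr_gt0 // exprn_gt0.
  rewrite mulrA; apply: le_trans h4 _.
  rewrite le_eqVlt; apply/orP; left; apply/eqP.
  by rewrite -[r.+2]addn2 exprD -[4%N]/(2 + 2)%N exprD addn2; ring.
rewrite close_costE; move: E2 E4; lra.
Qed.

(** The inequality of [rebalance] is evaluated here: a bad edge costs about [kap r * N ^+ r], while
    about [q] bad edges each give the moved vertex about [r * (N / r) ^+ r.-1] copies. It fails
    exactly because of the margin [eps]. *)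
Lemma close_balanced : #|arcs (Kpart f)| = turan V r.
Proof.
have r0 : (0 < r)%N := ltnW r2.
apply/eqP; apply/negPn/negP => nt.
have k0 := kap_gt0 R r2.
have rr0 : 0 < r%:R :> R by rewrite ltr0n.
have rV0 : 0 <= r%:R^-1 :> R by rewrite invr_ge0 ltW.
have rV1 : r%:R^-1 <= 1 :> R by rewrite invf_le1 // ler1n.
have rE : r%:R * r%:R^-1 = 1 :> R by rewrite divff // gt_eqF.
have e30 : 0 <= e3.
  by rewrite -(ler_pM2l k0) mulr0 e3E !(mulr_ge0, addr_ge0) ?exprn_ge0 // ltW.
have [i [j big]] : exists i j, (#|part f j|.+2 <= #|part f i|)%N.
  case: (pickP (fun p : 'I_r * 'I_r => #|part f p.2|.+2 <= #|part f p.1|)%N) => [[i j] h|h].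
    by exists i, j.
  case/eqP: nt; apply: turan_of_balanced => // i j.
  by have := h (i, j); rewrite /= => /negbT; rewrite -leqNgt.
set bd : R := #|arcs (bad f A)|%:R.
pose beta := 2 * (r%:R^-1 - r%:R^-1 ^+ 2 - eps) + e3.
have hbd : bd <= beta * N.
  have := close_bad_le; have := qN; rewrite -/bd /beta; lra.
have beta0 : 0 <= beta.
  by rewrite -(ler_pM2r N0) mul0r (le_trans _ hbd) // ler0n.
(* If every vertex of class [i] had two bad neighbours, there would be about [2 * N / r] bad arcs,
   more than [beta * N]. *)
have [v vi d1] : exists2 v, v \in part f i & (#|nbr (bad f A) v| <= 1)%N.
  case: (pickP (fun v => (v \in part f i) && (#|nbr (bad f A) v| <= 1)%N)) => [v /andP[h1 h2]|h].
    by exists v.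
  have : (2 * #|part f i| <= #|arcs (bad f A)|)%N.
    rewrite card_arcs mulnC -sum_nat_const [leqRHS](bigID (mem (part f i))) /=.
    apply: leq_trans (leq_addr _ _); apply: leq_sum => v vi.
    by have := h v; rewrite /= vi /= => /negbT; rewrite -ltnNge.
  rewrite -(ler_nat R) natrM -/bd => h1.
  have h2 := close_partN i.
  have : 0 < (2 * r%:R^-1 ^+ 2 - (e3 + 2 * e)) * N by rewrite mulr_gt0 // subr_gt0.
  have := mulr_gt0 eps0 N0; rewrite /beta in hbd; lra.
have bex : exists a b, bad f A a b.
  have : (0 < #|arcs (bad f A)|)%N.
    have h1 := arcs_balance f A; have h2 := turan_ge f.
    have h3 : (#|arcs (Kpart f)| < turan V r)%N by rewrite ltn_neqAle nt.
    by move: h1 h2 h3; rewrite arcsA; clear; lia.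
  by case/card_gt0P => -[a b]; rewrite inE => h; exists a, b.
have fv : f v = i by move: vi; rewrite inE => /eqP.
have jv : j != f v by rewrite fv; apply: contraTneq big => ->; rewrite -ltnNge ltnS leqnSn.
have big' : (#|part f j|.+2 <= #|part f (f v)|)%N by rewrite fv.
have [a [b [bab hS]]] := rebalance gA close_complete opt jv big' d1 bex.
have hc := close_edge_copies bab.
pose m := (\max_l #|part f l|).+1.
have hm l : (#|part (recolor f v j) l| <= m)%N.
  by apply: part_recolor => i'; apply: bigop.leq_bigmax.
have mN : m%:R <= (r%:R^-1 + 2 * e) * N.
  have h : (0 < #|'I_r|)%N by rewrite card_ord.
  have [l hl] := @bigop.eq_bigmax 'I_r (fun l => #|part f l|) h.
  rewrite /m hl -natr1; have := partN l; rewrite ler_norml => /andP[_].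
  have := eN; lra.
pose d := \max_u #|nbr (bad f A) u|.
have dN : d%:R <= e * N.
  have h : (0 < #|V|)%N by rewrite -(ltr0n R).
  by have [u hu] := @bigop.eq_bigmax V (fun u => #|nbr (bad f A) u|) h; rewrite /d hu.
have gM := graph_moved f gA v j.
have nb u : ~~ bad (recolor f v j) (moved f A v j) u v.
  by apply/negP => /bad_moved[_ _]; rewrite eqxx.
have sub x y : bad (recolor f v j) (moved f A v j) x y -> bad f A x y by case/bad_moved.
have hd u : (#|nbr (bad (recolor f v j) (moved f A v j)) u| <= d)%N.
  apply: leq_trans (bigop.leq_bigmax u).
  by apply/subset_leq_card/subsetP => w; rewrite !inE; apply: sub.
have := card_ocopies_vertex gM nb hm r2 hd.
set bd' := #|arcs _|; set S := [set t in ocopies r (moved f A v j) | _] in hS *.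
have hbd' : bd'%:R <= beta * N.
  apply: le_trans hbd; rewrite ler_nat; apply/subset_leq_card/subsetP => p.
  by rewrite !inE; apply: sub.
rewrite -(ler_nat R) natrM natrM natrX natrD natrM natrX natrM natrM natrX
  natrM natrM natrM natrD natrM natrM !natrX => h.
have {hS} hS : c * N ^+ r <= #|S|%:R by apply: le_trans hc _; rewrite ler_nat.
pose y : R := r%:R^-1 + 2 * e.
pose w : R := r%:R^-1 ^+ r.-1.
have w0 : 0 <= w by rewrite exprn_ge0.
have w1 : w <= 1 by rewrite exprn_ile1.
have y1 : y <= 1.
  have : r%:R^-1 <= 2^-1 :> R by rewrite lef_pV2 ?posrE // ler_nat.
  by have := E1; rewrite /y; lra.
have hy : y ^+ r.-1 <= w + 2 * r%:R * e.
  have e20 : 0 <= 2 * e by rewrite mulr_ge0 // ltW.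
  have := @expr_diff_le R r%:R^-1 y r.-1 rV0 _ y1.
  rewrite /y lerDl e20 => /(_ isT); rewrite -/w.
  have : r.-1%:R * e <= r%:R * e by rewrite ler_wpM2r ?(ltW e0) // ler_nat leq_pred.
  lra.
have X0 : 0 < N ^+ r by rewrite exprn_gt0.
have e31 : e3 <= 2.
  have : r%:R^-1 ^+ 2 <= 1 :> R by rewrite exprn_ile1.
  have := E5; have := e0; lra.
have beta4 : beta <= 4.
  have := sqr_ge0 (r%:R^-1 : R); have := eps0; rewrite /beta; lra.
have bound1 : bd'%:R * (r%:R * m%:R ^+ r.-1) <= (beta * N) * (r%:R * (y ^+ r.-1 * N ^+ r.-1)).
  apply: ler_pM => //; first by rewrite mulr_ge0 ?exprn_ge0.
  rewrite ler_wpM2l ?(ltW rr0) // -exprMn lerXn2r ?nnegrE //.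
  by rewrite mulr_ge0 ?(ltW N0) // addr_ge0 // mulr_ge0 // ltW.
have bound2 : bd'%:R * (N * d%:R + bd'%:R) <= 4 * N * (5 * e * N * N).
  have hb4 : beta * N <= 4 * N by rewrite ler_wpM2r // ltW.
  apply: ler_pM => //; first by rewrite addr_ge0 ?mulr_ge0.
    exact: le_trans hbd' hb4.
  have := ler_wpM2l (ltW N0) dN; have := ler_wpM2r (ltW N0) eN.
  lra.
(* Since [beta * r] is about [2 * (1 - r^-1 - r * eps)] and [c] about [(1 - r^-1) * w], this fails
   by about [2 * r * eps * w] for small [e]. *)
have key : 2 * c <= beta * r%:R * y ^+ r.-1 + 40 * e * r.+2%:R ^+ 2.
  have P0 : 0 < N ^+ r * N ^+ 5 by rewrite mulr_gt0 // exprn_gt0.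
  rewrite -(ler_pM2r P0).
  have N5 : 0 <= N ^+ 5 by rewrite exprn_ge0 // ltW.
  have t1 : 2 * c * (N ^+ r * N ^+ 5) <= 2 * N ^+ 5 * #|S|%:R.
    have := ler_wpM2l N5 hS; lra.
  apply: le_trans t1 _; apply: le_trans h _.
  have NrE : N ^+ r = N ^+ r.-1 * N by rewrite -exprSr prednK.
  have t2 := ler_wpM2l N5 bound1.
  have RN0 : 0 <= r.+2%:R ^+ 2 * N ^+ r.+2 by rewrite mulr_ge0 ?exprn_ge0 // ltW.
  have t3 := ler_wpM2r RN0 bound2.
  have t4 : N ^+ 5 * (beta * N * (r%:R * (y ^+ r.-1 * N ^+ r.-1))) =
     beta * r%:R * y ^+ r.-1 * (N ^+ r * N ^+ 5) by rewrite NrE; ring.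
  have t5 : 4 * N * (5 * e * N * N) * (r.+2%:R ^+ 2 * N ^+ r.+2) =
     20 * e * r.+2%:R ^+ 2 * (N ^+ r * N ^+ 5).
    by rewrite -[in N ^+ r.+2]addn2 exprD -[5%N]/(3 + 2)%N exprD; ring.
  rewrite t4 in t2; rewrite t5 in t3; lra.
have kE : kap R r = (1 - r%:R^-1) * w.
  have hr : r%:R ^+ r = r%:R ^+ r.-1 * r%:R :> R by rewrite -exprSr prednK.
  by rewrite /kap /w hr exprVn invfM mulrA mulrAC mulrBl mul1r rE.
have betaE : beta * r%:R = 2 * (1 - r%:R^-1 - r%:R * eps + r%:R * e3 / 2).
  have : r%:R^-1 ^+ 2 * r%:R = r%:R^-1 :> R by rewrite expr2 -mulrA mulVf ?mulr1 // gt_eqF.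
  move: rE; rewrite /beta; lra.
have key2 : beta * r%:R * y ^+ r.-1 <= 2 * ((1 - r%:R^-1 - r%:R * eps + r%:R * e3 / 2) * w + 2 * r%:R * e).
  have br0 : 0 <= beta * r%:R by rewrite mulr_ge0 // ltW.
  apply: le_trans (ler_wpM2l br0 hy) _.
  have b1 : beta * r%:R <= 2.
    rewrite betaE; have := mulr_gt0 rr0 eps0; have := E7; lra.
  have re0 : 0 <= 2 * r%:R * e by rewrite mulr_ge0 ?mulr_ge0 ?ltW.
  have := ler_wpM2r re0 b1; rewrite mulrDr betaE; lra.
have w3 : r%:R * e3 / 2 * w <= r%:R * e3 / 2.
  by rewrite ler_piMr // divr_ge0 // mulr_ge0 // ltW.
have sq0 : 0 <= e * r.+2%:R ^+ 2 by rewrite mulr_ge0 ?exprn_ge0 // ltW.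
move: key key2 w3 sq0 E6 kE; rewrite close_costE -/w; lra.
Qed.
End CloseStructure.

Lemma optimal_structure (R : archiRealFieldType) r (eps : R) : (2 <= r)%N -> 0 < eps ->
  exists Lam : R, forall (V : finType) (A : rel V) (q : nat), Lam <= #|V|%:R -> graph A ->
  optimal r A -> #|arcs A| = (turan V r + 2 * q)%N ->
  q%:R <= (r%:R^-1 - r%:R^-1 ^+ 2 - eps) * #|V|%:R :> R ->
  exists f : {ffun V -> 'I_r}, #|arcs (Kpart f)| = turan V r /\
    forall x y, f x != f y -> A x y.
Proof.
move=> r2 eps0.
have k0 := kap_gt0 R r2; have k1 := kap_le1 R r2.
have rr0 : 0 < r%:R :> R by rewrite ltr0n ltnW.
have rV0 : 0 < r%:R^-1 :> R by rewrite invr_gt0.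
pose k3 := (2 + 25 * r%:R + 10 * r%:R ^+ 2) / kap R r.
(* The list contains [E1] to [E7] with [e3 = k3 * e]. *)
have [e [e0 e1 he]] := @small_enough R [:: (5, r%:R^-1); (5 * r%:R + 2 * r%:R ^+ 2, kap R r / 2);
  (4, kap R r); (7 * r.+2%:R ^+ 2, kap R r / 2); (k3 + 2, 2 * r%:R^-1 ^+ 2);
  (r%:R * k3 / 2 + (2 * r%:R + 30 * r.+2%:R ^+ 2 + 5 * r%:R + 2 * r%:R ^+ 2),
     r%:R * eps * r%:R^-1 ^+ r.-1);
  (r%:R * k3 / 2, r%:R^-1)] ltac:(rewrite /= andbT; positivity).
move: he; rewrite /= andbT => /and5P[E1 E2 E3 E4 /and3P[E5 E6 E7]].
have [gam [eta [Lam1 [gam0 eta0 Htyp]]]] := typical_structure r2 e0 e1.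
have [Lam2 Hcut] := maxcut_exists r2 gam0.
pose eta' := Num.min eta e.
have eta'0 : 0 < eta' by rewrite lt_min eta0.
exists (Num.max 1 (Num.max Lam1 (Num.max Lam2 (Num.max e^-1 (Num.max (r%:R ^+ 2 + 1)
  (Num.max (r%:R + r%:R) ((3 * r%:R + 6) / eta'))))))).
move=> V A q; rewrite !ge_max => /and4P[N1 NL1 NL2 /and4P[Ne Nr N2r Neta]] gA opt hA hq.
set N : R := #|V|%:R in N1 NL1 NL2 Ne Nr N2r Neta hq *.
have N0 : 0 < N by apply: lt_le_trans N1.
have X0 : 0 < N ^+ r by rewrite exprn_gt0.
have hq' : q%:R <= (r%:R^-1 - r%:R^-1 ^+ 2) * N.
  by apply: le_trans hq _; rewrite ler_wpM2r ?(ltW N0) //; clear -eps0; lra.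
have qN : q%:R <= N.
  apply: le_trans hq' _; rewrite ler_piMl ?(ltW N0) //.
  have h1 : r%:R^-1 <= 1 :> R by rewrite invf_le1 // ler1n ltnW.
  have h2 : 0 <= r%:R^-1 ^+ 2 :> R by rewrite sqr_ge0.
  clear -h1 h2; lra.
have hA' : (#|arcs A| <= turan V r + 2 * q)%N by rewrite hA.
have rN : r%:R ^+ 2 < N by clear -Nr; lra.
have hc := optimal_upper r2 eta'0 opt hA' hq' rN N2r Neta.
have NX0 : 0 <= N * N ^+ r by rewrite mulr_ge0 ?ltW.
have hc_eta : #|ocopies r A|%:R <= kap R r * q%:R * N ^+ r + eta * (N * N ^+ r).
  by apply: le_trans hc _; rewrite lerD2l ler_wpM2r // ge_min lexx.
have hc_e : #|ocopies r A|%:R <= kap R r * q%:R * N ^+ r + e * (N * N ^+ r).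
  by apply: le_trans hc _; rewrite lerD2l ler_wpM2r // ge_min lexx orbT.
have hc_2 : #|ocopies r A|%:R <= 2 * (N * N ^+ r).
  apply: le_trans hc_e _.
  have h1 : kap R r * q%:R * N ^+ r <= 1 * (N * N ^+ r).
    rewrite -mulrA; apply: ler_pM => //; [exact: ltW | by rewrite mulr_ge0 // ltW |].
    by rewrite ler_wpM2r // ltW.
  have h2 := ler_wpM2r NX0 e1; clear -h1 h2; lra.
have arcs_ge : (1 - r%:R^-1) * N ^+ 2 - r%:R + 2 * q%:R <= #|arcs A|%:R.
  rewrite hA natrD natrM lerD2r; exact: turan_lb.
have arcs_ge' : (1 - r%:R^-1) * N ^+ 2 - r%:R <= #|arcs A|%:R.
  by apply: le_trans arcs_ge; rewrite lerDl mulr_ge0.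
have [f [mc hbad]] := Hcut V A NL2 gA arcs_ge' hc_2.
have [badN misN partN misA] := Htyp V f A q gA mc NL1 hbad arcs_ge qN hc_eta.
have eN : 1 <= e * N.
  by have := ler_wpM2l (ltW e0) Ne; rewrite mulrV ?unitf_gt0.
have e3E : kap R r * (k3 * e) = (2 + 25 * r%:R + 10 * r%:R ^+ 2) * e.
  by rewrite mulrA /k3 mulrCA divff ?mulr1 // gt_eqF.
have E5' : k3 * e + 2 * e < 2 * r%:R^-1 ^+ 2 by rewrite -mulrDl.
have E6' : r%:R * (k3 * e) / 2 + (2 * r%:R + 30 * r.+2%:R ^+ 2 + 5 * r%:R + 2 * r%:R ^+ 2) * e
  < r%:R * eps * r%:R^-1 ^+ r.-1.
  by apply: le_lt_trans E6; rewrite le_eqVlt; apply/orP; left; apply/eqP; field.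
have E7' : r%:R * (k3 * e) / 2 < r%:R^-1.
  by apply: le_lt_trans E7; rewrite le_eqVlt; apply/orP; left; apply/eqP; field.
exists f; split.
  exact: (close_balanced r2 gA opt eN N0 e0 badN misN partN misA hA hq hc_e eps0 E1 E2 E3 E4 E5' E6' E7' e3E).
move=> x y.
exact: (close_complete r2 gA opt eN N0 e0 badN misN partN misA hA hq hc_e eps0 E1 E2 E3 E4 E5' e3E).
Qed.

Local Close Scope ring_scope.

(** * Lower bound above a balanced partition *)

Section CompleteCross.
Variables (V : finType) (r : nat) (f : {ffun V -> 'I_r}) (A : rel V).
Hypothesis gA : graph A.
Hypothesis r2 : 2 <= r.
Hypothesis cross : forall x y, f x != f y -> A x y.
Local Notation n := #|V|.

(** Without missing pairs [card_fans] loses only the coincidences [y = g (f y)], one for each colour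
    other than that of the edge. *)
Lemma card_fans_complete p : p \in arcs (bad f A) ->
  others f (f p.1) * (n - #|part f (f p.1)|) <=
  #|fans f A (epart f A set0 p) (erest f A set0 p)| + r.-1 * others f (f p.1).
Proof.
move=> pB; set k := f p.1.
have pZ : p \in free_bad f A set0 by rewrite in_set !in_set0 !andbT.
have fp2 : f p.2 = k by move: pB; rewrite inE => /andP[_ /eqP].
have kk : epart f A set0 p k = [set p.1] by rewrite /epart eqxx.
have ne : forall l, l != k -> epart f A set0 p l = part f l.
  move=> l lk; rewrite /epart (negPf lk) setD0; apply/setP => u; rewrite !inE.
  have [fu|] //= := eqVneq (f u) l.
  by rewrite !cross // ?fp2 fu eq_sym.
have m0 : #|arcs (mis f A)| = 0.
  apply: eq_card0 => -[x y]; rewrite !inE /mis /=.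
  by case: (boolP (f x == f y)) => [_|/cross ->]; rewrite ?andbF.
have CK : #|~: [set k]| = r.-1 by rewrite cardsC1 card_ord.
have Eprod : \prod_l #|epart f A set0 p l| = others f k.
  rewrite (bigD1 k) //= kk cards1 mul1n /others; apply: eq_big => l; rewrite ?inE // => lk.
  by rewrite ne.
have Erest : #|erest f A set0 p| = n - #|part f k|.
  rewrite (_ : erest f A set0 p = ~: part f k); first by rewrite cardsCs setCK.
  apply/setP => u; rewrite /erest set0U in_setD !inE.
  have [//|fu] /= := eqVneq (f u) k.
  by rewrite !cross // ?fp2 eq_sym.
have := card_fans gA (fun l u => @epartP V r f A gA set0 p l u pZ) (Y := erest f A set0 p) (K := [set k]).
rewrite CK m0 muln0 mul0n addn0 Eprod Erest => H.
have n0 : 0 < n ^ 2 by rewrite expn_gt0; apply/orP; left; apply/card_gt0P; exists p.1.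
rewrite -(leq_pmul2l n0); apply: H.
- by move=> l /set1P ->; rewrite kk cards1.
- by move=> y; rewrite /erest set0U !inE => /andP[].
- move=> l l' u w /set1P -> kl; rewrite kk => /set1P -> ; rewrite ne; last by rewrite eq_sym.
  by rewrite inE => /eqP fw; apply: cross; rewrite fw.
- by move=> l u y /set1P ->; rewrite kk => /set1P -> ; rewrite !inE => /andP[_ /andP[]].
Qed.

Definition transversals := [set g : {ffun 'I_r -> V} | [forall l, f (g l) == l]].

Lemma transversalP (g : {ffun 'I_r -> V}) : reflect (forall l, f (g l) = l) (g \in transversals).
Proof. by rewrite inE; apply: (iffP forallP) => h l; apply/eqP; rewrite h. Qed.

Definition codeg (g : {ffun 'I_r -> V}) := #|cnbr A [set g l | l in setT]|.

(** For a bad arc [(u, z)] and a transversal through [u], the vertex [z] is a common neighbour of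
    the transversal: of [u] by the bad arc, of the others by [cross]. The colour of [z] gives back
    [u]. *)
Lemma sum_codeg :
  \sum_(p in arcs (bad f A)) #|family (slots f p.1)| <= \sum_(g in transversals) codeg g.
Proof.
pose L := [set s : (V * V) * {ffun 'I_r -> V} | (s.1 \in arcs (bad f A)) && (s.2 \in [set g : {ffun 'I_r -> V} in family (slots f s.1.1)])].
pose Rr := [set s : {ffun 'I_r -> V} * V | (s.1 \in transversals) && (s.2 \in cnbr A [set s.1 l | l in setT])].
have -> : \sum_(p in arcs (bad f A)) #|family (slots f p.1)| = #|L|.
  rewrite (card_pairs_in (arcs (bad f A)) (fun p => [set g : {ffun 'I_r -> V} in family (slots f p.1)])).
  by apply: eq_bigr => p _; apply: eq_card => g; rewrite in_set.
have -> : \sum_(g in transversals) codeg g = #|Rr|.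
  by rewrite (card_pairs_in transversals (fun g => cnbr A [set g l | l in setT])).
have slot (p : V * V) (g : {ffun 'I_r -> V}) : g \in family (slots f p.1) ->
    (forall l, f (g l) = l) /\ g (f p.1) = p.1.
  move/familyP=> h; split=> [l|].
    by move: (h l); rewrite /slots; case: eqP => [->|_]; rewrite inE => /eqP // ->.
  by move: (h (f p.1)); rewrite /slots eqxx inE => /eqP.
pose F (s : (V * V) * {ffun 'I_r -> V}) := (s.2, s.1.2).
have inj : {in L &, injective F}.
  move=> [[u z] g] [[u' z'] g']; rewrite !in_set /= => /andP[/andP[_ /eqP fz] hg] /andP[/andP[_ /eqP fz'] hg'] [e1 e2].
  have [_ h1] := slot (u, z) g hg; have [_ h2] := slot (u', z') g' hg'.
  by rewrite /= in h1 h2 fz fz'; subst g' z'; rewrite -h1 -h2 fz fz'.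
rewrite -(card_in_imset inj); apply/subset_leq_card/subsetP => _ /imsetP[[[u z] g] + ->].
rewrite !in_set /= => /andP[/andP[Auz /eqP fz] hg].
have [fg gu] := slot (u, z) g hg; rewrite /= in gu.
apply/andP; split; first by apply/forallP => l; rewrite fg.
apply/forall_inP => _ /imsetP[l _ ->].
have [->|lz] := eqVneq l (f u); first by rewrite gu.
by apply: cross; rewrite fg -fz.
Qed.

Lemma card_rainbow :
  \sum_(g in transversals) codeg g * (codeg g).-1 <= #|[set t in ocopies r A | rainbow f t.1]|.
Proof.
pose L := [set s : {ffun 'I_r -> V} * (V * V) | (s.1 \in transversals) &&
   (s.2 \in [set p | [&& p.1 \in cnbr A [set s.1 l | l in setT], p.2 \in cnbr A [set s.1 l | l in setT] & p.1 != p.2]])].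
have -> : \sum_(g in transversals) codeg g * (codeg g).-1 = #|L|.
  rewrite (card_pairs_in transversals (fun g => [set p | [&& p.1 \in cnbr A [set g l | l in setT],
    p.2 \in cnbr A [set g l | l in setT] & p.1 != p.2]])).
  by apply: eq_bigr => g _; rewrite card_offdiag.
pose F (s : {ffun 'I_r -> V} * (V * V)) := ([set s.1 l | l in setT], s.2).
have inj : {in L &, injective F}.
  move=> [g p] [g' p']; rewrite !in_set /= => /andP[/forallP hg _] /andP[/forallP hg' _] /eqP.
  rewrite /F xpair_eqE /= => /andP[/eqP e1 /eqP ->]; congr pair; apply/ffunP => l.
  have : g l \in [set g' l | l in setT] by rewrite -e1; apply: imset_f.
  case/imsetP => l' _ e2; rewrite e2; congr (g' _).
  by rewrite -(eqP (hg' l')) -e2 (eqP (hg l)).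
rewrite -(card_in_imset inj); apply/subset_leq_card/subsetP => _ /imsetP[[g [x y]] + ->].
rewrite in_set /= => /andP[/transversalP fg]; rewrite in_set /= => /and3P[/cnbrP hx /cnbrP hy xy].
apply/setIdP; split.
  apply/ocopiesP; split=> //.
    by rewrite card_imset ?cardsT ?card_ord //; apply: can_inj fg.
  move=> _ _ /imsetP[l _ ->] /imsetP[l' _ ->] ll; apply: cross; rewrite !fg.
  by apply: contraNneq ll => ->.
by apply/rainbowP => _ _ /imsetP[l _ ->] /imsetP[l' _ ->]; rewrite !fg => ->.
Qed.

Lemma card_transversals : #|transversals| = \prod_l #|part f l|.
Proof.
rewrite -card_family_prod; apply: eq_card => g; rewrite inE; apply/forallP/familyP => h l.
  by rewrite inE.
by move: (h l); rewrite inE.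
Qed.

(* For a transversal T the number d of its common neighbours satisfies d(d-1) >= 2(d-1), so the
   copies on transversals can be bounded through the mere sum of the d's. *)
Lemma balanced_lower q m : (forall l, #|part f l| = m) -> #|arcs (bad f A)| = 2 * q ->
  q * (m ^ r.-1 * (r.-1 * m.-1)) + 4 * q * m ^ r.-1 <= #|ocopies r A| + 2 * m ^ r.
Proof.
move=> pm cB.
have om k : others f k = m ^ r.-1.
  rewrite /others (eq_bigr (fun=> m)) // prod_nat_const cardsC1 card_ord //.
have nm : n = r * m by rewrite -(sum_part f) (eq_bigr (fun=> m)) // sum_nat_const card_ord.
have fb : free_bad f A set0 = arcs (bad f A).
  by apply/setP => p; rewrite in_set !in_set0 !andbT.
have H := lower_count f gA set0.
rewrite big_set0 muln0 add0n fb in H.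
have h1 : 2 * q * (m ^ r.-1 * (r.-1 * m.-1)) <=
    \sum_(p in arcs (bad f A)) #|fans f A (epart f A set0 p) (erest f A set0 p)|.
  rewrite -cB -sum_nat_const; apply: leq_sum => p pB.
  have := card_fans_complete pB; rewrite om pm nm.
  have -> : r * m - m = r.-1 * m by rewrite -{2}[m]mul1n -mulnBl subn1.
  case: m {om nm pm} => [|m] /=; first by rewrite !muln0.
  move=> h; rewrite -(leq_add2r (r.-1 * m.+1 ^ r.-1)); apply: leq_trans h.
  by rewrite mulnS [in leqRHS]mulnDr addnC [r.-1 * _ ^ _]mulnC.
have h2 : 4 * q * m ^ r.-1 <= #|[set t in ocopies r A | [disjoint verts t & set0] && rainbow f t.1]| + 2 * m ^ r.
  have -> : [set t in ocopies r A | [disjoint verts t & set0] && rainbow f t.1]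
      = [set t in ocopies r A | rainbow f t.1].
    by apply/setP => t; rewrite !in_set disjoint_sym disjoints_subset sub0set.
  apply: leq_trans (_ : 2 * \sum_(g in transversals) codeg g <= _).
    apply: leq_trans (_ : 2 * \sum_(p in arcs (bad f A)) #|family (slots f p.1)| <= _); last first.
      by rewrite leq_mul2l sum_codeg.
    rewrite (eq_bigr (fun=> m ^ r.-1)) ?sum_nat_const ?cB; last first.
      by move=> p _; rewrite (card_slots (k := f p.1)) // om.
    by rewrite !mulnA.
  (* For every natural [d] one has [2 * d <= d * (d - 1) + 2]; the constants sum to [2 * m ^ r] over
     the [m ^ r] transversals. *)
  apply: leq_trans (_ : \sum_(g in transversals) (codeg g * (codeg g).-1 + 2) <= _).
    rewrite big_distrr; apply: leq_sum => g _; move: (codeg g) => d; clear.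
    case: d => [|[|d]] //=; rewrite mulnS; lia.
  rewrite big_split /= sum_nat_const card_transversals leq_add ?card_rainbow //.
  by rewrite mulnC (eq_bigr (fun=> m)) // prod_nat_const card_ord leqnn.
move: H h1 h2; move: #|[set t in _ | _ && _]| (\sum_(p in _) _) (m ^ r) (m ^ r.-1) (r.-1 * m.-1).
by clear => S1 S2 X Y Z H h1 h2; lia.
Qed.

(** Outside the class of the edge there are at least [2 * r.-1] vertices, so one of them differs
    from the [r.-1] vertices of a transversal there. *)
Lemma bad_edge_copy a b : bad f A a b -> (forall l, 2 <= #|part f l|) -> 0 < #|ocopies r A|.
Proof.
move=> bab pl; have pB : (a, b) \in arcs (bad f A) by rewrite inE.
have o0 k : 0 < others f k.
  by rewrite /others prodn_cond_gt0 // => l _; apply: leq_trans (pl l).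
have := card_fans_complete pB => /=.
have hY : r.-1 < n - #|part f (f a)|.
  rewrite -(sum_part f) (bigD1 (f a)) //= addKn.
  apply: leq_trans (_ : \sum_(l | l != f a) 2 <= _); last by apply: leq_sum => l _.
  rewrite sum_nat_const (eq_card (_ : _ =i [set~ f a])); last by move=> l; rewrite !inE.
  by rewrite cardsC1 card_ord; clear -r2; lia.
move=> h; have : 0 < #|fans f A (epart f A set0 (a, b)) (erest f A set0 (a, b))|.
  rewrite lt0n; apply: contraTneq h => ->.
  by rewrite add0n -ltnNge mulnC ltn_mul2l o0.
case/card_gt0P => gy gyF; apply/card_gt0P; exists (fan f b gy).
have pZ : (a, b) \in free_bad f A set0 by rewrite in_set !in_set0 !andbT.
exact: (fan_ocopies gA (fun l u => @epartP V r f A gA set0 (a, b) l u pZ) (@erestP V r f A set0 (a, b)) gyF).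
Qed.
End CompleteCross.

Lemma ocopies_Kpart (V : finType) (r : nat) (f : V -> 'I_r) : #|ocopies r (Kpart f)| = 0.
Proof.
apply: eq_card0 => t; apply/negP => tc.
have [u [v [_ _]]] := ocopy_bad f (graph_Kpart f) tc.
by rewrite /bad /Kpart andNb.
Qed.

(** Divided by [m ^ (r - 2)], the left side minus the right side is [(m - 1) * ((r - 1) * m - r - q
    * r) + 6 * m - 4 * q - 4]. The surplus [4 * r] in [q * r] makes the first product at most
    [- 5 * r * (m - 1)], which outweighs [6 * m]. *)
Lemma unbalanced_arith (r m q : nat) : 2 <= r -> 2 <= m -> q * r = r.-1 * m + 4 * r -> q < m ->
  q.+1 * ((m.-1 * m ^ (r - 2)) * (r.-1 * m - r)) + 2 * ((2 * q.+1).+1 - m.+1) * (m.-1 * m ^ (r - 2))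
    + 2 * m ^ r < q * (m ^ r.-1 * (r.-1 * m.-1)) + 4 * q * m ^ r.-1.
Proof.
case: r => [|[|s]] // _; case: m => [|[|k]] // _ hq qm.
have -> : s.+2 - 2 = s by rewrite subSS subSS subn0.
rewrite /= !expnS; set X := _ ^ s; have X0 : 0 < X by rewrite expn_gt0.
have e1 : s.+1 * k.+2 - s.+2 = s * k.+1 + k by nia.
have e2 : (2 * q.+1).+1 - k.+3 = 2 * q - k by lia.
have h2q : k.+2 <= 2 * q by nia.
have [z ez] : exists z, 2 * q = k + z by exists (2 * q - k); lia.
rewrite e1 e2 ez addKn.
suff : q.+1 * (k.+1 * (s * k.+1 + k)) + 2 * z * k.+1 + 2 * (k.+2 * k.+2)
    < q * (k.+2 * (s.+1 * k.+1)) + 4 * q * k.+2.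
  by rewrite -(ltn_pmul2r X0); clear; lia.
clear -hq ez h2q qm; nia.
Qed.

(** * Relations and sets of edges *)

Section EdgeSets.
Variable n : nat.
Implicit Types (E : {set {set 'I_n}}) (A : rel 'I_n).

Definition adj E : rel 'I_n := fun u v => [set u; v] \in E.
Definition edges A : {set {set 'I_n}} := [set [set p.1; p.2] | p in arcs A].

Lemma set2_eq (u v x y : 'I_n) : [set u; v] = [set x; y] ->
  (u = x /\ v = y) \/ (u = y /\ v = x).
Proof.
move=> e; have := set21 u v; have := set22 u v; rewrite e !inE.
have := set21 x y; have := set22 x y; rewrite -e !inE.
by do 4![case/orP=> /eqP ?]; subst; auto.
Qed.

Lemma is_graph_card2 E e : is_graph E -> e \in E -> #|e| = 2.
Proof. by move=> /forall_inP h /h /eqP. Qed.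

Lemma graph_adj E : is_graph E -> graph (adj E).
Proof.
move=> gE; split=> [u v|u]; rewrite /adj; first by rewrite setUC.
by apply/negP => /(is_graph_card2 gE); rewrite setUid cards1.
Qed.

Lemma mem_edges A u v : symmetric A -> ([set u; v] \in edges A) = A u v.
Proof.
move=> symA; apply/imsetP/idP => [[[x y]]|Auv]; last by exists (u, v); rewrite ?inE.
by rewrite inE /= => Axy /set2_eq[] [-> ->]; rewrite // symA.
Qed.

Lemma is_graph_edges A : graph A -> is_graph (edges A).
Proof.
move=> [symA irrA]; apply/forall_inP => _ /imsetP[[x y] + ->]; rewrite inE /= => Axy.
have xy : x != y by apply: contraTneq Axy => ->; rewrite irrA.
by rewrite cards2 xy.
Qed.

Lemma card_arcs_edges A : graph A -> #|arcs A| = 2 * #|edges A|.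
Proof.
move=> gA; have [symA irrA] := gA.
rewrite -[LHS]sum1_card (partition_big_imset (fun p : 'I_n * 'I_n => [set p.1; p.2])) /=.
rewrite -/(edges A) mulnC -sum_nat_const; apply: eq_bigr => e /imsetP[[x y] + ->].
rewrite inE /= => Axy; have xy : x != y by apply: contraTneq Axy => ->; rewrite irrA.
rewrite -(_ : #|[set (x, y); (y, x)]| = 2); last by rewrite cards2 xpair_eqE (negPf xy).
rewrite sum1dep_card; apply: eq_card => -[u v]; rewrite !inE /= !xpair_eqE.
apply/andP/orP => [[_ /eqP/set2_eq[]]|[]].
- by case=> -> ->; left; rewrite !eqxx.
- by case=> -> ->; right; rewrite !eqxx.
- by case/andP=> /eqP -> /eqP ->.
- by case/andP=> /eqP -> /eqP ->; rewrite symA setUC.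
Qed.

Lemma card_arcs_adj E : is_graph E -> #|arcs (adj E)| = 2 * #|E|.
Proof.
move=> gE; rewrite (card_arcs_edges (graph_adj gE)); congr (2 * _); apply: eq_card => e.
apply/imsetP/idP => [[[x y]]|eE]; first by rewrite inE => h ->.
have /eqP/cards2P[x [y [xy eE2]]] := is_graph_card2 gE eE.
by exists (x, y); rewrite // inE /adj /= -eE2.
Qed.

Lemma ocopies_ext r A A' : A =2 A' -> ocopies r A = ocopies r A'.
Proof.
by move=> h; apply/eqP; rewrite eqEsubset !ocopies_sub // => x y; rewrite h.
Qed.

Lemma adj_edges A : symmetric A -> adj (edges A) =2 A.
Proof. by move=> symA u v; rewrite /adj mem_edges. Qed.
End EdgeSets.

Section Copies.
Variables (n r : nat) (E : {set {set 'I_n}}).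
Hypothesis gE : is_graph E.
Local Notation F := (K_minus_e r).
Let o0 : 'I_r.+2 := ord0.
Let o1 : 'I_r.+2 := Ordinal (isT : 1 < r.+2).

Lemma missing_edge : [set x : 'I_r.+2 | val x < 2] = [set o0; o1].
Proof. by apply/setP => -[[|[|i]] h]; rewrite !inE -!val_eqE. Qed.

Lemma image_K_minus_e (phi : {ffun 'I_r.+2 -> 'I_n}) : injective phi ->
  [set phi @: (e : {set 'I_r.+2}) | e in F] =
  [set e : {set 'I_n} | [&& e \subset phi @: setT, #|e| == 2 & e != [set phi o0; phi o1]]].
Proof.
move=> inj; have im2 i j : phi @: [set i; j] = [set phi i; phi j].
  by rewrite imsetU !imset_set1.
apply/setP => e; apply/imsetP/idP.
  case=> e'; rewrite inE missing_edge => /andP[c2 ne] ->; rewrite inE imsetS ?subsetT //=.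
  by rewrite card_imset // c2 -im2 (inj_eq (imset_inj inj)).
rewrite inE => /and3P[sub /cards2P[u [v [uv ee]]] ne]; subst e.
move: sub; rewrite subUset !sub1set => /andP[/imsetP[i _ ui] /imsetP[j _ vj]]; subst u v.
exists [set i; j]; last by rewrite im2.
have ij : i != j by apply: contraNneq uv => ->.
by rewrite inE missing_edge -(inj_eq (imset_inj inj)) !im2 ne andbT cards2 ij.
Qed.

Definition copy_of (t : {set 'I_n} * ('I_n * 'I_n)) : {set 'I_n} * {set {set 'I_n}} :=
  (verts t, [set e : {set 'I_n} | [&& e \subset verts t, #|e| == 2 & e != [set t.2.1; t.2.2]]]).

Lemma copy_of_copies t : t \in ocopies r (adj E) -> copy_of t \in copies F E.
Proof.
case: t => T [x y] tc; have gA := graph_adj gE.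
have [xT yT] := ocopy_notin gA tc; have [cT _ _ _ xy] := ocopiesP _ _ _ _ _ tc.
pose s := x :: y :: enum T.
have us : uniq s.
  by rewrite /= !inE negb_or xy !mem_enum xT yT enum_uniq.
have ss : size s = r.+2 by rewrite /= -cardE cT.
pose phi : {ffun 'I_r.+2 -> 'I_n} := [ffun i => nth x s (val i)].
have inj : injective phi.
  move=> i j; rewrite !ffunE => /eqP; rewrite nth_uniq ?ss ?ltn_ord // => /eqP; exact: val_inj.
have im : phi @: setT = verts (T, (x, y)).
  apply/setP => u; apply/imsetP/idP => [[i _ ->]|].
    have : phi i \in s by rewrite ffunE; apply: mem_nth; rewrite ss ltn_ord.
    by rewrite !inE mem_enum.
  rewrite !inE /= => h; have us' : u \in s by rewrite !inE mem_enum.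
  have hi : index u s < r.+2 by rewrite -ss index_mem.
  by exists (Ordinal hi); rewrite ?inE // ffunE /= nth_index.
rewrite inE; apply/existsP; exists phi; apply/and4P; split.
- exact/injectiveP.
- by rewrite im.
- by rewrite (image_K_minus_e inj) im !ffunE.
- apply/subsetP => e; rewrite inE => /and3P[sub /cards2P[u [v [uv ee]]] ne]; subst e.
  move: sub; rewrite subUset !sub1set => /andP[uQ vQ].
  apply: (ocopy_adj gA tc uQ vQ uv); apply: contraNneq ne => -[-> ->] //=.
  by rewrite setUC.
Qed.

Lemma copies_copy_of US : US \in copies F E -> exists2 t, t \in ocopies r (adj E) & copy_of t = US.
Proof.
case: US => U S; rewrite inE => /existsP[phi /and4P[/= /injectiveP inj /eqP UE /eqP SE sub]].
rewrite (image_K_minus_e inj) in SE.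
pose T := phi @: [set i : 'I_r.+2 | 2 <= val i].
have vE : verts (T, (phi o0, phi o1)) = phi @: setT.
  rewrite /verts /= -!(imset_set1 phi) -!imsetU.
  suff -> : o0 |: (o1 |: [set i : 'I_r.+2 | 2 <= val i]) = setT by [].
  apply/setP => -[[|[|i]] h].
  - by rewrite !inE -!val_eqE.
  - by rewrite !inE -!val_eqE.
  - by rewrite !inE -!val_eqE.
have adjP i j : i != j -> [set i; j] != [set o0; o1] -> adj E (phi i) (phi j).
  move=> ij ne; apply: (subsetP sub); rewrite SE inE; apply/and3P; split.
  - by rewrite subUset !sub1set !imset_f.
  - by rewrite cards2 (inj_eq inj) ij.
  - by rewrite -!(imset_set1 phi) -!imsetU (inj_eq (imset_inj inj)).
have ne2 (i j : 'I_r.+2) : 2 <= val i -> [set i; j] != [set o0; o1].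
  move=> i2; apply/eqP => /setP/(_ i); rewrite !inE eqxx /= -!val_eqE /=.
  by case: i i2 => -[|[|k]] ki.
exists (T, (phi o0, phi o1)); last by rewrite /copy_of vE SE /= UE.
apply/ocopiesP; split.
- rewrite card_imset //; apply: (@addnI 2).
  have := cardsC [set i : 'I_r.+2 | val i < 2]; rewrite missing_edge cards2 card_ord -missing_edge.
  have -> : ~: [set x : 'I_r.+2 | val x < 2] = [set i : 'I_r.+2 | 2 <= val i].
    by apply/setP => i; rewrite !inE -leqNgt.
  by [].
- move=> _ _ /imsetP[i + ->] /imsetP[j _ ->]; rewrite inE => i2 ij.
  by apply: adjP; [rewrite -(inj_eq inj) | apply: ne2].
- move=> _ /imsetP[i + ->]; rewrite inE => i2; apply: adjP; last exact: ne2.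
  by apply: contraTneq i2 => ->.
- move=> _ /imsetP[i + ->]; rewrite inE => i2; apply: adjP; last exact: ne2.
  by apply: contraTneq i2 => ->.
- by rewrite (inj_eq inj).
Qed.

Lemma copy_of_eq T x y T' x' y' : (T, (x, y)) \in ocopies r (adj E) ->
  (T', (x', y')) \in ocopies r (adj E) -> copy_of (T, (x, y)) = copy_of (T', (x', y')) ->
  T = T' /\ ((x = x' /\ y = y') \/ (x = y' /\ y = x')).
Proof.
move=> tc tc' /eqP; rewrite /copy_of xpair_eqE /= => /andP[/eqP ev /eqP es].
have gA := graph_adj gE.
have [xT yT] := ocopy_notin gA tc; have [xT' yT'] := ocopy_notin gA tc'.
have [_ _ _ _ xy] := ocopiesP _ _ _ _ _ tc.
have e2 : [set x; y] = [set x'; y'].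
  apply/eqP; apply/negPn/negP => ne; move/setP/(_ [set x; y]): es.
  rewrite !inE -ev eqxx /= !andbF ne cards2 xy /= andbT.
  by rewrite subUset !sub1set !inE /= !eqxx !orbT.
split; last exact: set2_eq.
have vD (Z : {set 'I_n}) z w : z \notin Z -> w \notin Z -> Z = verts (Z, (z, w)) :\: [set z; w].
  move=> zZ wZ; apply/setP => u; rewrite !inE /=.
  have [->|_] := eqVneq u z; first by rewrite (negPf zZ).
  by have [->|//] := eqVneq u w; rewrite (negPf wZ).
by rewrite (vD T x y) // (vD T' x' y') // ev e2.
Qed.

(** A copy determines its vertex set, and the removed pair as the only pair of vertices that is not
    one of its edges. Only the order of that pair is lost. *)
Lemma card_ocopies_adj : #|ocopies r (adj E)| = 2 * ncopies F E.
Proof.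
have gA := graph_adj gE.
rewrite -[LHS]sum1_card (partition_big copy_of (mem (copies F E))) /=; last exact: copy_of_copies.
rewrite /ncopies mulnC -sum_nat_const; apply: eq_bigr => US /copies_copy_of[[T [x y]] tc <-].
have xy : x != y by case/ocopiesP: tc.
rewrite -(_ : #|[set (T, (x, y)); (T, (y, x))]| = 2); last first.
  by rewrite cards2 !xpair_eqE eqxx (negPf xy).
rewrite sum1dep_card; apply: eq_card => -[T' [x' y']]; rewrite in_set in_set2.
apply/andP/orP => [[tc' /eqP ec]|].
  by have [-> [[-> ->]|[-> ->]]] := copy_of_eq tc' tc ec; [left|right]; rewrite eqxx.
case=> /eqP[-> -> ->]; split=> //; first exact: ocopies_swap.
by rewrite /copy_of verts_swap /= setUC.
Qed.
End Copies.

Lemma leq_bigmin (I : finType) (P : pred I) (F : I -> nat) d x : x <= d ->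
  (forall i, P i -> x <= F i) -> x <= \big[minn/d]_(i | P i) F i.
Proof. by move=> xd xF; elim/big_ind: _ => // a b xa xb; rewrite leq_min xa. Qed.

Lemma bigmin_leq (I : finType) (P : pred I) (F : I -> nat) d i : P i ->
  \big[minn/d]_(j | P j) F j <= F i.
Proof.
move=> Pi; have: i \in index_enum I by rewrite mem_index_enum.
elim: (index_enum I) => // j s IH; rewrite inE big_cons => /predU1P[<-|/IH h].
  by rewrite Pi geq_minl.
by case: ifP => // _; rewrite geq_min h orbT.
Qed.

(** The interface between the asymptotic analysis and the exact functions: the values of [exF], [hF]
    and [tF] are compared through this property alone at a fixed [n]. *)
Definition rigid r n q := forall A : rel 'I_n, graph A -> optimal r A ->
  #|arcs A| = turan 'I_n r + 2 * q ->
  exists f : {ffun 'I_n -> 'I_r}, #|arcs (Kpart f)| = turan 'I_n r /\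
    forall x y, f x != f y -> A x y.

Lemma part_ge2 (V : finType) r (f : {ffun V -> 'I_r}) : 2 * r <= #|V| ->
  #|arcs (Kpart f)| = turan V r -> forall l, 2 <= #|part f l|.
Proof.
move=> nV ft l; have r0 : 0 < r := leq_ltn_trans (leq0n l) (ltn_ord l).
rewrite leqNgt; apply/negP => hl; have bal := turan_balanced ft.
move: nV; rewrite leqNgt -(sum_part f) (bigD1 l) //= => /negP; apply.
apply: leq_ltn_trans (_ : #|part f l| + \sum_(i | i != l) 2 < _).
  rewrite leq_add2l; apply: leq_sum => i _; apply: leq_trans (bal i l) _; exact: hl.
rewrite sum_nat_const (eq_card (_ : _ =i [set~ l])); last by move=> i; rewrite !inE.
rewrite cardsC1 card_ord; clear -hl r0; lia.
Qed.

(** * The extremal functions *)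

Section Extremal.
Variables n r : nat.
Hypothesis r2 : 2 <= r.
Local Notation F := (K_minus_e r).
Local Notation tu := (turan 'I_n r).
Implicit Types (E : {set {set 'I_n}}).

Lemma ncopies_free E : is_graph E -> (ncopies F E == 0) = (#|ocopies r (adj E)| == 0).
Proof. by move=> gE; rewrite card_ocopies_adj // muln_eq0. Qed.

Lemma ncopies_edges (A : rel 'I_n) : graph A -> 2 * ncopies F (edges A) = #|ocopies r A|.
Proof.
move=> gA; rewrite -card_ocopies_adj ?is_graph_edges //.
by rewrite (ocopies_ext r (adj_edges (proj1 gA))).
Qed.

Lemma free_optimal (A : rel 'I_n) : #|ocopies r A| = 0 -> optimal r A.
Proof. by move=> h A' _ _; rewrite h. Qed.

Lemma edges_Kpart_free (f : 'I_n -> 'I_r) : ncopies F (edges (Kpart f)) == 0.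
Proof.
by have := ncopies_edges (graph_Kpart f); rewrite ocopies_Kpart => /eqP; rewrite muln_eq0.
Qed.

Lemma card_bad_cross (f : 'I_n -> 'I_r) (A : rel 'I_n) : (forall x y, f x != f y -> A x y) ->
  #|arcs A| = #|arcs (bad f A)| + #|arcs (Kpart f)|.
Proof.
move=> cross; rewrite -arcs_balance -[LHS]addn0; congr (_ + _); apply/esym/eq_card0 => -[x y].
by rewrite !inE /mis /=; case: (boolP (f x == f y)) => [_|/cross ->]; rewrite ?andbF.
Qed.

Hypothesis n2r : 2 * r <= n.
Hypothesis rigid1 : rigid r n 1.

(** A graph without copies is trivially optimal. With one edge more than a Turan graph it would, by
    [rigid1], contain a Turan graph and a bad edge, hence a copy. *)
Lemma exF_turan : 2 * exF F n = tu.
Proof.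
have [f ft] := turan_attained 'I_n (ltnW r2); have gK := graph_Kpart f.
have ef : 2 * #|edges (Kpart f)| = tu by rewrite -card_arcs_edges.
apply/eqP; rewrite eqn_leq -{2}ef !leq_pmul2l // andbC.
rewrite (bigop.leq_bigmax_cond (edges (Kpart f))) ?is_graph_edges ?edges_Kpart_free //=.
rewrite -ef leq_pmul2l //; apply/bigmax_leqP => E /andP[gE free].
rewrite leqNgt; apply/negP => lt; rewrite ncopies_free // in free.
have [|A [gA sA cA]] := @exact_subgraph _ (adj E) #|edges (Kpart f)|.+1 (graph_adj gE).
  by rewrite card_arcs_adj // leq_pmul2l.
have A0 : #|ocopies r A| = 0.
  by apply/eqP; rewrite -leqn0 -(eqP free) subset_leq_card // ocopies_sub.
have [|f' [ft' cross]] := rigid1 gA (free_optimal A0); first by rewrite cA mulnS ef addnC.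
have := card_bad_cross cross; rewrite cA ft' mulnS ef => /addIn/esym c2.
have /card_gt0P[[a b]] : 0 < #|arcs (bad f' A)| by rewrite c2.
rewrite inE /= => /(bad_edge_copy gA r2 cross); rewrite A0 ltnn => h.
by have := h (part_ge2 _ ft'); rewrite card_ord => /(_ n2r).
Qed.

Lemma exF_Kpart (f : {ffun 'I_n -> 'I_r}) : #|arcs (Kpart f)| = tu ->
  #|edges (Kpart f)| = exF F n.
Proof.
move=> ft; apply/eqP; rewrite -(eqn_pmul2l (m := 2)) // exF_turan -card_arcs_edges ?ft //.
exact: graph_Kpart.
Qed.

Lemma edges_Kpart_sub (f : {ffun 'I_n -> 'I_r}) E :
  (forall x y, f x != f y -> adj E x y) -> edges (Kpart f) \subset E.
Proof. by move=> cross; apply/subsetP => _ /imsetP[[x y] + ->]; rewrite inE => /cross. Qed.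

Lemma hF_le E q : is_graph E -> #|E| = exF F n + q -> hF F n q <= ncopies F E.
Proof. by move=> gE cE; rewrite /hF bigmin_leq // gE cE eqxx. Qed.

(** A minimiser for [hF] is optimal, so rigidity makes it contain a Turan graph, which is a maximum
    graph without copies; it therefore competes in [tF] as well. *)
Lemma hF_eq_tF q : rigid r n q -> hF F n q = tF F n q.
Proof.
move=> rigidq; apply/eqP; rewrite eqn_leq; apply/andP; split.
  have hd : hF F n q <= ncopies F (complete_graph n).
    by rewrite /hF; elim/big_rec: _ => // E x _ h; rewrite geq_min h orbT.
  apply: leq_bigmin => // E0 /and3P[g0 _ /eqP c0]; apply: leq_bigmin => // E /and3P[gE _ /eqP cE].
  by apply: hF_le; rewrite // cE c0.
(* If no graph has that many edges, [hF] takes its default value, which bounds [tF] from above. *)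
rewrite /hF; case: (pickP (fun E => is_graph E && (#|E| == exF F n + q))) => [E1 PE1|none]; last first.
  rewrite big_pred0 //; rewrite /tF.
  by elim/big_rec: _ => // E x _ h; rewrite geq_min h orbT.
apply: leq_bigmin.
  by rewrite /tF; elim/big_rec: _ => // E x _ h; rewrite geq_min h orbT.
have [E /andP[gE /eqP cE] Emin] := @arg_minnP _ E1
  (fun E => is_graph E && (#|E| == exF F n + q)) (ncopies F) PE1.
move=> E' /Emin; apply: leq_trans.
have cA : #|arcs (adj E)| = tu + 2 * q by rewrite card_arcs_adj // cE mulnDr exF_turan.
have opt : optimal r (adj E).
  apply: optimal_eq (graph_adj gE) _ => A' gA' cA'.
  rewrite card_ocopies_adj // -ncopies_edges // leq_pmul2l //.
  apply: Emin; rewrite is_graph_edges //= -(eqn_pmul2l (m := 2)) // -card_arcs_edges //.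
  by rewrite cA' cA mulnDr exF_turan.
have [f [ft cross]] := rigidq _ (graph_adj gE) opt cA.
rewrite /tF; apply: leq_trans (@bigmin_leq _ _ _ _ (edges (Kpart f)) _) _.
  by rewrite is_graph_edges ?edges_Kpart_free ?exF_Kpart //=; apply: graph_Kpart.
apply: bigmin_leq; rewrite gE edges_Kpart_sub //=.
by rewrite exF_Kpart // cE.
Qed.

Lemma qF_ge q : q <= 'C(n, 2) - exF F n -> (forall q', q' <= q -> rigid r n q') ->
  q <= qF F n.
Proof.
move=> qC hq; rewrite /qF -ltnS in qC *.
rewrite (bigop.leq_bigmax_cond (Ordinal qC)) //=.
by apply/forallP => q'; apply/eqP/hF_eq_tF/hq; rewrite -ltnS.
Qed.

Lemma qF_le q : hF F n q < tF F n q -> qF F n <= q.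
Proof.
move=> lt; apply/bigmax_leqP => -[q' hq'] /= /forallP h; rewrite leqNgt; apply/negP => qq.
have qq' : q < q'.+1 by apply: ltnW.
by have := h (Ordinal qq'); rewrite /= ltn_eqF.
Qed.
End Extremal.

Lemma equal_parts (V : finType) r m (f : {ffun V -> 'I_r}) : #|V| = r * m ->
  #|arcs (Kpart f)| = turan V r -> forall l, #|part f l| = m.
Proof.
move=> nV ft l; have bal := turan_balanced ft; have := sum_part f.
rewrite nV; have -> : r * m = \sum_(i < r) m by rewrite sum_nat_const card_ord.
rewrite (bigD1 l) //= [RHS](bigD1 l) //= => e.
have [lt|lt|//] := ltngtP #|part f l| m.
- have h : \sum_(i | i != l) #|part f i| <= \sum_(i < r | i != l) m.
    by apply: leq_sum => i _; apply: leq_trans (bal i l) lt.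
  by have := leq_add lt h; rewrite addSn e ltnn.
- have h : \sum_(i < r | i != l) m <= \sum_(i | i != l) #|part f i|.
    by apply: leq_sum => i _; rewrite -ltnS; apply: leq_trans lt (bal l i).
  by have := leq_add lt h; rewrite addSn e ltnn.
Qed.

(** * The partition with classes m + 1, m - 1, m, ..., m *)

Section Unbalanced.
Variables (V : finType) (r m : nat) (f : {ffun V -> 'I_r}) (v : V) (k : 'I_r).
Hypothesis pm : forall l, #|part f l| = m.
Hypothesis vk : f v != k.
Local Notation f' := (recolor f v k).

Lemma card_part_target : #|part f' k| = m.+1.
Proof.
rewrite (_ : part f' k = v |: part f k); first by rewrite cardsU1 pm inE vk.
by apply/setP => u; rewrite !inE ffunE; have [_|_] := eqVneq u v; rewrite ?eqxx.
Qed.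

Lemma card_part_source : #|part f' (f v)|.+1 = m.
Proof.
rewrite -(pm (f v)) (cardsD1 v (part f (f v))) inE eqxx add1n; congr _.+1.
apply: eq_card => u; rewrite !inE ffunE.
by have [_|] //= := eqVneq u v; rewrite eq_sym (negPf vk).
Qed.

Lemma card_part_other l : l != k -> l != f v -> #|part f' l| = m.
Proof.
move=> lk lv; rewrite -(pm l); apply: eq_card => u; rewrite !inE ffunE.
by have [->|] //= := eqVneq u v; rewrite eq_sym (negPf lk) eq_sym (negPf lv).
Qed.

Lemma others_unbalanced : others f' k = m.-1 * m ^ (r - 2).
Proof.
rewrite /others (bigD1 (f v)) ?inE //= -card_part_source /=; congr (_ * _).
rewrite (eq_bigl (mem (~: [set k; f v]))) => [|l]; last by rewrite !inE negb_or.
rewrite (eq_bigr (fun=> m)) => [|l]; last first.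
  by rewrite !inE negb_or => /andP[lk lv]; apply: card_part_other.
rewrite card_part_source prod_nat_const; congr (m ^ _).
by have := cardsC [set k; f v]; rewrite cards2 eq_sym vk card_ord => h; rewrite -[in RHS]h addKn.
Qed.

(** Since [(m + 1) ^ 2 + (m - 1) ^ 2 = 2 * m ^ 2 + 2], the shift loses one edge. *)
Lemma arcs_unbalanced : #|arcs (Kpart f')| + 2 = #|arcs (Kpart f)|.
Proof.
have h' := card_arcs_Kpart f'; have h := card_arcs_Kpart f.
rewrite (bigD1 k) //= (bigD1 (f v)) //= card_part_target in h'.
rewrite (bigD1 k) //= (bigD1 (f v)) //= !pm in h.
have hm := card_part_source.
rewrite (eq_bigr (fun i => #|part f i| ^ 2)) in h'; last first.
  by move=> i /andP[ik iv]; rewrite card_part_other // pm.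
move: (\sum_(i | _) _) (#|V| ^ 2) #|part f' _| h h' hm => S N a h h' hm.
rewrite -hm -!mulnn in h h'; move: #|arcs _| #|arcs _| h h' => A A'; clear; lia.
Qed.
End Unbalanced.

Section UpperBound.
Variables r m q : nat.
(** [q] exceeds the threshold [(r - 1) * m / r] by 4. The condition [q < m] lets a forest of [q + 1]
    edges fit into a class of [m + 1] vertices. *)
Hypotheses (r2 : 2 <= r) (m2 : 2 <= m) (qm : q < m) (qr : q * r = r.-1 * m + 4 * r).
Local Notation n := (r * m).
Local Notation F := (K_minus_e r).
Hypotheses (rigid0 : rigid r n 0) (rigid1 : rigid r n 1).

Let n2r : 2 * r <= n. Proof. by rewrite mulnC leq_mul2l m2 orbT. Qed.

(** Stated for [exF F n + q] edges or more, because it is also applied to the complete graph, the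
    default value in [tF]. *)
Lemma dense_lower (f : {ffun 'I_n -> 'I_r}) E : is_graph E -> #|arcs (Kpart f)| = turan 'I_n r ->
  (forall x y, f x != f y -> adj E x y) -> exF F n + q <= #|E| ->
  q * (m ^ r.-1 * (r.-1 * m.-1)) + 4 * q * m ^ r.-1 <= 2 * ncopies F E + 2 * m ^ r.
Proof.
move=> gE ft cross cE; have gA := graph_adj gE.
have pm := equal_parts (card_ord _) ft.
have [Q cB] := even_arcs (graph_bad gA f).
have := card_bad_cross cross; rewrite card_arcs_adj // cB ft -(exF_turan r2 n2r rigid1) => e.
have qQ : q <= Q by clear -e cE; lia.
rewrite -card_ocopies_adj //; apply: leq_trans (balanced_lower gA cross pm cB).
by rewrite leq_add // leq_mul // leq_mul.
Qed.

(* The classes have sizes m + 1, m - 1, m, ..., m, so that q + 1 edges in the first one are needed. *)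
Lemma hF_upper : 2 * hF F n q <=
  q.+1 * ((m.-1 * m ^ (r - 2)) * (r.-1 * m - r)) +
  2 * ((2 * q.+1).+1 - m.+1) * (m.-1 * m ^ (r - 2)).
Proof.
have [f ft] := turan_attained 'I_n (ltnW r2).
have pm := equal_parts (card_ord _) ft.
pose l0 : 'I_r := Ordinal (ltnW r2); pose k : 'I_r := Ordinal r2.
have /card_gt0P[v] : 0 < #|part f l0| by rewrite pm ltnW.
rewrite inE => /eqP fv; have vk : f v != k by rewrite fv.
have [|B [gB Bk triB cB sB]] := @exists_forest _ (part (recolor f v k) k) q.+1.
  by rewrite (card_part_target pm).
have Bk' x y : B x y -> recolor f v k x = k by move/Bk; rewrite inE => /eqP.
rewrite (card_part_target pm) // in sB.
have gA := graph_augment (recolor f v k) gB.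
have cA := arcs_augment gB Bk'.
have au := arcs_unbalanced pm vk.
have cE : #|edges (augment (recolor f v k) B)| = exF F n + q.
  apply/eqP; rewrite -(eqn_pmul2l (m := 2)) // -card_arcs_edges // cA cB mulnDr exF_turan //.
  by rewrite -ft -au mulnS addnA.
have hle := hF_le (is_graph_edges gA) cE.
apply: leq_trans (_ : #|ocopies r (augment (recolor f v k) B)| <= _).
  by rewrite -ncopies_edges // leq_mul2l.
have := card_ocopies_augment gB Bk' triB.
rewrite cB (others_unbalanced pm vk) (card_part_target pm vk) card_ord.
have -> : n - m.+1 - r.-1 = r.-1 * m - r.
  by case: (r) r2 => // s _ /=; rewrite mulSn; clear; lia.
rewrite -(mulnA 2 q.+1) -mulnDr leq_mul2l /= => /leq_trans; apply.
by rewrite leq_add2l leq_mul2r sB orbT.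
Qed.

(** By rigidity at 0 every maximum graph without copies contains a Turan graph, so [dense_lower]
    covers all competitors in [tF]. *)
Lemma qF_upper : qF F n <= q.
Proof.
apply: qF_le; rewrite -[X in X <= _]/(hF F n q).+1.
have low t : q * (m ^ r.-1 * (r.-1 * m.-1)) + 4 * q * m ^ r.-1 <= 2 * t + 2 * m ^ r -> hF F n q < t.
  have := unbalanced_arith r2 m2 qr qm; have := hF_upper; clear; lia.
have [f0 ft0] := turan_attained 'I_n (ltnW r2).
have gC : is_graph (complete_graph n) by apply/forall_inP => e; rewrite inE.
have lowC : hF F n q < ncopies F (complete_graph n).
  apply/low/(dense_lower gC ft0).
    by move=> x y fxy; rewrite /adj inE cards2 (_ : x != y) //; apply: contraNneq fxy => ->.
  have := exF_turan r2 n2r rigid1; rewrite -ft0.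
  have := card_arcs_Kpart f0; rewrite card_ord (eq_bigr (fun=> m ^ 2)); last first.
    by move=> l _; rewrite (equal_parts (card_ord _) ft0).
  rewrite sum_nat_const card_ord.
  have -> : #|complete_graph n| = 'C(n, 2) by rewrite -[in RHS](card_ord n) -card_draws.
  have := mul_bin_diag n 1; rewrite bin1.
  clear -r2 m2 qm; move: 'C(n, 2) (exF F n) #|_| => C X A; nia.
apply: leq_bigmin => // E0 /and3P[g0 free /eqP c0]; apply: leq_bigmin => // E /and3P[gE sub /eqP cE].
rewrite ncopies_free // in free.
have [|f [ft cross]] := rigid0 (graph_adj g0) (free_optimal (eqP free)).
  by rewrite card_arcs_adj // c0 (exF_turan r2 n2r rigid1) addn0.
apply/low/(dense_lower gE ft); last by rewrite cE c0.
by move=> x y /cross; apply: (subsetP sub).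
Qed.
End UpperBound.

Local Open Scope ring_scope.

(** * From large n to bounds on q_F(n)/n *)

Section Asymptotics.
Variables (R : archiRealFieldType) (r : nat).
Hypothesis r2 : (2 <= r)%N.
Local Notation F := (K_minus_e r).
Local Notation c1 := (r%:R^-1 - r%:R^-1 ^+ 2 : R).

Lemma c1_gt0 : 0 < c1.
Proof.
have r0 : 0 < r%:R :> R by rewrite ltr0n ltnW.
rewrite expr2 -{1}[r%:R^-1]mulr1 -mulrBr mulr_gt0 ?invr_gt0 // subr_gt0.
by rewrite invf_lt1 // ltr1n.
Qed.

Lemma nat_above (x : R) : exists N : nat, forall n, (N <= n)%N -> x <= n%:R.
Proof.
exists (Num.bound `|x|) => n Nn; apply: le_trans (ler_norm x) _.
by apply: le_trans (ltW (archi_boundP (normr_ge0 x))) _; rewrite ler_nat.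
Qed.

Lemma rigid_large (eps : R) : 0 < eps -> exists N, forall n, (N <= n)%N ->
  forall q, q%:R <= (c1 - eps) * n%:R -> rigid r n q.
Proof.
move=> eps0; have [Lam HL] := optimal_structure r2 eps0; have [N hN] := nat_above Lam.
exists N => n Nn q hq A gA opt cA; apply: HL opt cA _ => //; rewrite card_ord //.
exact: hN.
Qed.

Lemma rigid_small : exists N, forall n, (N <= n)%N -> rigid r n 0 /\ rigid r n 1.
Proof.
have c0 := c1_gt0; have e0 : 0 < c1 / 2 by rewrite divr_gt0.
have [N1 h1] := rigid_large e0; have [N2 h2] := nat_above ((c1 / 2)^-1).
have c2 : c1 - c1 / 2 = c1 / 2 by field; rewrite pnatr_eq0 -lt0n ltnW.
exists (maxn N1 N2) => n; rewrite geq_max => /andP[n1 n2].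
have hn := h2 n n2; split; apply: h1 => //; rewrite c2.
  exact: mulr_ge0 (ltW e0) (ler0n _ _).
by rewrite mulrC -ler_pdivrMr // mul1r.
Qed.

(** At most [(1 - 1/r) * n ^ 2 / 2] pairs are used, which leaves [n ^ 2 / (2 * r) - n / 2], at least
    [n] when [n >= 3 * r]. *)
Lemma room_for_edges n q : (2 * r <= n)%N -> (3 * r <= n)%N -> rigid r n 1 -> (q <= n)%N ->
  (q <= 'C(n, 2) - exF F n)%N.
Proof.
move=> n2r n3r rig qn; have := exF_turan r2 n2r rig.
have [f <-] := turan_attained 'I_n (ltnW r2) => ef.
have := @card_Kpart_le _ _ f rat setT (ltnW r2).
rewrite cardsT card_ord (_ : arcs_in _ _ = arcs (Kpart f)); last first.
  by apply/setP => p; rewrite !inE !andbT.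
rewrite -ef => h.
have r0 : 0 < r%:R :> rat by rewrite ltr0n ltnW.
have {h} : (r * (2 * exF F n) + n ^ 2 <= r * n ^ 2)%N.
  rewrite -(ler_nat rat) natrD 2!(natrM _ r) natrX.
  have := ler_wpM2l (ltW r0) h; rewrite mulrA mulrBr mulr1 mulfV ?gt_eqF // mulrBl mul1r.
  by rewrite -lerBrDr.
have := mul_bin_diag n 1; rewrite bin1.
move: 'C(n, 2) (exF F n) => C X; clear -n3r qn r2; nia.
Qed.

(** One half of [eps] is spent on rigidity, the other on rounding [q] down to an integer. *)
Lemma qF_lower (eps : R) : 0 < eps -> exists N, forall n, (N <= n)%N ->
  c1 - eps <= (qF F n)%:R / n%:R.
Proof.
move=> eps0; have e20 : 0 < eps / 2 by rewrite divr_gt0.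
have [N1 h1] := rigid_large e20; have [N2 h2] := rigid_small; have [N3 h3] := nat_above (2 / eps).
exists (maxn (maxn N1 N2) (maxn N3 (3 * r))) => n; rewrite !geq_max => /andP[/andP[n1 n2] /andP[n3 n3r]].
have [rig0 rig1] := h2 n n2.
have n2r : (2 * r <= n)%N by clear -n3r; lia.
have n0 : 0 < n%:R :> R by rewrite ltr0n; clear -n3r r2; lia.
rewrite ler_pdivlMr //.
have [neg|pos] := leP (c1 - eps / 2) 0.
  apply: le_trans (ler0n _ _); rewrite nmulr_rle0 //; clear -neg eps0; lra.
pose q := Num.truncn ((c1 - eps / 2) * n%:R).
have x0 : 0 <= (c1 - eps / 2) * n%:R by rewrite mulr_ge0 ?ltW.
have /andP[q1 q2] := truncn_itv x0; rewrite -/q in q1 q2.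
have qn : (q <= n)%N.
  rewrite -(ler_nat R); apply: le_trans q1 _; rewrite ler_piMl ?ltW //.
  have : r%:R^-1 <= 1 :> R by rewrite invf_le1 ?ltr0n ?ler1n ltnW.
  have : 0 <= r%:R^-1 ^+ 2 :> R by rewrite sqr_ge0.
  clear -eps0; lra.
have hq : (q <= qF F n)%N.
  apply: qF_ge => // [|q' qq']; first exact: room_for_edges.
  by apply: h1 => //; apply: le_trans q1; rewrite ler_nat.
rewrite -(ler_nat R) in hq; apply: le_trans hq.
have := h3 n n3; rewrite ler_pdivrMr // => h.
rewrite -(@natr1 R q) in q2; clear -q2 h; lra.
Qed.

(** A liminf needs infinitely many [n] only, so [n = r * (r * p)] is taken: then [m = r * p], and
    [q = r.-1 * p + 4] satisfies [q * r = r.-1 * m + 4 * r] exactly. The bound [p >= 5] gives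
    [q < m]. *)
Lemma qF_upper_frequently (eps : R) : 0 < eps -> forall N, exists2 n, (N <= n)%N &
  (qF F n)%:R / n%:R <= c1 + eps.
Proof.
move=> eps0 N; have [N1 h1] := rigid_small; have [N2 h2] := nat_above (4 / eps).
pose p := maxn (maxn N N1) (maxn N2 5).
have : (p <= p)%N := leqnn p.
rewrite {1}/p !geq_max => /andP[/andP[pN pN1] /andP[pN2 p5]].
have pn : (p <= r * (r * p))%N by rewrite mulnA leq_pmull // muln_gt0 ltnW.
exists (r * (r * p))%N; first exact: leq_trans pn.
have [rig0 rig1] := h1 _ (leq_trans pN1 pn).
have r0 : 0 < r%:R :> R by rewrite ltr0n ltnW.
have p0 : 0 < p%:R :> R by rewrite ltr0n ltnW // ltnW // (leq_trans _ p5).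
have : (qF F (r * (r * p)) <= r.-1 * p + 4)%N.
  apply: qF_upper => //; clear -p5 r2; nia.
rewrite -(ler_nat R) => h; rewrite ler_pdivrMr ?ltr0n ?muln_gt0 ?(ltnW r2) -?(ltr0n R) //.
apply: le_trans h _.
have -> : (r.-1 * p + 4)%:R = (r%:R - 1) * p%:R + 4 :> R.
  by rewrite natrD natrM -subn1 natrB // ltnW.
have -> : (r * (r * p))%:R = r%:R * (r%:R * p%:R) :> R by rewrite 2!natrM.
have -> : (c1 + eps) * (r%:R * (r%:R * p%:R)) = (r%:R - 1) * p%:R + eps * p%:R * r%:R ^+ 2.
  by field; rewrite gt_eqF.
rewrite lerD2l; apply: le_trans (_ : eps * p%:R <= _).
  by rewrite -ler_pdivrMl // mulrC h2.
apply: ler_peMr; first by rewrite mulr_ge0 ?ltW.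
by rewrite exprn_ege1 // ler1n ltnW.
Qed.
End Asymptotics.

Local Close Scope ring_scope.

From mathcomp Require Import all_classical all_reals all_analysis.
Import Order.TTheory GRing.Theory Num.Theory.
Local Open Scope ring_scope.
Local Open Scope ereal_scope.

(** * The limit *)

Lemma limn_einf_eq (R : realType) (u : nat -> R) (l : R) :
  (forall e, (0 < e)%R -> exists N, forall n, (N <= n)%N -> (l - e <= u n)%R) ->
  (forall e, (0 < e)%R -> forall N, exists2 n, (N <= n)%N & (u n <= l + e)%R) ->
  limn_einf (fun n => (u n)%:E) = l%:E.
Proof.
move=> lower upper; rewrite limn_einf_lim (cvg_lim _ (@cvg_einfs_sup _ _)) //.
apply/le_anti/andP; split.
  apply: ge_ereal_sup => _ [N _ <-]; apply/lee_addgt0Pr => e e0.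
  have [n Nn le] := upper e e0 N; rewrite -EFinD; apply: le_trans (_ : (u n)%:E <= _).
    by apply: ereal_inf_lbound; exists n.
  by rewrite lee_fin.
apply/lee_subgt0Pr => e e0; have [N hN] := lower e e0.
apply: le_trans (_ : einfs (fun n => (u n)%:E) N <= _); last by apply: ereal_sup_ubound; exists N.
by apply: le_ereal_inf_tmp => _ [n Nn <-]; rewrite -EFinB lee_fin hN.
Qed.

(* c_1(F) = liminf_{n -> oo} q_F(n)/n = (r-1)/r^2 for F = K_{r+2} - e, r >= 2 *)
Theorem theorem4 (R : realType) (r : nat) (hr : (2 <= r)%N) :
  limn_einf (fun n : nat => (((qF (K_minus_e r) n)%:R / n%:R : R)%:E)) =
  (((r - 1)%:R / (r ^ 2)%:R : R)%:E).
Proof.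
have -> : ((r - 1)%:R / (r ^ 2)%:R = r%:R^-1 - r%:R^-1 ^+ 2 :> R)%R.
  by rewrite natrX natrB ?(ltnW hr) //; field; rewrite pnatr_eq0 -lt0n ltnW.
apply: limn_einf_eq => e e0; first exact: qF_lower.
by move=> N; apply: qF_upper_frequently.
Qed.
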